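(* Let $m>0$ and let $p_1,p_2,q\in L^2(\mathbb{R}_+)$ be real-valued with $\operatorname{supp}V:=\operatorname{supp}p_1\cup\operatorname{supp}p_2\cup\operatorname{supp}q\subset[0,\gamma]$, $\gamma=\sup\operatorname{supp}V>0$. Let $H=\begin{pmatrix} m+p_1&-\partial_x+q\\ \partial_x+q&-m+p_2\end{pmatrix}$ in $L^2(\mathbb{R}_+)\oplus L^2(\mathbb{R}_+)$ with the boundary condition $f_1(0)=0$. Then: 1) Let $\lambda^{(1)}\in g_+$ be an eigenvalue of $H$ and let $\lambda^{(2)}\in g_-$ be the same number but on the non-physical sheet. Then $\lambda^{(2)}$ is not an anti-bound state. 2) Let $\lambda_1<\lambda_2$ be eigenvalues of $H$ and assume that there are no other eigenvalues on the interval $(\lambda_1,\lambda_2)\subset g_+$. Let $\Omega\subset g_-$ be the same interval but on the non-physical sheet. Then there exists an odd number $\ge1$ of anti-bound states, counted with multiplicities, on $\Omega$.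
   Context: $\mathbb{R}_+=[0,\infty)$, $\mathbb{C}_\pm=\{\pm\operatorname{Im}\lambda>0\}$, $V=\begin{pmatrix} p_1 & q \\ q & p_2 \end{pmatrix}$. $H_0$ denotes $H$ with $V=0$; $\sigma_{\rm ac}(H_0)=\mathbb{R}\setminus(-m,m)$. $H$ is self-adjoint, its absolutely continuous spectrum is $\mathbb{R}\setminus(-m,m)$, and it has finitely many simple eigenvalues in the gap $(-m,m)$. The cut plane. Let $\Lambda=\mathbb{C}\setminus[-m,m]$ and $k(\lambda)=\sqrt{\lambda^2-m^2}$ on $\Lambda$, with the branch $k(\lambda)=\lambda+O(1/\lambda)$ as $|\lambda|\to\infty$ (so $\operatorname{Im}k>0$ on $\mathbb{C}_+$). Let $g_+$, $g_-$ be the upper and lower rims of the cut $(-m,m)$ in $\mathbb{C}\setminus[-m,m]$, and $\Lambda_\pm=\mathbb{C}_\pm\cup g_\pm$. $\Lambda_+$ represents the physical sheet and $\Lambda_-$ the non-physical sheet of the two-sheeted Riemann surface of $\sqrt{\lambda^2-m^2}$. Functions are first defined on $\mathbb{C}_+$ and then continued analytically (meromorphically) into $\Lambda$ through $\sigma_{\rm ac}(H_0)$, up to and including the rims $g_\pm$, where they are regarded as functions near the corresponding points of the Riemann surface. States. For $h\in C_0(\mathbb{R}_+,\mathbb{C}^2)$ (continuous, compactly supported), $G(\lambda)=((H-\lambda)^{-1}h,h)$, $\lambda\in\mathbb{C}_+$, has a meromorphic continuation from $\mathbb{C}_+$ into $\Lambda$ through $\sigma_{\rm ac}(H_0)$.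 $\lambda_0\in g_+$ is an eigenvalue if $G$ has a pole at $\lambda_0$ for some $h\neq0$. $\lambda_0\in\Lambda_-$ is a resonance if $G$ has a pole at $\lambda_0$ for some $h\ne0$; if moreover $\lambda_0\in g_-$, it is called an anti-bound state. The multiplicity of an eigenvalue or resonance is the multiplicity of the corresponding pole (the largest order attained over $h$). *)

(* Defs.v *)
From HB Require Import structures.
From mathcomp Require Import all_boot all_order all_algebra.
From mathcomp Require Import complex.
From mathcomp Require Import all_classical all_reals all_analysis.
Set Implicit Arguments.
Unset Strict Implicit.
Unset Printing Implicit Defensive.
Import Order.TTheory GRing.Theory Num.Theory.
Import numFieldNormedType.Exports.
Local Open Scope classical_set_scope.
Local Open Scope ring_scope.
Local Open Scope complex_scope.

(* The carrier [R[i]^o] (rather than [R[i]]) gives access to the topology and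
   to the [R[i]]-normed module structure, hence to complex derivatives. *)
Notation Cplx R := ((R[i])^o).

Section Functions.
Context {R : realType}.
Local Notation C := (Cplx R).
Local Notation mu := (@lebesgue_measure R).

Definition halfline : set R := `[0, +oo[%classic.

Definition L2real (f : R -> R) : Prop := f \_ halfline \in Lfun mu 2%:E.

Definition L2 (f : R -> C) : Prop :=
  L2real (fun x => complex.Re (f x)) /\ L2real (fun x => complex.Im (f x)).

Definition integrableC (D : set R) (f : R -> C) : Prop :=
  mu.-integrable D (EFin \o (fun x => complex.Re (f x))) /\
  mu.-integrable D (EFin \o (fun x => complex.Im (f x))).

Definition integralC (D : set R) (f : R -> C) : C :=
  (\int[mu]_(x in D) complex.Re (f x)) +i* (\int[mu]_(x in D) complex.Im (f x)).

(* Support in the sense of L^2 classes (distributions) on the half-line: the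
   complement of the largest relatively open set on which [p] vanishes a.e. *)
Definition esssupport (p : R -> R) : set R :=
  [set x | forall e, 0 < e ->
     (0 < mu (ball x e `&` halfline `&` [set y | p y != 0%R]))%E].

Definition suppV (p1 p2 q : R -> R) : set R :=
  esssupport p1 `|` esssupport p2 `|` esssupport q.

(* [u] is locally absolutely continuous on [0, +oo[ with derivative [v] a.e.,
   i.e. [u] is the primitive of the locally integrable function [v]. *)
Definition AC_deriv (u v : R -> C) : Prop :=
  forall x, 0 <= x ->
    integrableC `[0, x]%classic v /\ u x = u 0 + integralC `[0, x]%classic v.

(* Only the values on the half-line matter. *)
Definition C0 (h : R -> C * C) : Prop :=
  {within halfline, continuous h} /\ exists b, forall x, b <= x -> h x = 0.

Definition nonzero (h : R -> C * C) : Prop := exists2 x, 0 <= x & h x != 0.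

Definition inner (f g : R -> C * C) : C :=
  integralC halfline
    (fun x => (f x).1 * ((g x).1)^* + (f x).2 * ((g x).2)^*).

End Functions.

Section Meromorphic.
Context {R : realType}.
Local Notation C := (Cplx R).

Definition holomorphic_at (f : C -> C) (z : C) : Prop :=
  \forall w \near z, derivable f w 1.

(* The value of [f] at [z] itself is irrelevant in the next two definitions. *)
Definition meromorphic_at (f : C -> C) (z : C) : Prop :=
  exists n (g : C -> C), holomorphic_at g z /\
    \forall w \near z^', f w = g w / (w - z) ^+ n.

Definition has_pole (f : C -> C) (z : C) (n : nat) : Prop :=
  (0 < n)%N /\
  exists g : C -> C, [/\ holomorphic_at g z, g z != 0 &
    \forall w \near z^', f w = g w / (w - z) ^+ n].

End Meromorphic.

Section Dirac.
Context {R : realType}.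
Local Notation C := (Cplx R).
Local Notation mu := (@lebesgue_measure R).
Variables (m : R) (p1 p2 q : R -> R).

(* Graph of [H] on its maximal domain with boundary condition [u_1(0) = 0]:
   [u] is in the domain and [H u = g]. *)
Definition dirac_graph (u g : R -> C * C) : Prop :=
  [/\ L2 (fun x => (u x).1) /\ L2 (fun x => (u x).2),
      L2 (fun x => (g x).1) /\ L2 (fun x => (g x).2),
      (u 0).1 = 0 &
      exists v : R -> C * C,
      [/\ AC_deriv (fun x => (u x).1) (fun x => (v x).1),
          AC_deriv (fun x => (u x).2) (fun x => (v x).2) &
          {ae mu, forall x, 0 <= x ->
             (g x).1 = (m + p1 x)%:C * (u x).1 + (- (v x).2 + (q x)%:C * (u x).2)
             /\
             (g x).2 = ((v x).1 + (q x)%:C * (u x).1) + (- m + p2 x)%:C * (u x).2}]].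

(* The solution [u] of [(H - lambda) u = h], written [H u = h + lambda u]; its
   representative is unique on the half-line when [lambda] is not real. *)
Definition resolvent (lambda : C) (h : R -> C * C) : R -> C * C :=
  xget (fun=> 0) [set u | dirac_graph u (fun x => h x + lambda *: u x)].

Definition G (h : R -> C * C) (lambda : C) : C := inner (resolvent lambda h) h.

Definition Lambda : set C :=
  ~` [set z : C | complex.Im z = 0 /\ - m <= complex.Re z <= m].

Definition continuation (h : R -> C * C) (F : C -> C) : Prop :=
  (forall z, Lambda z -> meromorphic_at F z) /\
  (forall z : C, 0 < complex.Im z -> F z = G h z).

Inductive sheet := physical | nonphysical.

Definition half_plane (s : sheet) : set C :=
  match s with
  | physical => [set z : C | 0 < complex.Im z]
  | nonphysical => [set z : C | complex.Im z < 0]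
  end.

Definition in_gap (x : R) : Prop := - m < x < m.

(* The half-plane of the sheet together with the rim of the cut bounding it;
   rim points are represented by the underlying numbers, the sheet being kept
   as a separate parameter. *)
Definition Lambda_ (s : sheet) : set C :=
  half_plane s `|` [set x%:C | x in in_gap].

(* The continuation of [G h], regarded as a function near the point [z] of
   [Lambda_ s], has a pole of order [n] at [z].  The function [Phi] represents
   its germ there: for [z] on the rim it extends across the cut, staying on
   the same sheet of the Riemann surface, what the continuation is on the
   half-plane bounded by the rim. *)
Definition pole (s : sheet) (h : R -> C * C) (z : C) (n : nat) : Prop :=
  exists F Phi : C -> C,
    [/\ continuation h F,
        \forall w \near z, half_plane s w -> Phi w = F w &
        has_pole Phi z n].

Definition state (s : sheet) (z : C) : Prop :=
  exists h n, [/\ C0 h, nonzero h & pole s h z n].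

Definition dirac_eigenvalue (x : R) : Prop := in_gap x /\ state physical x%:C.

Definition dirac_resonance (z : C) : Prop :=
  Lambda_ nonphysical z /\ state nonphysical z.

Definition antibound_state (x : R) : Prop := in_gap x /\ dirac_resonance x%:C.

Definition pole_multiplicity (s : sheet) (z : C) (n : nat) : Prop :=
  (exists h, [/\ C0 h, nonzero h & pole s h z n]) /\
  (forall h k, C0 h -> nonzero h -> pole s h z k -> (k <= n)%N).

End Dirac.

(* Main.v *)
(** Let phi(x, lam) solve the Dirac system with phi(0) = (0, 1), let
    s^2 = m^2 - lam^2 and D_s(lam) = phi_1(gamma) s - phi_2(gamma) (lam + m).  The
    resolvent is a meromorphic function of lam and s with denominator D_s, where
    s = - kappa on the physical sheet and s = kappa on the other one near the gap,
    kappa being the root with positive real part.  Testing with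
    h(t) = (gamma - t)_+ phi(t, x) shows that a number x of the gap is a state exactly
    when D_s(x) = 0, with multiplicity the order of this zero.

    If both D_{-kappa}(x) and D_kappa(x) vanish then phi(gamma, x) = 0, which is
    impossible.  At a zero x of D_{-kappa}, Lagrange's identity gives
    phi_1(gamma, x) D_{-kappa}(y) (y - x) > 0 for y close to x; so phi_1(gamma, .) has
    opposite signs at consecutive eigenvalues, and so has D_kappa, which equals
    2 kappa phi_1(gamma, .) there.  Hence D_kappa has an odd number of zeros in
    between. *)
Require Import Defs.
From HB Require Import structures.
From mathcomp Require Import all_boot all_order all_algebra.
From mathcomp Require Import complex.
From mathcomp Require Import all_classical all_reals all_analysis.
From mathcomp Require Import measurable_realfun ring lra.
Set Implicit Arguments.
Unset Strict Implicit.
Unset Printing Implicit Defensive.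
Import Order.TTheory GRing.Theory Num.Theory.
Import numFieldNormedType.Exports.
Local Open Scope classical_set_scope.
Local Open Scope ring_scope.
Local Open Scope complex_scope.

(** * Complex numbers with the l1-norm *)

(** The obstacle is that [pole] speaks of every continuation [F] and every germ [Phi] of it across
    the rim, whereas the computation concerns one explicit quotient. Passing from one to the other
    is a uniqueness statement for meromorphic germs, and this is what the complex analysis is for:
    Goursat's lemma and Cauchy's formula on squares yield the order of a zero and the identity
    theorem, with no power series. The potential is merely square integrable, so solutions are only
    absolutely continuous; Gronwall bounds in terms of the integral of a weight replace uniform
    Lipschitz bounds, and they also give holomorphy in [lam]. A function [h] may live beyond
    [gamma], so the quotient is formed at some [b >= gamma]; between [gamma] and [b] its denominator
    changes only by a nonvanishing factor. The sign extracted from Lagrange's identity rests on two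
    facts: the integral of [phi] squared is positive, and [kappa / (x + m) = sqrt ((m - x) / (m +
    x))] decreases on the gap. *)

Notation Re := complex.Re.
Notation Im := complex.Im.

Section L1norm.
Context {R : realType}.
Local Notation C := (Cplx R).
Implicit Types z w : C.

Lemma CP z w : Re z = Re w -> Im z = Im w -> z = w.
Proof. by case: z w => a b [c d] /= -> ->. Qed.
Lemma ReD z w : Re (z + w) = Re z + Re w. Proof. by case: z w => a b [c d]. Qed.
Lemma ImD z w : Im (z + w) = Im z + Im w. Proof. by case: z w => a b [c d]. Qed.
Lemma ReN z : Re (- z) = - Re z. Proof. by case: z. Qed.
Lemma ImN z : Im (- z) = - Im z. Proof. by case: z. Qed.
Lemma ReM z w : Re (z * w) = Re z * Re w - Im z * Im w.
Proof. by case: z w => a b [c d]. Qed.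
Lemma ImM z w : Im (z * w) = Re z * Im w + Im z * Re w.
Proof. by case: z w => a b [c d]. Qed.
Definition ReImE := (ReD, ImD, ReN, ImN, ReM, ImM).

(** The norm of [R[i]] is complex-valued and compared by a partial order; this equivalent norm is
    real, which keeps estimates within reach of [lra]. It is only submultiplicative. *)
Definition n1 z : R := `|Re z| + `|Im z|.

Lemma n1_ge0 z : 0 <= n1 z. Proof. by rewrite addr_ge0. Qed.
Lemma n1_0 : n1 0 = 0. Proof. by rewrite /n1 /= normr0 addr0. Qed.
Lemma n1N z : n1 (- z) = n1 z. Proof. by rewrite /n1 !ReImE !normrN. Qed.
Lemma n1_dist z w : n1 (z - w) = n1 (w - z). Proof. by rewrite -n1N opprB. Qed.
Lemma n1D z w : n1 (z + w) <= n1 z + n1 w.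
Proof.
rewrite /n1 !ReImE.
have := ler_normD (Re z) (Re w); have := ler_normD (Im z) (Im w); lra.
Qed.
Lemma n1B z w : n1 (z - w) <= n1 z + n1 w.
Proof. by rewrite (le_trans (n1D _ _))// n1N. Qed.
Lemma n1M z w : n1 (z * w) <= n1 z * n1 w.
Proof.
rewrite /n1 !ReImE.
have := ler_normB (Re z * Re w) (Im z * Im w).
have := ler_normD (Re z * Im w) (Im z * Re w).
rewrite !normrM; lra.
Qed.
Lemma n1_real (a : R) : n1 a%:C = `|a|.
Proof. by rewrite /n1 /= normr0 addr0. Qed.
Lemma n1_realM (a : R) z : n1 (a%:C * z) = `|a| * n1 z.
Proof. by rewrite /n1 !ReImE /= !mul0r subr0 addr0 !normrM mulrDr. Qed.
Lemma n1_eq0 z : n1 z <= 0 -> z = 0.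
Proof.
rewrite /n1 => h; have := normr_ge0 (Re z); have := normr_ge0 (Im z) => h1 h2.
by apply: CP; apply/eqP; rewrite -normr_eq0; apply/eqP => /=; lra.
Qed.
Lemma n1_gt0 z : z != 0 -> 0 < n1 z.
Proof.
by move=> z0; rewrite ltNge; apply/negP => /n1_eq0 h; rewrite h eqxx in z0.
Qed.
(* [z^*] parses as [Num.conj] or as [conjc] depending on the scope. *)
Definition cj z : C := Re z -i* Im z.
Lemma cjE z : Num.conj z = cj z.
Proof. by case: z. Qed.
Lemma cjD z w : cj (z + w) = cj z + cj w.
Proof. by apply: CP; rewrite /= !ReImE /=; ring. Qed.
Lemma cjM z w : cj (z * w) = cj z * cj w.
Proof. by apply: CP; rewrite /= !ReImE /=; ring. Qed.
Lemma cjN z : cj (- z) = - cj z.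
Proof. by apply: CP; rewrite /= !ReImE. Qed.
Lemma cjR (x : R) : cj x%:C = x%:C.
Proof. by apply: CP; rewrite /= ?oppr0. Qed.
Lemma cj0 : cj 0 = 0. Proof. exact: (cjR 0). Qed.
Lemma n1_conj z : n1 (cj z) = n1 z.
Proof. by case: z => a b; rewrite /n1 /= normrN. Qed.
Lemma n1X z n : n1 (z ^+ n) <= n1 z ^+ n.
Proof.
elim: n => [|n IH]; first by rewrite !expr0 /n1 /= normr1 normr0 addr0.
rewrite !exprS (le_trans (n1M _ _))// ler_wpM2l// n1_ge0//.
Qed.
(** Exactly, [n1 z^-1] is [n1 z] divided by the squared modulus, and [n1 z ^+ 2] is at most twice
    that squared modulus. The factors 2 in the later kernel bounds come from here. *)
Lemma n1V z : n1 z^-1 <= 2 / n1 z.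
Proof.
have [->|z0] := eqVneq z 0; first by rewrite invr0 n1_0 invr0 mulr0.
have p : 0 < n1 z by exact: n1_gt0.
case: z z0 p => a b z0; rewrite /n1 /= => p.
have q : 0 < a ^+ 2 + b ^+ 2.
  rewrite lt_neqAle eq_sym addr_ge0 ?sqr_ge0// andbT.
  apply: contra z0 => /eqP h.
  have [ha hb] : a ^+ 2 = 0 /\ b ^+ 2 = 0.
    by have := sqr_ge0 a; have := sqr_ge0 b; lra.
  by rewrite eq_complex /= -!(sqrf_eq0 a) -!(sqrf_eq0 b) ha hb eqxx.
rewrite ?mulNr normrN !normrM !normfV (ger0_norm (ltW q)).
rewrite -mulrDl ler_pdivrMr// mulrAC ler_pdivlMr//.
have -> : a ^+ 2 = `|a| ^+ 2 by rewrite real_normK ?num_real.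
have -> : b ^+ 2 = `|b| ^+ 2 by rewrite real_normK ?num_real.
have := sqr_ge0 (`|a| - `|b|); nra.
Qed.
Lemma Re_le_n1 z : `|Re z| <= n1 z. Proof. by rewrite lerDl. Qed.
Lemma Im_le_n1 z : `|Im z| <= n1 z. Proof. by rewrite lerDr. Qed.

Lemma normCE z : `|z| = (Num.sqrt (Re z ^+ 2 + Im z ^+ 2))%:C.
Proof. by case: z. Qed.

Lemma norm_le_n1 z : `|z| <= (n1 z)%:C.
Proof.
rewrite normCE lecR -(ger0_norm (n1_ge0 z)) -sqrtr_sqr.
rewrite ler_sqrt ?sqr_ge0//.
have -> : Re z ^+ 2 = `|Re z| ^+ 2 by rewrite real_normK ?num_real.
have -> : Im z ^+ 2 = `|Im z| ^+ 2 by rewrite real_normK ?num_real.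
rewrite /n1; have := normr_ge0 (Re z); have := normr_ge0 (Im z); nra.
Qed.

Lemma n1_le_norm z : (n1 z)%:C <= 2 * `|z|.
Proof.
have -> : 2 * `|z| = (2 * Num.sqrt (Re z ^+ 2 + Im z ^+ 2))%:C.
  by rewrite normCE rmorphM rmorph_nat.
rewrite lecR.
have h1 : `|Re z| <= Num.sqrt (Re z ^+ 2 + Im z ^+ 2).
  by rewrite -sqrtr_sqr ler_sqrt ?addr_ge0 ?sqr_ge0// lerDl sqr_ge0.
have h2 : `|Im z| <= Num.sqrt (Re z ^+ 2 + Im z ^+ 2).
  by rewrite -sqrtr_sqr ler_sqrt ?addr_ge0 ?sqr_ge0// lerDr sqr_ge0.
rewrite /n1; lra.
Qed.

(** The bridge from the topology of [R[i]]: limits, continuity and derivatives become statements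
    with real radii. *)
Lemma nearC (P : set C) z :
  (\forall w \near z, P w) <->
  exists2 e : R, 0 < e & forall w, n1 (w - z) < e -> P w.
Proof.
split.
  move=> /nbhs_normP[e /= e0 h].
  move: e0; rewrite ltcE /= => /andP[/eqP eI eR].
  exists (Re e) => // w we; apply: h => /=.
  rewrite -normrN opprB (le_lt_trans (norm_le_n1 _))//.
  by rewrite ltcE /= eI eqxx /=.
move=> [e e0 h]; apply/nbhs_normP; exists (e / 2)%:C => /=.
  by rewrite ltcR divr_gt0.
move=> w /= we; apply: h; rewrite -ltcR (le_lt_trans (n1_le_norm _))//.
rewrite -normrN opprB -ltr_pdivlMl//.
have -> // : 2^-1 * e%:C = (e / 2)%:C :> R[i].
by rewrite mulrC rmorphM fmorphV rmorph_nat.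
Qed.

Lemma dnearC (P : set C) z :
  (\forall w \near z^', P w) <->
  exists2 e : R, 0 < e & forall w, w != z -> n1 (w - z) < e -> P w.
Proof.
rewrite /dnbhs /within; split.
  by move=> /nearC[e e0 h]; exists e => // w wz we; apply: h.
by move=> [e e0 h]; apply/nearC; exists e => // w we wz; apply: h.
Qed.

Lemma cvgC (f : C -> C) (F : set_system C) {FF : Filter F} (l : C) :
  f @ F --> l <->
  forall e : R, 0 < e -> \forall w \near F, n1 (f w - l) < e.
Proof.
split.
  move=> h e e0.
  have hn : nbhs l [set y | n1 (y - l) < e] by apply/nearC; exists e.
  exact: (h _ hn).
move=> h A /nearC[e e0 hA]; have := h e e0.
by apply: filterS => w; exact: hA.
Qed.

Lemma continuousCP (f : C -> C) z :
  {for z, continuous f} <->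
  forall e : R, 0 < e -> exists2 d : R, 0 < d &
    forall w, n1 (w - z) < d -> n1 (f w - f z) < e.
Proof.
split=> [h e e0|h].
  exact: ((nearC _ _).1 ((cvgC f _).1 h e e0)).
by apply/(@cvgC f (nbhs z) _ (f z)) => e e0; apply/nearC; exact: h.
Qed.

(** Multiplying the difference quotient out removes both the division and the punctured
    neighbourhood. *)
Lemma derivableCP (f : C -> C) z :
  derivable f z 1 <->
  exists d : C, forall e : R, 0 < e -> exists2 t : R, 0 < t &
    forall w, n1 (w - z) < t -> n1 (f w - f z - d * (w - z)) <= e * n1 (w - z).
Proof.
rewrite /derivable; split.
  move=> /cvg_ex[d /cvgC h]; exists d => e e0.
  have /dnearC[t t0 ht] := h e e0; exists t => // w wt.
  have [->|wz] := eqVneq w z.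
    by rewrite !subrr mulr0 subrr n1_0 mulr0.
  have := ht (w - z); rewrite subr_eq0 subr0 => /(_ wz wt) /=.
  rewrite /GRing.scale /= mulr1 subrK => h1.
  have -> : f w - f z - d * (w - z) = ((w - z)^-1 * (f w - f z) - d) * (w - z).
    by field; rewrite subr_eq0.
  by rewrite (le_trans (n1M _ _))// ler_wpM2r ?n1_ge0// ltW.
move=> [d h]; apply/cvg_ex; exists d; apply/cvgC => e e0.
(* Dividing back by [k] costs the factor 2 of [n1V], which leaves [e / 2 < e]. *)
have e40 : 0 < e / 4 by rewrite divr_gt0.
have [t t0 ht] := h _ e40.
apply/dnearC; exists t => // k k0; rewrite subr0 => kt.
rewrite /GRing.scale /= mulr1.
have := ht (k + z); rewrite addrK => /(_ kt) h1.
have -> : k^-1 * (f (k + z) - f z) - d = k^-1 * (f (k + z) - f z - d * k).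
  by field.
have p := n1_gt0 k0.
apply: (le_lt_trans (n1M _ _)).
apply: (@le_lt_trans _ _ (2 / n1 k * (e / 4 * n1 k))).
  by rewrite ler_pM ?n1_ge0// n1V.
by have -> : 2 / n1 k * (e / 4 * n1 k) = e / 2; [field; rewrite gt_eqF|lra].
Qed.

(** Cauchy integrals and solutions of the Dirac system come with an explicit quadratic remainder;
    this turns it into differentiability. *)
Lemma derivable_quad (f : C -> C) z (d : C) (K t : R) : 0 < t ->
  (forall w, n1 (w - z) < t ->
     n1 (f w - f z - d * (w - z)) <= K * n1 (w - z) ^+ 2) ->
  derivable f z 1.
Proof.
move=> t0 h; apply/derivableCP; exists d => e e0.
have K0 : 0 < `|K| + 1 by rewrite ltr_wpDl.
exists (Num.min t (e / (`|K| + 1))); first by rewrite lt_min t0 divr_gt0.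
move=> w; rewrite lt_min => /andP[wt we]; apply: (le_trans (h w wt)).
rewrite expr2 mulrA ler_wpM2r ?n1_ge0//.
apply: (@le_trans _ _ ((`|K| + 1) * n1 (w - z))).
  by rewrite ler_wpM2r ?n1_ge0//; have := ler_norm K; lra.
by rewrite mulrC -ler_pdivlMr// ltW.
Qed.

Lemma derB (f g : C -> C) z : derivable f z 1 -> derivable g z 1 ->
  derivable (fun w => f w - g w) z 1.
Proof.
move=> /derivableCP[D hD] /derivableCP[E hE]; apply/derivableCP.
exists (D - E) => e e0; have e20 : 0 < e / 2 by rewrite divr_gt0.
have [d1 d10 k1] := hD _ e20; have [d2 d20 k2] := hE _ e20.
exists (Num.min d1 d2); first by rewrite lt_min d10.
move=> w; rewrite lt_min => /andP[/k1 l1 /k2 l2].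
have -> : f w - g w - (f z - g z) - (D - E) * (w - z) =
  (f w - f z - D * (w - z)) - (g w - g z - E * (w - z)) by ring.
by apply: (le_trans (n1B _ _)); have := n1_ge0 (w - z); lra.
Qed.

Lemma der_cst (k z : C) : derivable (fun=> k) z 1.
Proof.
apply/derivableCP; exists 0 => e e0; exists 1 => // w _.
by rewrite subrr mul0r subrr n1_0 mulr_ge0 ?n1_ge0// ltW.
Qed.

Lemma der_id (z : C) : derivable (fun w : C => w) z 1.
Proof.
apply/derivableCP; exists 1 => e e0; exists 1 => // w _.
by rewrite mul1r subrr n1_0 mulr_ge0 ?n1_ge0// ltW.
Qed.

Lemma derM (f g : C -> C) z : derivable f z 1 -> derivable g z 1 ->
  derivable (fun w => f w * g w) z 1.
Proof. exact: (@derivableM _ _ f g z 1). Qed.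

Lemma derV (f : C -> C) z : derivable f z 1 -> f z != 0 ->
  derivable (fun w => (f w)^-1) z 1.
Proof. by move=> h f0; exact: derivableV. Qed.

Lemma derN (f : C -> C) z : derivable f z 1 -> derivable (fun w => - f w) z 1.
Proof.
move=> h; have := derB (@der_cst 0 z) h.
by under eq_fun do rewrite sub0r.
Qed.

Lemma derD (f g : C -> C) z : derivable f z 1 -> derivable g z 1 ->
  derivable (fun w => f w + g w) z 1.
Proof.
move=> h1 h2; have := derB h1 (derN h2).
by under eq_fun do rewrite opprK.
Qed.

Lemma derX (f : C -> C) z n : derivable f z 1 -> derivable (fun w => f w ^+ n) z 1.
Proof.
move=> h; elim: n => [|n IH].
  by under eq_fun do rewrite expr0; exact: der_cst.
by under eq_fun do rewrite exprS; exact: derM.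
Qed.

Lemma der_ext (f g : C -> C) z : (exists2 e : R, 0 < e &
    forall w, n1 (w - z) < e -> f w = g w) ->
  derivable f z 1 -> derivable g z 1.
Proof.
move=> [e e0 h] /derivableCP[D hD]; apply/derivableCP; exists D => k k0.
have [t t0 ht] := hD k k0; exists (Num.min e t); first by rewrite lt_min e0.
move=> w; rewrite lt_min => /andP[we wt]; rewrite -!h// ?subrr ?n1_0//.
exact: ht.
Qed.

Lemma derivable_cont (f : C -> C) z : derivable f z 1 -> {for z, continuous f}.
Proof. by move=> /derivable1_diffP/differentiable_continuous. Qed.

Lemma near_ne0 (f : C -> C) z : {for z, continuous f} -> f z != 0 ->
  exists2 e : R, 0 < e & forall w, n1 (w - z) < e -> f w != 0.
Proof.
move=> /continuousCP h fz; have [d d0 hd] := h _ (n1_gt0 fz).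
exists d => // w /hd; apply: contraTneq => ->.
by rewrite sub0r n1N ltxx.
Qed.

End L1norm.
Arguments der_cst {R} k z.
Arguments der_id {R} z.

(** * Integration of complex-valued functions *)

Section ComplexIntegral.
Context {R : realType}.
Local Notation C := (Cplx R).
Local Notation mu := (@lebesgue_measure R).
Local Notation meas A := (measurable (A : set (measurableTypeR R))).
Local Notation mfun A g := (measurable_fun (A : set (measurableTypeR R)) g).
Implicit Types (D : set R) (f g : R -> C) (a b c : R).

Lemma eq_integralC D f g : (forall x, D x -> f x = g x) ->
  integralC D f = integralC D g.
Proof.
move=> fg; apply: CP => /=; apply: eq_Rintegral => x /set_mem Dx; by rewrite fg.
Qed.

Lemma eq_integrableC D f g : meas D -> (forall x, D x -> f x = g x) ->
  integrableC D f -> integrableC D g.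
Proof.
move=> mD fg [h1 h2]; split.
  by apply: eq_integrable h1 => // x /set_mem Dx /=; rewrite fg.
by apply: eq_integrable h2 => // x /set_mem Dx /=; rewrite fg.
Qed.

Lemma integrableCS D E f : meas D -> meas E -> E `<=` D ->
  integrableC D f -> integrableC E f.
Proof. by move=> mD mE ED [h1 h2]; split; [exact: integrableS h1|exact: integrableS h2]. Qed.

Lemma integrable_add D (f g : R -> R) : meas D ->
  mu.-integrable D (EFin \o f) -> mu.-integrable D (EFin \o g) ->
  mu.-integrable D (EFin \o (fun x => f x + g x)).
Proof.
move=> mD h1 h2; have := integrableD mD h1 h2.
by apply: eq_integrable => // x _ /=.
Qed.

Lemma integrable_sub D (f g : R -> R) : meas D ->
  mu.-integrable D (EFin \o f) -> mu.-integrable D (EFin \o g) ->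
  mu.-integrable D (EFin \o (fun x => f x - g x)).
Proof.
move=> mD h1 h2; have := integrableB mD h1 h2.
by apply: eq_integrable => // x _ /=.
Qed.

Lemma integrable_scale D (f : R -> R) (k : R) : meas D ->
  mu.-integrable D (EFin \o f) ->
  mu.-integrable D (EFin \o (fun x => k * f x)).
Proof.
move=> mD h1; have := integrableZl mD k h1.
by apply: eq_integrable => // x _ /=.
Qed.

Lemma integrable_absR D (f : R -> R) : meas D ->
  mu.-integrable D (EFin \o f) ->
  mu.-integrable D (EFin \o (fun x => `|f x|)).
Proof. by move=> mD h1; have := integrable_norm h1. Qed.

Lemma integrableCD D f g : meas D -> integrableC D f -> integrableC D g ->
  integrableC D (fun x => f x + g x).
Proof.
move=> mD [f1 f2] [g1 g2]; split.
  by apply: eq_integrable (integrable_add mD f1 g1) => // x _ /=; rewrite ReD.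
by apply: eq_integrable (integrable_add mD f2 g2) => // x _ /=; rewrite ImD.
Qed.

Lemma integrableCZ D f (k : C) : meas D -> integrableC D f ->
  integrableC D (fun x => k * f x).
Proof.
move=> mD [f1 f2]; split.
  have := integrable_sub mD (integrable_scale (Re k) mD f1)
    (integrable_scale (Im k) mD f2).
  by apply: eq_integrable => // x _ /=; rewrite ReM.
have := integrable_add mD (integrable_scale (Re k) mD f2)
  (integrable_scale (Im k) mD f1).
by apply: eq_integrable => // x _ /=; rewrite ImM.
Qed.

Lemma integrableCB D f g : meas D -> integrableC D f -> integrableC D g ->
  integrableC D (fun x => f x - g x).
Proof.
move=> mD h1 h2; have := integrableCD mD h1 (integrableCZ (-1) mD h2).
by apply: eq_integrableC => // x _; rewrite mulN1r.
Qed.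

Lemma integralCD D f g : meas D -> integrableC D f -> integrableC D g ->
  integralC D (fun x => f x + g x) = integralC D f + integralC D g.
Proof.
move=> mD [f1 f2] [g1 g2]; apply: CP; rewrite ?ReD ?ImD /=.
  rewrite -RintegralD//; apply: eq_Rintegral => x _; exact: ReD.
rewrite -RintegralD//; apply: eq_Rintegral => x _; exact: ImD.
Qed.

Lemma integralCZ D f (k : C) : meas D -> integrableC D f ->
  integralC D (fun x => k * f x) = k * integralC D f.
Proof.
move=> mD [f1 f2]; have sc := integrable_scale _ mD.
apply: CP; rewrite ?ReM ?ImM /=.
  rewrite -!RintegralZl// -RintegralB//; [|exact: sc|exact: sc].
  by apply: eq_Rintegral => x _; exact: ReM.
rewrite -!RintegralZl// -RintegralD//; [|exact: sc|exact: sc].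
by apply: eq_Rintegral => x _; exact: ImM.
Qed.

Lemma integralCB D f g : meas D -> integrableC D f -> integrableC D g ->
  integralC D (fun x => f x - g x) = integralC D f - integralC D g.
Proof.
move=> mD h1 h2; rewrite -mulN1r -integralCZ// -integralCD//.
  by apply: eq_integralC => x _; rewrite mulN1r.
exact: integrableCZ.
Qed.

Lemma integralC0 D : integralC D (fun=> 0 : C) = 0.
Proof.
by apply: CP => /=; rewrite /Rintegral integral0_eq.
Qed.

Lemma Rintegral_split (f : R -> R) a b c : a <= b -> b <= c ->
  mu.-integrable `[a, c] (EFin \o f) ->
  \int[mu]_(x in `[a, c]) f x =
  \int[mu]_(x in `[a, b]) f x + \int[mu]_(x in `[b, c]) f x.
Proof.
move=> ab bc h; have := @Rintegral_itvB R f (BLeft a) (BRight c) b h.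
rewrite !bnd_simp => /(_ ab bc) h1.
rewrite -(@Rintegral_itv_obnd_cbnd _ b (BRight c)).
  by rewrite -h1 addrC subrK.
apply: integrableS h => //.
by apply: subset_itvr; rewrite bnd_simp.
Qed.

Lemma sub_itvcc (a b c d : R) : a <= b -> d <= c ->
  `[b, d]%classic `<=` `[a, c]%classic.
Proof.
move=> ab dc x /=; rewrite !in_itv/= => /andP[bx xd].
by rewrite (le_trans ab bx) (le_trans xd dc).
Qed.

Lemma integralC_split f a b c : a <= b -> b <= c ->
  integrableC `[a, c]%classic f ->
  integralC `[a, c]%classic f =
  integralC `[a, b]%classic f + integralC `[b, c]%classic f.
Proof.
move=> ab bc [f1 f2]; apply: CP; rewrite ?ReD ?ImD /=; exact: Rintegral_split.
Qed.

Lemma integrable_n1 D f : meas D -> integrableC D f ->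
  mu.-integrable D (EFin \o (fun x => n1 (f x))).
Proof.
move=> mD [f1 f2].
exact: (integrable_add mD (integrable_absR mD f1) (integrable_absR mD f2)).
Qed.

Lemma n1_integralC D f : meas D -> integrableC D f ->
  n1 (integralC D f) <= \int[mu]_(x in D) n1 (f x).
Proof.
move=> mD [f1 f2]; rewrite /n1 RintegralD//; last 2 first.
- exact: integrable_absR.
- exact: integrable_absR.
by rewrite lerD//= le_normr_Rintegral.
Qed.

Lemma integrable_cst a b (k : R) : mu.-integrable `[a, b] (EFin \o cst k).
Proof.
apply: continuous_compact_integrable; first exact: segment_compact.
by apply: continuous_in_subspaceT => x _; exact: cvg_cst.
Qed.

Lemma Rintegral_cst_itv a b (k : R) : a <= b ->
  \int[mu]_(x in `[a, b]) k = k * (b - a).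
Proof.
move=> ab; rewrite Rintegral_cst//.
rewrite [X in fine X](lebesgue_measure_itv `[a, b])/= lte_fin.
case: ltP => //= h; congr (_ * _).
by rewrite (@le_anti _ _ a b) ?ab// subrr.
Qed.

Lemma integralC_le f a b (g : R -> R) : integrableC `[a, b]%classic f ->
  mu.-integrable `[a, b] (EFin \o g) ->
  (forall x, a <= x <= b -> n1 (f x) <= g x) ->
  n1 (integralC `[a, b]%classic f) <= \int[mu]_(x in `[a, b]) g x.
Proof.
move=> fi gi h; rewrite (le_trans (n1_integralC _ fi))//.
apply: le_Rintegral => //; first exact: integrable_n1.
Qed.

Lemma integralC_bound f a b (M : R) : a <= b ->
  integrableC `[a, b]%classic f ->
  (forall x, a <= x <= b -> n1 (f x) <= M) ->
  n1 (integralC `[a, b]%classic f) <= M * (b - a).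
Proof.
move=> ab fi h; rewrite -Rintegral_cst_itv//; apply: integralC_le => //.
exact: integrable_cst.
Qed.

Lemma integralC_cst a b (k : C) : a <= b ->
  integralC `[a, b]%classic (fun=> k) = k * (b - a)%:C.
Proof.
by move=> ab; apply: CP; rewrite ?ReM ?ImM /= Rintegral_cst_itv//; ring.
Qed.

(** Bounded measurable functions form an algebra and multiply integrable functions into integrable
    ones. On a segment they include the absolutely continuous functions, which settles most
    integrability questions below. *)
Definition bm D f :=
  [/\ mfun D (fun x => Re (f x)), mfun D (fun x => Im (f x))
    & exists M : R, forall x, D x -> n1 (f x) <= M].

Lemma bm_cst D (k : C) : bm D (fun=> k).
Proof. by split; [| |exists (n1 k)]; try exact: measurable_cst. Qed.

Lemma bmD D f g : bm D f -> bm D g -> bm D (fun x => f x + g x).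
Proof.
move=> [f1 f2 [M hM]] [g1 g2 [N hN]]; split.
- have := measurable_funD f1 g1; apply: eq_measurable_fun => x _ /=.
  by rewrite ReD.
- have := measurable_funD f2 g2; apply: eq_measurable_fun => x _ /=.
  by rewrite ImD.
- exists (M + N) => x Dx; rewrite (le_trans (n1D _ _))// lerD//;
  [exact: hM|exact: hN].
Qed.

Lemma bmM D f g : bm D f -> bm D g -> bm D (fun x => f x * g x).
Proof.
move=> [f1 f2 [M hM]] [g1 g2 [N hN]]; split.
- have := measurable_funB (measurable_funM f1 g1) (measurable_funM f2 g2).
  by apply: eq_measurable_fun => x _ /=; rewrite ReM.
- have := measurable_funD (measurable_funM f1 g2) (measurable_funM f2 g1).
  by apply: eq_measurable_fun => x _ /=; rewrite ImM.
- exists (M * N) => x Dx; rewrite (le_trans (n1M _ _))// ler_pM ?n1_ge0//;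
  [exact: hM|exact: hN].
Qed.

Lemma bmB D f g : bm D f -> bm D g -> bm D (fun x => f x - g x).
Proof.
move=> h1 h2; have := bmD h1 (bmM (bm_cst D (-1)) h2).
by under eq_fun do rewrite mulN1r.
Qed.

Lemma bm_conj D f : bm D f -> bm D (fun x => cj (f x)).
Proof.
move=> [f1 f2 [M hM]]; split.
- by apply: eq_measurable_fun f1 => x _; case: (f x).
- have := measurable_funN f2; apply: eq_measurable_fun => x _ /=.
  by case: (f x).
- by exists M => x /hM; rewrite n1_conj.
Qed.

Lemma integrable_bmul D (f g : R -> R) (M : R) : meas D ->
  mfun D f -> (forall x, D x -> `|f x| <= M) ->
  mu.-integrable D (EFin \o g) ->
  mu.-integrable D (EFin \o (fun x => f x * g x)).
Proof.
move=> mD mf hM gi.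
have := integrableMr mD mf _ gi; rewrite /comp => h.
have {}h := h _; apply: eq_integrable (h _) => //.
exists M; split; first by rewrite num_real.
by move=> N MN x Dx /=; rewrite (le_trans (hM x Dx))// ltW.
Qed.

Lemma integrableC_bmul D f g : meas D -> bm D f -> integrableC D g ->
  integrableC D (fun x => f x * g x).
Proof.
move=> mD [f1 f2 [M hM]] [g1 g2].
have hR x : D x -> `|Re (f x)| <= M.
  by move=> /hM; apply: le_trans; exact: Re_le_n1.
have hI x : D x -> `|Im (f x)| <= M.
  by move=> /hM; apply: le_trans; exact: Im_le_n1.
split.
  apply: eq_integrable (integrable_sub mD (integrable_bmul mD f1 hR g1)
    (integrable_bmul mD f2 hI g2)) => // x _ /=; by rewrite ReM.
apply: eq_integrable (integrable_add mD (integrable_bmul mD f1 hR g2)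
  (integrable_bmul mD f2 hI g1)) => // x _ /=; by rewrite ImM.
Qed.

Lemma bm_integrable a b f : bm `[a, b]%classic f -> integrableC `[a, b]%classic f.
Proof.
move=> h; have := @integrableC_bmul `[a, b]%classic f (fun=> 1) _ h.
move=> h1; apply: eq_integrableC (h1 _ _) => //; first by move=> x _; rewrite mulr1.
by split; exact: integrable_cst.
Qed.

Lemma continuous_integrable (f : R -> R) a b :
  (forall x, a <= x <= b -> {for x, continuous f}) ->
  mu.-integrable `[a, b] (EFin \o f).
Proof.
move=> h; apply: continuous_compact_integrable; first exact: segment_compact.
by apply: continuous_in_subspaceT => x /set_mem/=; rewrite in_itv/=; exact: h.
Qed.

Lemma continuous_real_pt (f : R -> R) x :
  (forall e : R, 0 < e -> exists2 d : R, 0 < d &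
    forall y, `|y - x| < d -> `|f y - f x| < e) -> {for x, continuous f}.
Proof.
move=> h; apply/cvgrPdist_lt => e e0; have [d d0 hd] := h e e0.
near=> y; rewrite distrC; apply: hd; rewrite distrC; near: y.
by exists d.
Unshelve. all: by end_near.
Qed.

Lemma path_integrable (F : C -> C) (p : R -> C) a b :
  (forall s t, n1 (p s - p t) = `|s - t|) ->
  (forall t, a <= t <= b -> {for p t, continuous F}) ->
  integrableC `[a, b]%classic (fun t => F (p t)).
Proof.
move=> hp hF; split; apply: continuous_integrable => x /hF/continuousCP h;
  apply: continuous_real_pt => e /h[d d0 hd]; exists d => // y yx;
  apply: (@le_lt_trans _ _ (n1 (F (p y) - F (p x)))).
- by rewrite -ReN -ReD Re_le_n1.
- by apply: hd; rewrite hp.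
- by rewrite -ImN -ImD Im_le_n1.
- by apply: hd; rewrite hp.
Qed.

Lemma half_small (S t : R) : 0 <= S -> 0 < t -> exists n, S / 2 ^+ n < t.
Proof.
move=> S0 t0; have [n hn] : exists n : nat, S / t < n%:R.
  by exists (Num.bound (S / t)); rewrite archi_boundP// divr_ge0// ltW.
exists n; rewrite ltr_pdivrMr ?exprn_gt0// mulrC -ltr_pdivrMr//.
by rewrite (lt_trans hn)// -natrX ltr_nat ltn_expl.
Qed.

End ComplexIntegral.

(** * Goursat's lemma and Cauchy's formula on squares *)

Section Goursat.
Context {R : realType}.
Local Notation C := (Cplx R).
Implicit Types (F : C -> C) (a b c d x y e : R).

Local Notation cont F z := {for (z : C), continuous F}.

Definition hint F y a b := integralC `[a, b]%classic (fun t => F (t +i* y)).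
Definition vint F x c d := integralC `[c, d]%classic (fun t => F (x +i* t)).
(** The counterclockwise contour integral of [F] along the boundary of [[a, b] x [c, d]]; the factor
    ['i] is [dz / dt] on the vertical edges. *)
Definition rectI F a b c d : C :=
  (hint F c a b - hint F d a b) + 'i * (vint F b c d - vint F a c d).

Definition hcont F y a b := forall t, a <= t <= b -> cont F (t +i* y).
Definition vcont F x c d := forall t, c <= t <= d -> cont F (x +i* t).

Lemma n1_hor y s t : n1 ((s +i* y : C) - (t +i* y)) = `|s - t|.
Proof. by rewrite /n1 /= subrr normr0 addr0. Qed.
Lemma n1_ver x s t : n1 ((x +i* s : C) - (x +i* t)) = `|s - t|.
Proof. by rewrite /n1 /= subrr normr0 add0r. Qed.

Lemma hcont_int F y a b : hcont F y a b ->
  integrableC `[a, b]%classic (fun t => F (t +i* y)).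
Proof. by move=> h; apply: (@path_integrable _ F (fun t => t +i* y)) => // s t; exact: n1_hor. Qed.

Lemma vcont_int F x c d : vcont F x c d ->
  integrableC `[c, d]%classic (fun t => F (x +i* t)).
Proof. by move=> h; apply: (@path_integrable _ F (fun t => x +i* t)) => // s t; exact: n1_ver. Qed.

Lemma rectI_splitx F a e b c d : a <= e -> e <= b ->
  hcont F c a b -> hcont F d a b ->
  rectI F a b c d = rectI F a e c d + rectI F e b c d.
Proof.
move=> ae eb h1 h2; rewrite /rectI /hint.
rewrite (integralC_split ae eb (hcont_int h1)).
rewrite (integralC_split ae eb (hcont_int h2)); ring.
Qed.

Lemma rectI_splity F a b c e d : c <= e -> e <= d ->
  vcont F a c d -> vcont F b c d ->
  rectI F a b c d = rectI F a b c e + rectI F a b e d.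
Proof.
move=> ce ed h1 h2; rewrite /rectI /vint.
rewrite (integralC_split ce ed (vcont_int h1)).
rewrite (integralC_split ce ed (vcont_int h2)); ring.
Qed.

Lemma n1_iM (z : C) : n1 ('i * z) = n1 z.
Proof. by case: z => u v; rewrite /n1 /= !mul0r !mul1r sub0r add0r normrN addrC. Qed.

Lemma rectI_bound F a b c d (M : R) : a <= b -> c <= d ->
  hcont F c a b -> hcont F d a b -> vcont F a c d -> vcont F b c d ->
  (forall t, a <= t <= b -> n1 (F (t +i* c)) <= M /\ n1 (F (t +i* d)) <= M) ->
  (forall t, c <= t <= d -> n1 (F (a +i* t)) <= M /\ n1 (F (b +i* t)) <= M) ->
  n1 (rectI F a b c d) <= 2 * M * ((b - a) + (d - c)).
Proof.
move=> ab cd h1 h2 h3 h4 m1 m2.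
have b1 : n1 (hint F c a b) <= M * (b - a).
  by apply: integralC_bound => //; [exact: hcont_int|move=> t /m1[]].
have b2 : n1 (hint F d a b) <= M * (b - a).
  by apply: integralC_bound => //; [exact: hcont_int|move=> t /m1[]].
have b3 : n1 (vint F a c d) <= M * (d - c).
  by apply: integralC_bound => //; [exact: vcont_int|move=> t /m2[]].
have b4 : n1 (vint F b c d) <= M * (d - c).
  by apply: integralC_bound => //; [exact: vcont_int|move=> t /m2[]].
apply: (le_trans (n1D _ _)); rewrite n1_iM.
have := n1B (hint F c a b) (hint F d a b).
have := n1B (vint F b c d) (vint F a c d).
lra.
Qed.

Lemma cont_affine (k D p z : C) : cont (fun w => k + D * (w - p)) z.
Proof.
apply/continuousCP => e e0; exists (e / (n1 D + 1)).
  by rewrite divr_gt0// ltr_wpDl// n1_ge0.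
move=> w; rewrite ltr_pdivlMr ?ltr_wpDl ?n1_ge0// => h.
have -> : k + D * (w - p) - (k + D * (z - p)) = D * (w - z) by ring.
apply: (le_lt_trans (n1M _ _)); apply: le_lt_trans h.
rewrite mulrC ler_wpM2l ?n1_ge0//; lra.
Qed.

Lemma contB F1 F2 (z : C) : cont F1 z -> cont F2 z -> cont (fun w => F1 w - F2 w) z.
Proof.
move=> /continuousCP h1 /continuousCP h2; apply/continuousCP => e e0.
have e20 : 0 < e / 2 by rewrite divr_gt0.
have [d1 d10 k1] := h1 _ e20; have [d2 d20 k2] := h2 _ e20.
exists (Num.min d1 d2); first by rewrite lt_min d10.
move=> w; rewrite lt_min => /andP[/k1 l1 /k2 l2].
have -> : F1 w - F2 w - (F1 z - F2 z) = F1 w - F1 z - (F2 w - F2 z) by ring.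
by apply: (le_lt_trans (n1B _ _)); lra.
Qed.

Lemma rectIB F1 F2 a b c d :
  hcont F1 c a b -> hcont F1 d a b -> vcont F1 a c d -> vcont F1 b c d ->
  hcont F2 c a b -> hcont F2 d a b -> vcont F2 a c d -> vcont F2 b c d ->
  rectI (fun z => F1 z - F2 z) a b c d = rectI F1 a b c d - rectI F2 a b c d.
Proof.
move=> *; rewrite /rectI /hint /vint !integralCB//; try exact: hcont_int;
  try exact: vcont_int.
ring.
Qed.

Lemma rectIZ F (k : C) a b c d :
  hcont F c a b -> hcont F d a b -> vcont F a c d -> vcont F b c d ->
  rectI (fun z => k * F z) a b c d = k * rectI F a b c d.
Proof.
move=> *; rewrite /rectI /hint /vint !integralCZ//; try exact: hcont_int;
  try exact: vcont_int.
ring.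
Qed.

(** Between opposite edges an affine integrand differs by a constant. The two pairs contribute
    [D i (c - d) (b - a)] and [i D (b - a) (d - c)], which cancel; no primitive is involved. *)
Lemma rectI_affine (k D p : C) a b c d : a <= b -> c <= d ->
  rectI (fun w => k + D * (w - p)) a b c d = 0.
Proof.
move=> ab cd; rewrite /rectI /hint /vint.
pose L := fun w : C => k + D * (w - p).
have hc y : hcont L y a b by move=> t _; exact: cont_affine.
have vc x : vcont L x c d by move=> t _; exact: cont_affine.
rewrite -!integralCB//; try exact: (hcont_int (hc _)); try exact: (vcont_int (vc _)).
rewrite (@eq_integralC _ _ _ (fun=> D * ('i * (c - d)%:C))).
  rewrite (@eq_integralC _ `[c, d]%classic _ (fun=> D * (b - a)%:C)).
    rewrite !integralC_cst// !rmorphB /=; ring.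
  move=> t _; rewrite /L.
  have -> : (b +i* t : C) = b%:C + 'i * t%:C by apply: CP; rewrite /=; ring.
  have -> : (a +i* t : C) = a%:C + 'i * t%:C by apply: CP; rewrite /=; ring.
  rewrite rmorphB /=; ring.
move=> t _; rewrite /L.
have -> : (t +i* c : C) = t%:C + 'i * c%:C by apply: CP; rewrite /=; ring.
have -> : (t +i* d : C) = t%:C + 'i * d%:C by apply: CP; rewrite /=; ring.
rewrite rmorphB /=; ring.
Qed.

Definition in_rect a b c d (z : C) := (a <= Re z <= b) /\ (c <= Im z <= d).

Lemma n1_in_rect a b c d (z w : C) : in_rect a b c d z -> in_rect a b c d w ->
  n1 (z - w) <= (b - a) + (d - c).
Proof.
move=> [/andP[z1 z2] /andP[z3 z4]] [/andP[w1 w2] /andP[w3 w4]].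
rewrite /n1 !ReImE lerD//; rewrite ler_norml; lra.
Qed.

(* The quadratic form [(b-a)^2 + (d-c)^2] is additive when a rectangle is cut
   into four equal quarters, whatever its aspect ratio. *)
Lemma rectI_local F a b c d (p : C) e (D : C) :
  a <= b -> c <= d ->
  (forall z, in_rect a b c d z -> cont F z) -> in_rect a b c d p -> 0 <= e ->
  (forall z, in_rect a b c d z -> n1 (F z - F p - D * (z - p)) <= e * n1 (z - p)) ->
  n1 (rectI F a b c d) <= 4 * e * ((b - a) ^+ 2 + (d - c) ^+ 2).
Proof.
move=> ab cd cF pR e0 hF.
set L := fun w : C => F p + D * (w - p).
have cL z : cont L z by exact: cont_affine.
have aa : a <= a <= b by rewrite lexx ab.
have bb : a <= b <= b by rewrite lexx ab.
have cc : c <= c <= d by rewrite lexx cd.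
have dd : c <= d <= d by rewrite lexx cd.
have -> : rectI F a b c d = rectI (fun z => F z - L z) a b c d.
  have hL y : hcont L y a b by move=> t _; exact: cL.
  have vL x : vcont L x c d by move=> t _; exact: cL.
  have hhF y : c <= y <= d -> hcont F y a b by move=> hy t ht; exact: cF.
  have vvF x : a <= x <= b -> vcont F x c d by move=> hx t ht; exact: cF.
  rewrite (rectIB (hhF c cc) (hhF d dd) (vvF a aa) (vvF b bb)
    (hL c) (hL d) (vL a) (vL b)).
  by rewrite [X in _ = _ - X]rectI_affine// subr0.
have mb z : in_rect a b c d z -> n1 (F z - L z) <= e * ((b - a) + (d - c)).
  move=> zR; rewrite /L opprD addrA (le_trans (hF z zR))//.
  by rewrite ler_wpM2l// n1_in_rect.
have cFL z : in_rect a b c d z -> cont (fun z => F z - L z) z.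
  by move=> zR; apply: contB; [exact: cF|exact: cL].
apply: le_trans (@rectI_bound _ a b c d (e * ((b - a) + (d - c))) ab cd _ _ _ _ _ _) _;
  try (by move=> t ht; exact: cFL).
- by move=> t ht; split; exact: mb.
- by move=> t ht; split; exact: mb.
have h := sqr_ge0 ((b - a) - (d - c)).
rewrite -subr_ge0.
have -> : 4 * e * ((b - a) ^+ 2 + (d - c) ^+ 2) -
  2 * (e * (b - a + (d - c))) * (b - a + (d - c)) =
  2 * e * ((b - a) - (d - c)) ^+ 2 by ring.
by rewrite mulr_ge0// mulr_ge0.
Qed.

Lemma nested_point (u v : nat -> R) :
  (forall n, u n <= u n.+1) -> (forall n, v n.+1 <= v n) ->
  (forall n, u n <= v n) -> exists x, forall n, u n <= x <= v n.
Proof.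
move=> hu hv huv.
have mu' k n : u n <= u (n + k)%N.
  elim: k => [|k IH]; first by rewrite addn0.
  by rewrite addnS (le_trans IH).
have mv' k n : v (n + k)%N <= v n.
  elim: k => [|k IH]; first by rewrite addn0.
  by rewrite addnS (le_trans _ IH).
have uv i j : u i <= v j.
  rewrite (le_trans (mu' j i))// (le_trans (huv _))// addnC; exact: mv'.
exists (sup (range u)) => n; apply/andP; split.
  apply: ub_le_sup; last by exists n.
  by exists (v 0%N) => _ [i _ <-].
by apply: ge_sup; [exists (u 0%N), 0%N|move=> _ [i _ <-]].
Qed.

Let rect := (R * R * R * R)%type.
Let wx (r : rect) := r.1.1.2 - r.1.1.1.
Let wy (r : rect) := r.2 - r.1.2.

(** Bisection: a rectangle is bad when its integral exceeds [e * Q]. A bad rectangle has a bad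
    quarter, and the nested bad rectangles shrink to a point where [rectI_local] contradicts
    badness. *)
Lemma goursat F a b c d : a <= b -> c <= d ->
  (forall z, in_rect a b c d z -> derivable F z 1) -> rectI F a b c d = 0.
Proof.
move=> ab cd hF; have cF z : in_rect a b c d z -> cont F z.
  by move=> /hF; exact: derivable_cont.
apply: n1_eq0; rewrite leNgt; apply/negP => I0.
pose Q (r : rect) := wx r ^+ 2 + wy r ^+ 2.
have Q0 : 0 <= Q (a, b, c, d) by rewrite addr_ge0// sqr_ge0.
(* Any [e > 0] for which [e * Q] stays below the integral would do; the [+ 1] keeps the denominator
   positive when [Q] vanishes. *)
pose e := n1 (rectI F a b c d) / (2 * (Q (a, b, c, d) + 1)).
have e0 : 0 < e by rewrite divr_gt0// mulr_gt0// ltr_wpDl.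
pose I (r : rect) := rectI F r.1.1.1 r.1.1.2 r.1.2 r.2.
pose bad (r : rect) := [/\ a <= r.1.1.1, r.1.1.1 <= r.1.1.2 & r.1.1.2 <= b] /\
  [/\ c <= r.1.2, r.1.2 <= r.2 & r.2 <= d] /\ e * Q r < n1 (I r).
pose half (r r' : rect) := [/\ r.1.1.1 <= r'.1.1.1, r'.1.1.2 <= r.1.1.2,
  r.1.2 <= r'.1.2, r'.2 <= r.2 & wx r' = wx r / 2 /\ wy r' = wy r / 2].
have step r : bad r -> exists r', bad r' /\ half r r'.
  case: r => [[[a1 b1] c1] d1]; rewrite /bad /half /Q /I /wx /wy /=.
  move=> [[aa1 ab1 bb1] [[cc1 cd1 dd1] bd]].
  set ex := (a1 + b1) / 2; set ey := (c1 + d1) / 2.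
  have [h1 h2] : a1 <= ex /\ ex <= b1 by clear -ab1 ex; rewrite /ex; split; lra.
  have [h3 h4] : c1 <= ey /\ ey <= d1 by clear -cd1 ey; rewrite /ey; split; lra.
  have [x1 x2] : ex - a1 = (b1 - a1) / 2 /\ b1 - ex = (b1 - a1) / 2.
    by clear; rewrite /ex; split; field.
  have [y1 y2] : ey - c1 = (d1 - c1) / 2 /\ d1 - ey = (d1 - c1) / 2.
    by clear; rewrite /ey; split; field.
  have hc y : c1 <= y <= d1 -> hcont F y a1 b1.
    move=> /andP[ly yl] t /andP[t1 t2]; apply: cF; rewrite /in_rect /=.
    by rewrite (le_trans aa1 t1) (le_trans t2 bb1) (le_trans cc1 ly) (le_trans yl dd1).
  have vc x y y' : a1 <= x <= b1 -> c1 <= y -> y' <= d1 -> vcont F x y y'.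
    move=> /andP[lx xl] yl ly t /andP[t1 t2]; apply: cF; rewrite /in_rect /=.
    rewrite (le_trans aa1 lx) (le_trans xl bb1) (le_trans cc1 (le_trans yl t1)).
    by rewrite (le_trans t2 (le_trans ly dd1)).
  have hI : rectI F a1 b1 c1 d1 =
      (rectI F a1 ex c1 ey + rectI F a1 ex ey d1) +
      (rectI F ex b1 c1 ey + rectI F ex b1 ey d1).
    rewrite (rectI_splitx h1 h2); try (by apply: hc; rewrite ?lexx ?cd1).
    by rewrite !(rectI_splity h3 h4)//; apply: vc => //; rewrite ?lexx ?ab1 ?h1.
  have quarter a2 b2 c2 d2 : a1 <= a2 -> b2 <= b1 -> c1 <= c2 -> d2 <= d1 ->
      a2 <= b2 -> c2 <= d2 ->
      b2 - a2 = (b1 - a1) / 2 -> d2 - c2 = (d1 - c1) / 2 ->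
      (exists r' : rect, bad r' /\ half (a1, b1, c1, d1) r') \/
      n1 (rectI F a2 b2 c2 d2) <=
        e * (((b1 - a1) / 2) ^+ 2 + ((d1 - c1) / 2) ^+ 2).
    move=> la lb lc ld lab lcd wx2 wy2.
    have [k|k] := ltP (e * ((b2 - a2) ^+ 2 + (d2 - c2) ^+ 2))
      (n1 (rectI F a2 b2 c2 d2)); last by right; rewrite -wx2 -wy2.
    left; exists (a2, b2, c2, d2); rewrite /bad /half /wx /wy /= wx2 wy2.
    by do !split => //; [apply: le_trans la|apply: le_trans bb1|
      apply: le_trans lc|apply: le_trans dd1].
  have [//|k1] := quarter a1 ex c1 ey (lexx _) h2 (lexx _) h4 h1 h3 x1 y1.
  have [//|k2] := quarter a1 ex ey d1 (lexx _) h2 h3 (lexx _) h1 h4 x1 y2.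
  have [//|k3] := quarter ex b1 c1 ey h1 (lexx _) (lexx _) h4 h2 h3 x2 y1.
  have [//|k4] := quarter ex b1 ey d1 h1 (lexx _) h3 (lexx _) h2 h4 x2 y2.
  (* Each quarter has a quarter of [Q], so the thresholds of four good quarters add up to that of
     the whole rectangle, which would then be good. *)
  exfalso; move: bd; rewrite ltNge => /negP; apply; rewrite hI.
  apply: (le_trans (n1D _ _)).
  apply: (le_trans (lerD (n1D _ _) (n1D _ _))).
  apply: (le_trans (lerD (lerD k1 k2) (lerD k3 k4))).
  by clear; rewrite le_eqVlt; apply/orP; left; apply/eqP; field.
pose nxt r := xget r [set r' | bad r' /\ half r r'].
pose rs n := iter n nxt (a, b, c, d).
have bad0 : bad (a, b, c, d).
  rewrite /bad /=; do !split => //.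
  rewrite /e mulrAC ltr_pdivrMr ?mulr_gt0 ?ltr_wpDl//.
  rewrite ltr_pM2l// /I/=; lra.
have nxtP r : bad r -> bad (nxt r) /\ half r (nxt r).
  by move=> br; have := @xgetPex _ r [set r' | bad r' /\ half r r'] (step r br).
have badn n : bad (rs n).
  by elim: n => //= n IH; exact: (nxtP _ IH).1.
have halfn n : half (rs n) (rs n.+1) by exact: (nxtP _ (badn n)).2.
have [x hx] : exists x, forall n, (rs n).1.1.1 <= x <= (rs n).1.1.2.
  apply: nested_point => n; first by case: (halfn n).
    by case: (halfn n).
  by case: (badn n) => -[].
have [y hy] : exists y, forall n, (rs n).1.2 <= y <= (rs n).2.
  apply: nested_point => n; first by case: (halfn n).
    by case: (halfn n).
  by case: (badn n) => _ [[]].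
have wn n : wx (rs n) + wy (rs n) = ((b - a) + (d - c)) / 2 ^+ n.
  elim: n => [|n IH]; first by rewrite expr0 divr1.
  have [_ _ _ _ [-> ->]] := halfn n.
  by rewrite -mulrDl IH exprS; field; rewrite expf_neq0.
set p : C := x +i* y.
have pR : in_rect a b c d p by split; [exact: (hx 0%N)|exact: (hy 0%N)].
have /derivableCP[D hD] := hF p pR.
(* The quarter of [e] absorbs the factor 4 of [rectI_local]. *)
have e40 : 0 < e / 4 by rewrite divr_gt0.
have [t t0 ht] := hD _ e40.
have S0 : 0 <= (b - a) + (d - c) by lra.
have [n hn] := half_small S0 t0.
have [[k1 k2 k3] [[k4 k5 k6] bd]] := badn n.
have sub z : in_rect (rs n).1.1.1 (rs n).1.1.2 (rs n).1.2 (rs n).2 z ->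
    in_rect a b c d z.
  move=> [/andP[l1 l2] /andP[l3 l4]]; rewrite /in_rect.
    by rewrite (le_trans k1 l1) (le_trans l2 k3) (le_trans k4 l3) (le_trans l4 k6).
have := @rectI_local F (rs n).1.1.1 (rs n).1.1.2 (rs n).1.2 (rs n).2 p (e / 4) D
  k2 k5 (fun z h => cF z (sub z h)) (conj (hx n) (hy n)) (ltW e40).
have -> : 4 * (e / 4) = e by field.
move=> h; move: bd; rewrite ltNge => /negP; apply; apply: h => z zR.
apply: ht; apply: le_lt_trans hn; rewrite -wn.
have pn : in_rect (rs n).1.1.1 (rs n).1.1.2 (rs n).1.2 (rs n).2 p.
  by split; [exact: hx|exact: hy].
exact: (n1_in_rect zR pn).
Qed.

End Goursat.

(** * Contour integrals over squares and the Cauchy kernel *)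

Section Cauchy.
Context {R : realType}.
Local Notation C := (Cplx R).
Implicit Types (F f : C -> C) (z w p : C) (r : R).
Local Notation cont F z := {for (z : C), continuous F}.

Lemma cont_cst (k z : C) : cont (fun=> k) z.
Proof.
by apply/continuousCP => e e0; exists 1 => // w _; rewrite subrr n1_0.
Qed.

(** Cutting along the four sides of the inner rectangle leaves strips on which [goursat] applies.
    Differentiability is required only off the open inner rectangle, so that a singularity may sit
    there. *)
Lemma rectI_shrink F (a b c d a' b' c' d' : R) :
  a <= a' -> a' < b' -> b' <= b -> c <= c' -> c' < d' -> d' <= d ->
  (forall z, in_rect a b c d z -> ~ (a' < Re z < b' /\ c' < Im z < d') ->
     derivable F z 1) ->
  rectI F a b c d = rectI F a' b' c' d'.
Proof.
move=> aa ab bb cc cd dd dF.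
have ab' := le_trans aa (ltW ab); have ab'' := le_trans (ltW ab) bb.
have cd' := le_trans cc (ltW cd); have cd'' := le_trans (ltW cd) dd.
have lab := le_trans ab' bb; have lcd := le_trans cd' dd.
have ho y u v : a <= u -> v <= b -> c <= y <= d -> ~~ (c' < y < d') ->
    hcont F y u v.
  move=> au vb /andP[cy yd] ny t /andP[t1 t2]; apply: derivable_cont.
  apply: dF; last by move=> [_ /=]; apply/negP.
  by rewrite /in_rect /= (le_trans au t1) (le_trans t2 vb) cy.
have ve x u v : c <= u -> v <= d -> a <= x <= b -> ~~ (a' < x < b') ->
    vcont F x u v.
  move=> cu vd /andP[ax xb] nx t /andP[t1 t2]; apply: derivable_cont.
  apply: dF; last by move=> [] /= + _; apply/negP.
  by rewrite /in_rect /= (le_trans cu t1) (le_trans t2 vd) ax.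
rewrite (rectI_splitx aa ab''); last 2 first.
- by apply: ho; rewrite ?lexx ?lcd// ltNge cc.
- by apply: ho; rewrite ?lexx ?lcd// [d < d']ltNge dd andbF.
rewrite (rectI_splitx (ltW ab) bb); last 2 first.
- by apply: ho; rewrite ?lexx ?lcd// ltNge cc.
- by apply: ho; rewrite ?lexx ?lcd// [d < d']ltNge dd andbF.
rewrite goursat//; last first.
  move=> z [/andP[z1 z2] z3]; apply: dF.
    by rewrite /in_rect z1 (le_trans z2 ab'').
  by move=> [/andP[+ _] _]; rewrite ltNge z2.
rewrite add0r [X in _ + X]goursat ?addr0//; last first.
  move=> z [/andP[z1 z2] z3]; apply: dF.
    by rewrite /in_rect z2 (le_trans ab' z1).
  by move=> [/andP[_ +] _]; rewrite ltNge z1.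
rewrite (rectI_splity cc cd''); last 2 first.
- by apply: ve; rewrite ?lexx ?ltxx ?aa ?ab''.
- by apply: ve; rewrite ?lexx ?ltxx ?andbF ?bb ?ab'.
rewrite (rectI_splity (ltW cd) dd); last 2 first.
- by apply: ve; rewrite ?lexx ?ltxx ?aa ?ab''.
- by apply: ve; rewrite ?lexx ?ltxx ?andbF ?bb ?ab'.
rewrite goursat ?(ltW ab)//; last first.
  move=> z [/andP[z1 z2] /andP[z3 z4]]; apply: dF.
    by rewrite /in_rect z3 (le_trans z4 cd'') (le_trans aa z1) (le_trans z2 bb).
  by move=> [_ /andP[+ _]]; rewrite ltNge z4.
rewrite add0r [X in _ + X]goursat ?addr0 ?(ltW ab)//.
move=> z [/andP[z1 z2] /andP[z3 z4]]; apply: dF.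
  by rewrite /in_rect z4 (le_trans cd' z3) (le_trans aa z1) (le_trans z2 bb).
by move=> [_ /andP[_ +]]; rewrite ltNge z3.
Qed.

Definition inQ (c : C) r z := `|Re z - Re c| <= r /\ `|Im z - Im c| <= r.
Definition bdQ (c : C) r z :=
  inQ c r z /\ (`|Re z - Re c| = r \/ `|Im z - Im c| = r).
Definition sq F (c : C) r :=
  rectI F (Re c - r) (Re c + r) (Im c - r) (Im c + r).

Lemma n1_inQ (c : C) r z : n1 (z - c) <= r -> inQ c r z.
Proof.
move=> h; split; apply: le_trans h; rewrite -?ReN -?ReD -?ImN -?ImD.
  exact: Re_le_n1.
exact: Im_le_n1.
Qed.

Lemma bdQ_n1 (c : C) r z : bdQ c r z -> r <= n1 (z - c).
Proof.
move=> [_ [<-|<-]]; rewrite -?ReN -?ReD -?ImN -?ImD.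
  exact: Re_le_n1.
exact: Im_le_n1.
Qed.

Lemma inQ_rect (c : C) r z :
  in_rect (Re c - r) (Re c + r) (Im c - r) (Im c + r) z <-> inQ c r z.
Proof.
rewrite /in_rect /inQ !ler_norml.
by split=> -[/andP[h1 h2] /andP[h3 h4]]; clear -h1 h2 h3 h4; split; lra.
Qed.

Definition bcont F c r := forall z, bdQ c r z -> cont F z.

Section Square.
Variables (c : C) (r : R).
Hypothesis r0 : 0 < r.

Let ax : Re c - r <= Re c + r.
Proof. by rewrite lerD2l ge0_cp// ltW. Qed.
Let ay : Im c - r <= Im c + r.
Proof. by rewrite lerD2l ge0_cp// ltW. Qed.

Lemma bdQ_hor y t : y = Im c - r \/ y = Im c + r ->
  Re c - r <= t <= Re c + r -> bdQ c r (t +i* y).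
Proof.
move=> hy /andP[t1 t2]; rewrite /bdQ /inQ /=.
have -> : `|y - Im c| = r.
  case: hy => ->; [rewrite addrAC subrr add0r normrN|rewrite addrAC subrr add0r];
  by rewrite gtr0_norm.
split; last by right.
by rewrite lexx ler_norml; clear -t1 t2; split=> //; lra.
Qed.

Lemma bdQ_ver x t : x = Re c - r \/ x = Re c + r ->
  Im c - r <= t <= Im c + r -> bdQ c r (x +i* t).
Proof.
move=> hy /andP[t1 t2]; rewrite /bdQ /inQ /=.
have -> : `|x - Re c| = r.
  case: hy => ->; [rewrite addrAC subrr add0r normrN|rewrite addrAC subrr add0r];
  by rewrite gtr0_norm.
split; last by left.
by rewrite lexx ler_norml; clear -t1 t2; split=> //; lra.
Qed.

Section bcont.
Variable F : C -> C.
Hypothesis bF : bcont F c r.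
Lemma bc1 : hcont F (Im c - r) (Re c - r) (Re c + r).
Proof. by move=> t ht; apply: bF; apply: bdQ_hor => //; left. Qed.
Lemma bc2 : hcont F (Im c + r) (Re c - r) (Re c + r).
Proof. by move=> t ht; apply: bF; apply: bdQ_hor => //; right. Qed.
Lemma bc3 : vcont F (Re c - r) (Im c - r) (Im c + r).
Proof. by move=> t ht; apply: bF; apply: bdQ_ver => //; left. Qed.
Lemma bc4 : vcont F (Re c + r) (Im c - r) (Im c + r).
Proof. by move=> t ht; apply: bF; apply: bdQ_ver => //; right. Qed.
End bcont.

Lemma sq_bound F (M : R) : bcont F c r -> (forall z, bdQ c r z -> n1 (F z) <= M) ->
  n1 (sq F c r) <= 8 * r * M.
Proof.
move=> bF hM.
have := rectI_bound ax ay (bc1 bF) (bc2 bF) (bc3 bF) (bc4 bF).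
move=> /(_ M) h; apply: (le_trans (h _ _)).
- by move=> t ht; split; apply: hM; apply: bdQ_hor => //; [left|right].
- by move=> t ht; split; apply: hM; apply: bdQ_ver => //; [left|right].
- by clear; rewrite le_eqVlt; apply/orP; left; apply/eqP; ring.
Qed.

Lemma eq_sq F1 F2 : (forall z, bdQ c r z -> F1 z = F2 z) ->
  sq F1 c r = sq F2 c r.
Proof.
move=> h; rewrite /sq /rectI /hint /vint.
congr (_ - _ + _ * (_ - _)); apply: eq_integralC => t /=; rewrite in_itv/= => ht;
  apply: h.
- by apply: bdQ_hor => //; left.
- by apply: bdQ_hor => //; right.
- by apply: bdQ_ver => //; right.
- by apply: bdQ_ver => //; left.
Qed.

Lemma sqB F1 F2 : bcont F1 c r -> bcont F2 c r ->
  sq (fun z => F1 z - F2 z) c r = sq F1 c r - sq F2 c r.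
Proof.
move=> h1 h2; exact: (rectIB (bc1 h1) (bc2 h1) (bc3 h1) (bc4 h1)
  (bc1 h2) (bc2 h2) (bc3 h2) (bc4 h2)).
Qed.

Lemma sqZ F (k : C) : bcont F c r -> sq (fun z => k * F z) c r = k * sq F c r.
Proof. move=> h; exact: (rectIZ k (bc1 h) (bc2 h) (bc3 h) (bc4 h)). Qed.

Lemma sqD F1 F2 : bcont F1 c r -> bcont F2 c r ->
  sq (fun z => F1 z + F2 z) c r = sq F1 c r + sq F2 c r.
Proof.
move=> h1 h2; have h3 : bcont (fun z => -1 * F2 z) c r.
  move=> z hz; apply: (@continuousM _ _ (fun=> -1) F2); last exact: h2.
  exact: cont_cst.
transitivity (sq (fun z => F1 z - (-1 * F2 z)) c r).
  by apply: eq_sq => z _; ring.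
rewrite sqB// sqZ//; ring.
Qed.

Lemma edge_bounded (g : R -> R) (a b : R) : a <= b ->
  (forall t, a <= t <= b -> {for t, continuous g}) ->
  exists M : R, forall t, a <= t <= b -> g t <= M.
Proof.
move=> ab hg; have [|m _ hm] := @EVT_max R g a b ab.
  by apply: continuous_in_subspaceT => t /set_mem/=; rewrite in_itv/=; exact: hg.
by exists (g m) => t ht; apply: hm; rewrite in_itv.
Qed.

Lemma n1_path_cont F (q : R -> C) t : (forall s t, n1 (q s - q t) = `|s - t|) ->
  cont F (q t) -> {for t, continuous (fun t => n1 (F (q t)))}.
Proof.
move=> hq /continuousCP h; apply: continuous_real_pt => e /h[d d0 hd].
exists d => // y yt; apply: le_lt_trans (hd (q y) _); last by rewrite hq.
have := n1D (F (q y) - F (q t)) (F (q t)); rewrite subrK.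
have := n1D (F (q t) - F (q y)) (F (q y)); rewrite subrK n1_dist => h1 h2.
by clear -h1 h2; rewrite ler_norml; apply/andP; split; lra.
Qed.

Lemma bcont_bounded F : bcont F c r ->
  exists2 M : R, 0 <= M & forall z, bdQ c r z -> n1 (F z) <= M.
Proof.
move=> bF.
have [M1 h1] := edge_bounded ax (fun t h =>
  @n1_path_cont F (fun t => t +i* (Im c - r)) t (n1_hor _) (bc1 bF h)).
have [M2 h2] := edge_bounded ax (fun t h =>
  @n1_path_cont F (fun t => t +i* (Im c + r)) t (n1_hor _) (bc2 bF h)).
have [M3 h3] := edge_bounded ay (fun t h =>
  @n1_path_cont F (fun t => (Re c - r) +i* t) t (n1_ver _) (bc3 bF h)).
have [M4 h4] := edge_bounded ay (fun t h =>
  @n1_path_cont F (fun t => (Re c + r) +i* t) t (n1_ver _) (bc4 bF h)).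
exists (`|M1| + `|M2| + `|M3| + `|M4|); first by rewrite !addr_ge0.
move=> [x y] [[]] /=; rewrite !ler_norml => /andP[x1 x2] /andP[y1 y2] hb.
have n_1 := ler_norm M1; have n_2 := ler_norm M2.
have n_3 := ler_norm M3; have n_4 := ler_norm M4.
have p_1 := normr_ge0 M1; have p_2 := normr_ge0 M2.
have p_3 := normr_ge0 M3; have p_4 := normr_ge0 M4.
have hx : Re c - r <= x <= Re c + r by clear -x1 x2; lra.
have hy : Im c - r <= y <= Im c + r by clear -y1 y2; lra.
clear -h1 h2 h3 h4 hb n_1 n_2 n_3 n_4 p_1 p_2 p_3 p_4 hx hy r0.
case: hb => /eqP; rewrite eqr_norml => /andP[/orP[]/eqP he _].
- have ex : x = Re c + r by rewrite -he; ring.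
  by have := h4 y hy; rewrite -ex; clear h1 h2 h3 h4 hx hy; lra.
- have ex : x = Re c - r by rewrite -he; ring.
  by have := h3 y hy; rewrite -ex; clear h1 h2 h3 h4 hx hy; lra.
- have ey : y = Im c + r by rewrite -he; ring.
  by have := h2 x hx; rewrite -ey; clear h1 h2 h3 h4 hx hy; lra.
- have ey : y = Im c - r by rewrite -he; ring.
  by have := h1 x hx; rewrite -ey; clear h1 h2 h3 h4 hx hy; lra.
Qed.

Lemma bdQ_dist w z : n1 (w - c) < r -> bdQ c r z ->
  r - n1 (w - c) <= n1 (z - w).
Proof.
move=> _ /bdQ_n1 h; have := n1D (z - w) (w - c).
by rewrite addrA subrK; lra.
Qed.

Lemma bdQ_neq w z : n1 (w - c) < r -> bdQ c r z -> z - w != 0.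
Proof.
move=> wr hz; apply: contraTneq (bdQ_dist wr hz) => ->.
by rewrite n1_0 -ltNge subr_gt0.
Qed.

Lemma derivable_ker w z : z - w != 0 -> derivable (fun z => (z - w)^-1) z 1.
Proof.
move=> zw; apply: derivableV => //.
Qed.

Lemma cont_ker w z : z - w != 0 -> cont (fun z => (z - w)^-1) z.
Proof. by move=> h; apply: derivable_cont; exact: derivable_ker. Qed.

Lemma bcont_ker w : n1 (w - c) < r -> bcont (fun z => (z - w)^-1) c r.
Proof. by move=> wr z hz; apply: cont_ker; exact: bdQ_neq hz. Qed.

Lemma bcontM F1 F2 : bcont F1 c r -> bcont F2 c r ->
  bcont (fun z => F1 z * F2 z) c r.
Proof. by move=> h1 h2 z hz; apply: (@continuousM _ _ F1 F2); [exact: h1|exact: h2]. Qed.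

(** The Cauchy integral without the factor [1 / (2 pi i)]: the integral of the kernel alone is never
    evaluated, only shown to be nonzero, and is divided out. *)
Definition cauchyT F w := sq (fun z => F z * (z - w)^-1) c r.

(** Differentiation of the kernel leaves the exact remainder [(v - w)^2 / ((z - w)^2 (z - v))]. On
    the boundary [z] is at distance at least [rho] from [w] and [rho / 2] from [v], which bounds
    it. *)
Lemma cauchyT_derivable F w : bcont F c r -> n1 (w - c) < r ->
  derivable (cauchyT F) w 1.
Proof.
move=> bF wr; have [M M0 hM] := bcont_bounded bF.
pose rho := r - n1 (w - c); have rho0 : 0 < rho by rewrite subr_gt0.
have rh2 : 0 < rho / 2 by rewrite divr_gt0.
apply: (@derivable_quad _ _ _ (sq (fun z => F z * (z - w)^-1 * (z - w)^-1) c r)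
  (8 * r * (M * ((2 / rho) * (2 / rho) * (2 / (rho / 2))))) (rho / 2) rh2).
move=> v vw.
have vr : n1 (v - c) < r.
  by have := n1D (v - w) (w - c); rewrite addrA subrK; clear -vw rho0; rewrite /rho in vw rho0 *; lra.
have kw := bcont_ker wr; have kv := bcont_ker vr.
have b1 := bcontM bF kw; have b2 := bcontM bF kv; have b3 := bcontM b1 kw.
have b4 : bcont (fun z => F z * ((z - w)^-1 * (z - w)^-1 * (z - v)^-1)) c r.
  by apply: (bcontM bF); apply: (bcontM (bcontM kw kw) kv).
have -> : cauchyT F v - cauchyT F w -
    sq (fun z => F z * (z - w)^-1 * (z - w)^-1) c r * (v - w) =
    (v - w) ^+ 2 *
    sq (fun z => F z * ((z - w)^-1 * (z - w)^-1 * (z - v)^-1)) c r.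
  have b5 : bcont (fun z => F z * (z - v)^-1 - F z * (z - w)^-1) c r.
    by move=> z hz; apply: contB; [exact: b2|exact: b1].
  have b6 : bcont (fun z => (v - w) * (F z * (z - w)^-1 * (z - w)^-1)) c r.
    have b0 : bcont (fun=> v - w) c r by move=> z _; exact: cont_cst.
    by have := bcontM b0 b3.
  rewrite (mulrC _ (v - w)) /cauchyT -(sqB b2 b1) -(sqZ (v - w) b3) -(sqB b5 b6).
  rewrite -(sqZ _ b4); apply: eq_sq => z hz.
  have n_1 := bdQ_neq vr hz; have n_2 := bdQ_neq wr hz.
  move: (F z) n_1 n_2 => Fz n_1 n_2; field.
  by rewrite n_1 n_2.
apply: (le_trans (n1M _ _)); rewrite mulrC.
apply: ler_pM; rewrite ?n1_ge0 ?n1X//.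
apply: (sq_bound b4).
move=> z hz; apply: (le_trans (n1M _ _)).
have inv_le x y : 0 < x -> x <= y -> 2 / y <= 2 / x :> R.
  by move=> x0 xy; rewrite ler_pM2l// lef_pV2// posrE// (lt_le_trans x0).
have d1 : n1 (z - w)^-1 <= 2 / rho.
  by apply: (le_trans (n1V _)); apply: inv_le => //; exact: bdQ_dist.
have d2 : n1 (z - v)^-1 <= 2 / (rho / 2).
  apply: (le_trans (n1V _)); apply: inv_le => //.
  have := bdQ_dist wr hz; have := n1D (z - v) (v - w).
  by rewrite addrA subrK -/rho; clear -vw; lra.
rewrite ler_pM ?n1_ge0// ?hM//.
apply: (le_trans (n1M _ _)); rewrite ler_pM ?n1_ge0//.
by apply: (le_trans (n1M _ _)); rewrite ler_pM ?n1_ge0.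
Qed.

End Square.

End Cauchy.
Arguments cont_cst {R} k z.

(** * Cauchy's formula and the order of a zero *)

Section Order.
Context {R : realType}.
Local Notation C := (Cplx R).
Local Notation mu := (@lebesgue_measure R).
Implicit Types (F f : C -> C) (z w p : C) (r : R).
Local Notation cont F z := {for (z : C), continuous F}.

Lemma Re_inv z : Re z^-1 = Re z / (Re z ^+ 2 + Im z ^+ 2).
Proof. by case: z. Qed.
Lemma Im_inv z : Im z^-1 = - (Im z / (Re z ^+ 2 + Im z ^+ 2)).
Proof. by case: z. Qed.

(* Each edge of the square contributes a nonnegative imaginary part, the
   integrand being the (positive) Poisson-type density
   [dist (w, edge) / |z - w|^2]. *)
Lemma sq_ker_neq0 (c w : C) r : 0 < r -> n1 (w - c) < r ->
  sq (fun z => (z - w)^-1) c r != 0.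
Proof.
move=> r0 wr; have bk := bcont_ker wr.
have [wx wy] := n1_inQ (ltW wr).
have wx' : `|Re w - Re c| < r.
  by apply: le_lt_trans wr; rewrite -ReN -ReD Re_le_n1.
have wy' : `|Im w - Im c| < r.
  by apply: le_lt_trans wr; rewrite -ImN -ImD Im_le_n1.
move: wx' wy'; rewrite !ltr_norml => /andP[x1 x2] /andP[y1 y2].
have ab : Re c - r <= Re c + r by rewrite lerD2l ge0_cp// ltW.
have cd : Im c - r <= Im c + r by rewrite lerD2l ge0_cp// ltW.
suff : 0 < Im (sq (fun z => (z - w)^-1) c r).
  by apply: contraTneq => ->; rewrite /= ltxx.
have [i1 j1] := hcont_int (bc1 r0 bk).
have [i2 j2] := hcont_int (bc2 r0 bk).
have [i3 j3] := vcont_int (bc3 r0 bk).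
have [i4 j4] := vcont_int (bc4 r0 bk).
rewrite /sq /rectI /hint /vint !ReImE /= mul0r add0r mul1r.
have h2 : Im (integralC `[(Re c - r), (Re c + r)]%classic
   (fun t => (t +i* (Im c + r) - w)^-1 : C)) <= 0.
  rewrite /= -[leRHS](mul0r (Re c + r - (Re c - r))) -Rintegral_cst_itv//.
  apply: le_Rintegral => //; first exact: integrable_cst.
  move=> t _; rewrite Im_inv oppr_le0 divr_ge0 ?addr_ge0 ?sqr_ge0//.
  by rewrite !ReImE /=; clear -y2; lra.
have h3 : Re (integralC `[(Im c - r), (Im c + r)]%classic
   (fun t => ((Re c - r) +i* t - w)^-1 : C)) <= 0.
  rewrite /= -[leRHS](mul0r (Im c + r - (Im c - r))) -Rintegral_cst_itv//.
  apply: le_Rintegral => //; first exact: integrable_cst.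
  move=> t _; rewrite Re_inv mulr_le0_ge0 ?invr_ge0 ?addr_ge0 ?sqr_ge0//.
  by rewrite !ReImE /=; clear -x1; lra.
have h4 : 0 <= Re (integralC `[(Im c - r), (Im c + r)]%classic
   (fun t => ((Re c + r) +i* t - w)^-1 : C)).
  rewrite /= -[leLHS](mul0r (Im c + r - (Im c - r))) -Rintegral_cst_itv//.
  apply: le_Rintegral => //; first exact: integrable_cst.
  move=> t _; rewrite Re_inv divr_ge0 ?addr_ge0 ?sqr_ge0//.
  by rewrite !ReImE /=; clear -x2; lra.
pose dl := Im w - (Im c - r); have dl0 : 0 < dl by rewrite /dl; clear -y1; lra.
pose K := (2 * r) ^+ 2 + dl ^+ 2.
have K0 : 0 < K by rewrite ltr_wpDl ?sqr_ge0// exprn_gt0.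
have h1 : 0 < Im (integralC `[(Re c - r), (Re c + r)]%classic
   (fun t => (t +i* (Im c - r) - w)^-1 : C)).
  apply: (@lt_le_trans _ _ (dl / K * (Re c + r - (Re c - r)))).
    by apply: mulr_gt0; rewrite ?divr_gt0// subr_gt0 ltrD2l gt0_cp.
  rewrite /= -Rintegral_cst_itv//.
  apply: le_Rintegral => //; first exact: integrable_cst.
  move=> t /=; rewrite in_itv/= => /andP[t1 t2].
  rewrite Im_inv -mulNr !ReImE /=.
  have -> : - (Im c - r - Im w) = dl by rewrite /dl; ring.
  have -> : (Im c - r - Im w) ^+ 2 = dl ^+ 2 by rewrite /dl; ring.
  rewrite ler_pM2l// lef_pV2 ?posrE//; last first.
    by rewrite ltr_wpDl ?sqr_ge0// exprn_gt0.
  rewrite /K lerD2r -real_normK ?num_real// lerXn2r ?nnegrE ?mulr_ge0 ?(ltW r0)//.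
  by rewrite ler_norml; apply/andP; split; clear -t1 t2 x1 x2; lra.
move: h1 h2 h3 h4; rewrite /=; clear; lra.
Qed.

Section Kernel.
Variables (c : C) (r : R).
Hypothesis r0 : 0 < r.
Hypotheses (f : C -> C) (df : forall z, inQ c r z -> derivable f z 1).

Lemma df_bcont : bcont f c r.
Proof. by move=> z [zQ _]; apply: derivable_cont; exact: df. Qed.

Lemma derivable_quot w z : derivable f z 1 -> z != w ->
  derivable (fun z => (f z - f w) * (z - w)^-1) z 1.
Proof.
move=> dz zw; apply: (derM (derB dz (der_cst (f w) z))).
by apply: derivable_ker; rewrite subr_eq0.
Qed.

(** The difference quotient of [f] at [w] is differentiable off [w] and bounded near it, so its
    integral is unchanged when the square shrinks around [w], and is therefore zero. *)
Lemma cauchy_formula w : n1 (w - c) < r ->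
  cauchyT c r f w = f w * sq (fun z => (z - w)^-1) c r.
Proof.
move=> wr; have bk := bcont_ker wr; have bf := df_bcont.
apply/eqP; rewrite -subr_eq0; apply/eqP.
have b1 := bcontM bf bk.
have b2 : bcont (fun z => f w * (z - w)^-1) c r.
  by have := @bcontM _ c r (fun=> f w) _ (fun z _ => cont_cst _ z) bk.
rewrite /cauchyT -(sqZ r0 (f w) bk) -(sqB r0 b1 b2).
set q := fun z => _.
have wQ : inQ c r w by apply: n1_inQ; exact: ltW.
have [D hD] := (derivableCP f w).1 (df wQ).
have [t t0 ht] := hD 1 ltr01.
pose K := 2 * (n1 D + 1).
have K0 : 0 <= K by rewrite mulr_ge0// addr_ge0 ?n1_ge0.
have qK z : z != w -> n1 (z - w) < t -> n1 (q z) <= K.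
  move=> zw zt; rewrite /q -mulrBl (le_trans (n1M _ _))//.
  have p := n1_gt0 (_ : z - w != 0); rewrite subr_eq0 in p; have {}p := p zw.
  have h1 : n1 (f z - f w) <= (n1 D + 1) * n1 (z - w).
    rewrite -(subrK (D * (z - w)) (f z - f w)).
    apply: (le_trans (n1D _ _)); rewrite mulrDl addrC lerD ?n1M//.
    by rewrite mul1r; have := ht z zt; rewrite mul1r.
  apply: (@le_trans _ _ ((n1 D + 1) * n1 (z - w) * (2 / n1 (z - w)))).
    by rewrite ler_pM ?n1_ge0// n1V.
  by rewrite /K le_eqVlt; apply/orP; left; apply/eqP; field; rewrite gt_eqF.
apply: n1_eq0; rewrite leNgt; apply/negP => N0.
pose s := n1 (sq q c r).
pose d1 := (r - n1 (w - c)) / 2.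
have d10 : 0 < d1 by rewrite divr_gt0// subr_gt0.
(* [d1] keeps the small square inside the large one, [t / 4] keeps it where [q] is bounded by [K],
   and the last term makes the edge estimate [8 dl K] smaller than [s]. *)
pose dl := Num.min d1 (Num.min (t / 4) (s / (16 * (K + 1)))).
have K10 : 0 < K + 1 by rewrite ltr_wpDl.
have dl0 : 0 < dl.
  by rewrite !lt_min d10 !divr_gt0// mulr_gt0.
have [l1 l2 l3] : [/\ dl <= d1, dl <= t / 4 & dl <= s / (16 * (K + 1))].
  by rewrite /dl !ge_min !lexx !orbT.
have bdt z : bdQ w dl z -> n1 (z - w) < t /\ z != w.
  move=> hz; split; last first.
    by have := bdQ_n1 hz; apply: contraTneq => ->; rewrite subrr n1_0 -ltNge.
  have [[h1 h2] _] := hz; apply: (@le_lt_trans _ _ (dl + dl)).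
    by rewrite /n1 !ReImE lerD.
  by clear -l2 t0; lra.
have dq z : inQ c r z -> z != w -> derivable q z 1.
  move=> zQ zw; apply: der_ext (derivable_quot (df zQ) zw).
  by exists 1 => // v _; rewrite /q mulrBl.
have e : sq q c r = sq q w dl.
  have := le_lt_trans (Re_le_n1 (w - c)) wr; have := le_lt_trans (Im_le_n1 (w - c)) wr.
  have [+ +] := n1_inQ (lexx (n1 (w - c))); rewrite !ler_norml.
  move=> /andP[x1 x2] /andP[y1 y2] _ _.
  have l1' : dl <= (r - n1 (w - c)) / 2 by [].
  apply: rectI_shrink; try (clear -l1' d10 x1 x2 y1 y2 dl0 wr; lra).
  move=> z /inQ_rect zQ zw; apply: dq => //; apply: contra_notN zw => /eqP ->.
  by clear -dl0; split; lra.
have : n1 (sq q w dl) <= 8 * dl * K.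
  apply: (sq_bound dl0).
    move=> z hz; apply: derivable_cont; have [h1 h2] := bdt z hz.
    apply: dq => //; apply: n1_inQ.
    have := n1D (z - w) (w - c); rewrite addrA subrK => h.
    have [[k1 k2] _] := hz.
    have h3 : n1 (z - w) <= dl + dl by rewrite /n1 !ReImE lerD.
    by have l1' : dl <= (r - n1 (w - c)) / 2 by []; clear -l1' h h3; lra.
  by move=> z hz; have [h1 h2] := bdt z hz; exact: qK.
rewrite -e -/s => h; have s0 : 0 < s by [].
have : 16 * (K + 1) * dl <= s by rewrite mulrC -ler_pdivlMr// mulr_gt0.
have := mulr_ge0 K0 (ltW dl0).
by clear -h s0 dl0; nra.
Qed.

Let phi N z := f z * ((z - c)^-1) ^+ N.

Lemma expV_cont N z : z - c != 0 -> cont (fun z => ((z - c)^-1) ^+ N) z.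
Proof.
by move=> zc; apply/derivable_cont/derX/derivable_ker.
Qed.

Lemma phi_bcont N : bcont (phi N) c r.
Proof.
move=> z hz; apply: (@continuousM _ _ f (fun z => ((z - c)^-1) ^+ N)).
  exact: df_bcont.
by apply: expV_cont; apply: (bdQ_neq _ hz); rewrite subrr n1_0.
Qed.

(** The remainder of order [N] in Taylor's formula at [c], up to the factor [2 pi i]; its value at
    [c] is the coefficient of order [N] up to the same factor. *)
Let RN N w := cauchyT c r (phi N) w.

(** From [1 / (z - w) = 1 / (z - c) + (w - c) / ((z - c) (z - w))] under the integral. *)
Lemma RN_step N w : n1 (w - c) < r -> RN N w = RN N c + (w - c) * RN N.+1 w.
Proof.
move=> wr; have cr : n1 (c - c) < r by rewrite subrr n1_0.
have bk := bcont_ker wr; have bc := bcont_ker cr.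
have b1 := bcontM (phi_bcont (N := N)) bc.
have b2 := bcontM (phi_bcont (N := N.+1)) bk.
have b3 : bcont (fun z => (w - c) * (phi N.+1 z * (z - w)^-1)) c r.
  by have := @bcontM _ c r (fun=> w - c) _ (fun z _ => cont_cst _ z) b2.
rewrite /RN /cauchyT -(sqZ r0 (w - c) b2) -(sqD r0 b1 b3).
apply: eq_sq => // z hz; rewrite /phi exprS.
have n_1 := bdQ_neq wr hz; have n_2 := bdQ_neq cr hz.
move: (f z) (_ ^+ N) n_1 n_2 => A B n_1 n_2; field.
by rewrite n_1 n_2.
Qed.

(** Iterating [RN_step] gives [f J = (w - c)^N RN N] as long as the earlier coefficients vanish. If
    all vanish, [RN N] is at most [K (2 / r)^N], so the right side is at most [K / 2^N] for
    [n1 (w - c) < r / 4], hence the radius. Otherwise the first nonzero coefficient gives the order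
    [n], with [g = RN n / J]. *)
Lemma order_dichotomy :
  (forall w, n1 (w - c) < r / 4 -> f w = 0) \/
  exists n (g : C -> C), [/\ forall w, n1 (w - c) < r -> derivable g w 1,
    g c != 0 & forall w, n1 (w - c) < r -> f w = (w - c) ^+ n * g w].
Proof.
pose J w := sq (fun z => (z - w)^-1) c r.
have J0 w : n1 (w - c) < r -> J w != 0 by exact: sq_ker_neq0 r0.
have fJ w : n1 (w - c) < r -> f w * J w = RN 0 w.
  move=> wr; rewrite -cauchy_formula// /RN /cauchyT.
  by apply: eq_sq => // z _; rewrite /phi expr0 mulr1.
have iter N w : n1 (w - c) < r -> (forall k, (k < N)%N -> RN k c = 0) ->
    f w * J w = (w - c) ^+ N * RN N w.
  move=> wr; elim: N => [|N IH] h; first by rewrite expr0 mul1r fJ.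
  rewrite IH; last by move=> k kN; apply: h; rewrite ltnS ltnW.
  by rewrite (RN_step N wr) h// add0r exprS; ring.
have [[N aN]|an0] := pselect (exists n, RN n c != 0); last first.
  left=> w wr; have wr' : n1 (w - c) < r.
    by rewrite (lt_trans wr)// ltr_pdivrMr// ltr_pMr// ltr1n.
  have a0 k : RN k c = 0.
    by apply/eqP/negPn/negP => h; apply: an0; exists k.
  have [M M0 hM] := bcont_bounded r0 df_bcont.
  have rp : 0 < r - n1 (w - c) by rewrite subr_gt0.
  pose K := 8 * r * (M * (2 / (r - n1 (w - c)))).
  have K0 : 0 <= K by rewrite !mulr_ge0 ?invr_ge0 ?(ltW r0) ?(ltW rp).
  have bnd N : n1 (f w * J w) <= K / 2 ^+ N.
    rewrite (iter N w wr')//; apply: (le_trans (n1M _ _)).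
    have hR : n1 (RN N w) <= K * (2 / r) ^+ N.
      rewrite /RN /cauchyT.
      have -> : K * (2 / r) ^+ N =
        8 * r * (M * (2 / r) ^+ N * (2 / (r - n1 (w - c)))) by rewrite /K; ring.
      apply: sq_bound => //.
        exact: bcontM (phi_bcont (N := N)) (bcont_ker wr').
      move=> z hz; apply: (le_trans (n1M _ _)).
      have inv_le x y : 0 < x -> x <= y -> 2 / y <= 2 / x :> R.
        by move=> x0 xy; rewrite ler_pM2l// lef_pV2// posrE// (lt_le_trans x0).
      rewrite ler_pM ?n1_ge0//; last first.
        by apply: (le_trans (n1V _)); apply: inv_le => //; exact: bdQ_dist.
      apply: (le_trans (n1M _ _)); rewrite ler_pM ?n1_ge0 ?hM//.
      apply: (le_trans (n1X _ _)); rewrite lerXn2r ?nnegrE ?n1_ge0//.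
        by rewrite divr_ge0// ltW.
      by apply: (le_trans (n1V _)); apply: inv_le => //; exact: bdQ_n1.
    apply: (@le_trans _ _ ((r / 4) ^+ N * (K * (2 / r) ^+ N))).
      rewrite ler_pM ?n1_ge0//; apply: (le_trans (n1X _ _)).
      by rewrite lerXn2r ?nnegrE ?n1_ge0 ?divr_ge0// ltW.
    rewrite mulrCA -exprMn -exprVn.
    by have -> : r / 4 * (2 / r) = 2^-1 :> R by field; rewrite gt_eqF.
  have : f w * J w = 0.
    apply: n1_eq0; rewrite leNgt; apply/negP => h.
    have [n hn] := half_small K0 h.
    by have := bnd n; rewrite leNgt hn.
  by move=> /eqP; rewrite mulf_eq0 (negbTE (J0 _ wr')) orbF => /eqP.
right; have [n an hn] := ex_minnP (ex_intro (fun n => RN n c != 0) N aN).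
exists n, (fun w => RN n w * (J w)^-1); split.
- move=> w wr; apply: (@derM R (RN n) (fun w => (J w)^-1) w).
    by apply: cauchyT_derivable => //; exact: phi_bcont.
  apply: (@derV R J w); last exact: J0.
  have b1 : bcont (fun=> 1) c r by move=> z _; exact: cont_cst.
  apply: der_ext (cauchyT_derivable r0 b1 wr); exists 1 => // v _.
  by rewrite /cauchyT; under [X in sq X]eq_fun do rewrite mul1r.
- rewrite mulf_eq0 invr_eq0 negb_or an /=.
  by apply: J0; rewrite subrr n1_0.
- move=> w wr; apply: (mulIf (J0 w wr)).
  rewrite (iter n w wr); first by rewrite -!mulrA mulVf ?mulr1// J0.
  by move=> k; apply: contraTeq => /hn; rewrite -leqNgt.
Qed.

End Kernel.

End Order.

(** * Zeros and poles *)

Section Identity.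
Context {R : realType}.
Local Notation C := (Cplx R).
Implicit Types (F f g : C -> C) (z w p c : C) (r e : R).

Lemma holP f z : holomorphic_at f z <->
  exists2 e : R, 0 < e & forall w, n1 (w - z) < e -> derivable f w 1.
Proof. exact: nearC. Qed.

Lemma inQ_n1 c r z : inQ c r z -> n1 (z - c) <= 2 * r.
Proof. by move=> [h1 h2]; rewrite /n1 !ReImE; clear -h1 h2; lra. Qed.

Lemma hol_order f z : holomorphic_at f z ->
  (exists2 e : R, 0 < e & forall w, n1 (w - z) < e -> f w = 0) \/
  exists n g, [/\ holomorphic_at g z, g z != 0 &
    exists2 e : R, 0 < e & forall w, n1 (w - z) < e -> f w = (w - z) ^+ n * g w].
Proof.
(* A square of half-side [e / 3] reaches [n1]-distance [2 e / 3] at its corners, still less than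
   [e]. *)
move=> /holP[e e0 he]; have r0 : 0 < e / 3 by rewrite divr_gt0.
have [w /inQ_n1 hw|h|[n [g [h1 h2 h3]]]] := @order_dichotomy R z (e / 3) r0 f.
- by apply: he; clear -hw e0; lra.
- by left; exists (e / 3 / 4); rewrite ?divr_gt0.
- right; exists n, g; split => //; last by exists (e / 3).
  by apply/holP; exists (e / 3).
Qed.

(** The dichotomy at [c] with half-side [r / 3] makes [f] vanish within [r / 12] of [c], and this
    covers a ball about [p] because [r / 20 < r / 12]. The other alternative is refuted at a real
    translate of [c]. *)
Lemma identity_near f p c r : 0 < r ->
  (forall w, n1 (w - p) < r -> derivable f w 1) -> n1 (c - p) < r / 20 ->
  (exists2 e : R, 0 < e & forall w, n1 (w - c) < e -> f w = 0) ->
  exists2 e : R, 0 < e & forall w, n1 (w - p) < e -> f w = 0.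
Proof.
move=> r0 df cp [e e0 fe].
have r3 : 0 < r / 3 by rewrite divr_gt0.
have tri w : n1 (w - p) <= n1 (w - c) + n1 (c - p).
  by have := n1D (w - c) (c - p); rewrite addrA subrK.
have tri' w : n1 (w - c) <= n1 (w - p) + n1 (c - p).
  by have := n1D (w - p) (p - c); rewrite addrA subrK (n1_dist p).
have [w /inQ_n1 hw|h|[n [g [h1 h2 h3]]]] := @order_dichotomy R c (r / 3) r3 f.
- by apply: df; have := tri w; clear -hw cp r0; lra.
- exists (r / 3 / 4 - r / 20); first by clear -r0; lra.
  by move=> w hw; apply: h; have := tri' w; clear -hw cp r0; lra.
exfalso.
have gc : {for c, continuous g} by apply/derivable_cont/h1; rewrite subrr n1_0.
have [d d0 hd] := near_ne0 gc h2.
pose m := Num.min e (Num.min (r / 3) d).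
have m0 : 0 < m by rewrite !lt_min e0 r3 d0.
have mc : n1 (c + (m / 2)%:C - c) = m / 2.
  by rewrite addrAC subrr add0r n1_real gtr0_norm// divr_gt0.
have m2 : m / 2 < m by clear -m0; lra.
have [l1 [l2 l3]] : m <= e /\ m <= r / 3 /\ m <= d.
  by rewrite /m !ge_min !lexx !orbT.
have fm : f (c + (m / 2)%:C) = 0 by apply: fe; rewrite mc (lt_le_trans m2).
have := h3 (c + (m / 2)%:C); rewrite fm mc => /(_ (lt_le_trans m2 l2)) /esym/eqP.
rewrite mulf_eq0 expf_eq0 addrAC subrr add0r => /orP[/andP[_ /eqP k0]|].
  by have := n1_real (m / 2); rewrite k0 n1_0 gtr0_norm ?divr_gt0// => k;
    clear -k m0; lra.
by apply/negP/hd; rewrite mc (lt_le_trans m2).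
Qed.

(** Vanishing of a meromorphic germ. The neighbourhood is punctured because a meromorphic function
    may take any value at the point itself. *)
Definition mzero F z := \forall w \near z^', F w = 0.

Lemma mzeroP F z : mzero F z <-> exists2 e : R, 0 < e &
  forall w, w != z -> n1 (w - z) < e -> F w = 0.
Proof. exact: dnearC. Qed.

Lemma mzero_open F z : mzero F z -> exists2 e : R, 0 < e &
  forall w, n1 (w - z) < e -> mzero F w.
Proof.
move=> /mzeroP[e e0 he]; exists e => // w we; apply/mzeroP.
have [->|wz] := eqVneq w z; first by exists e.
have p : 0 < n1 (w - z) by apply: n1_gt0; rewrite subr_eq0.
exists (Num.min (n1 (w - z)) (e - n1 (w - z))); first by rewrite lt_min p subr_gt0.
move=> v vw; rewrite lt_min => /andP[h1 h2]; apply: he.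
  by apply: contraTneq h1 => ->; rewrite n1_dist ltxx.
by have := n1D (v - w) (w - z); rewrite addrA subrK; clear -h2; lra.
Qed.

(** Clearing the denominator at [p] leaves a holomorphic numerator that vanishes near points
    arbitrarily close to [p], to which [identity_near] applies. *)
Lemma mzero_closed F p : meromorphic_at F p ->
  (forall e : R, 0 < e -> exists2 c, n1 (c - p) < e & mzero F c) -> mzero F p.
Proof.
move=> [n [g [/holP[r r0 hr] /dnearC[s s0 hs]]]] hc.
pose m := Num.min (r / 20) s.
have m0 : 0 < m by rewrite lt_min s0 divr_gt0.
have [l1 l2] : m <= r / 20 /\ m <= s by rewrite /m !ge_min !lexx !orbT.
have [c cm /mzeroP[e e0 he]] := hc _ m0.
have [ec|cp] := eqVneq c p; first by apply/mzeroP; exists e => //; rewrite -ec.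
have cp0 : 0 < n1 (c - p) by apply: n1_gt0; rewrite subr_eq0.
(* move off [c], where [F] may take a junk value *)
pose t := Num.min e (Num.min (n1 (c - p)) (m - n1 (c - p))) / 2.
have t2 : 0 < 2 * t.
  by rewrite /t mulrC divfK// !lt_min e0 cp0 subr_gt0 cm.
have t0 : 0 < t by move: t2; clear; lra.
have [k1 [k2 k3]] : 2 * t <= e /\ 2 * t <= n1 (c - p) /\ 2 * t <= m - n1 (c - p).
  by rewrite /t mulrC divfK// !ge_min !lexx !orbT.
pose c' := c + t%:C.
have c'c : n1 (c' - c) = t by rewrite /c' addrAC subrr add0r n1_real gtr0_norm.
have gz : exists2 e : R, 0 < e & forall w, n1 (w - c') < e -> g w = 0.
  exists t => // w wc'.
  have a1 : n1 (w - c) < 2 * t.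
    by have := n1D (w - c') (c' - c); rewrite addrA subrK c'c; clear -wc'; lra.
  have wc : w != c.
    by apply: contraTneq wc' => ->; rewrite n1_dist c'c ltxx.
  have wp : w != p.
    by apply: contraTneq a1 => ->; rewrite -leNgt n1_dist.
  have a2 : n1 (w - p) < s.
    have := n1D (w - c) (c - p); rewrite addrA subrK; clear -a1 k3 l2; lra.
  have := he w wc (lt_le_trans a1 k1); rewrite hs// => /eqP.
  by rewrite mulf_eq0 invr_eq0 expf_eq0 subr_eq0 (negbTE wp) andbF orbF => /eqP.
have c'p : n1 (c' - p) < r / 20.
  by have := n1D (c' - c) (c - p); rewrite addrA subrK c'c; clear -k3 l1 t0; lra.
have [u u0 hu] := identity_near r0 hr c'p gz.
apply/mzeroP; exists (Num.min u s); first by rewrite lt_min u0.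
move=> w wp; rewrite lt_min => /andP[wu ws].
by rewrite hs// hu// mul0r.
Qed.

(** The identity theorem along a segment: at the supremum of the parameters up to which all germs
    vanish, [mzero_closed] gives vanishing and [mzero_open] pushes further unless the end is
    reached. *)
Lemma mzero_segment F (a b : C) :
  (forall t : R, 0 <= t <= 1 -> meromorphic_at F (a + t%:C * (b - a))) ->
  mzero F a -> mzero F b.
Proof.
move=> mF za; pose p t := a + t%:C * (b - a).
have pE s t : n1 (p s - p t) = `|s - t| * n1 (b - a).
  by rewrite -n1_realM rmorphB; congr n1; rewrite /p; ring.
(* A Lipschitz constant of the parametrisation; the [+ 1] keeps it positive when [a = b]. *)
pose N := n1 (b - a) + 1; have N0 : 0 < N by rewrite ltr_wpDl ?n1_ge0.
have pL s t e : `|s - t| < e / N -> n1 (p s - p t) < e.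
  rewrite pE ltr_pdivlMr// => h; apply: le_lt_trans h.
  by rewrite ler_wpM2l// lerDl.
pose T := [set t : R | 0 <= t <= 1 /\ forall s, 0 <= s <= t -> mzero F (p s)].
have T0 : T 0.
  split=> [|s]; first by rewrite lexx ler01.
  by rewrite -eq_le => /eqP <-; rewrite /p mul0r addr0.
have T1 : has_ubound T by exists 1 => t [/andP[]].
pose t := sup T.
have t0 : 0 <= t by apply: ub_le_sup.
have t1 : t <= 1.
  by apply: ge_sup; [exists 0|move=> s [/andP[]]].
have lt_t s : 0 <= s -> s < t -> mzero F (p s).
  move=> s0 st; have ts : 0 < t - s by rewrite subr_gt0.
  have hs : has_sup T by split; [exists 0|].
  have [u [_ hu]] := sup_adherent ts hs.
  by rewrite -/t opprB addrC subrK => su; apply: hu; rewrite s0 ltW.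
have zt : mzero F (p t).
  have [t00|tn0] := eqVneq t 0; first by rewrite t00 /p mul0r addr0.
  have tp : 0 < t by rewrite lt_neqAle eq_sym tn0.
  apply: mzero_closed; first by apply: mF; rewrite t0.
  move=> e e0; have eN : 0 < e / N by rewrite divr_gt0.
  pose s := Num.max 0 (t - e / N / 2).
  have s0 : 0 <= s by rewrite le_max lexx.
  have st : s < t by rewrite gt_max tp ltrBlDr ltrDl divr_gt0.
  exists (p s); last exact: lt_t.
  apply: pL; rewrite distrC ger0_norm ?subr_ge0 ?(ltW st)//.
  have : t - e / N / 2 <= s by rewrite le_max lexx orbT.
  by clear -eN; lra.
have [e e0 he] := mzero_open zt.
have le_t s : 0 <= s <= t -> mzero F (p s).
  move=> /andP[s0]; rewrite le_eqVlt => /orP[/eqP ->//|]; exact: lt_t.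
have [t1'|tlt1] := leP 1 t.
  have t11 : t = 1 by apply/eqP; rewrite eq_le t1.
  by move: zt; rewrite t11 /p mul1r addrC subrK.
exfalso; have eN : 0 < e / N by rewrite divr_gt0.
pose u := Num.min 1 (t + e / N / 2).
have tu : t < u by rewrite lt_min tlt1 ltrDl divr_gt0.
have : T u.
  split; first by rewrite (le_trans t0 (ltW tu)) ge_min lexx.
  move=> s /andP[s0 su]; have [st|ts] := leP s t; first by apply: le_t; rewrite s0.
  apply: he; apply: pL; rewrite gtr0_norm ?subr_gt0//.
  have : s <= t + e / N / 2 by rewrite (le_trans su)// ge_min lexx orbT.
  by clear -eN; lra.
by move=> /(ub_le_sup T1); rewrite -/t leNgt tu.
Qed.

Lemma mer_near F z : meromorphic_at F z <->
  exists n g, [/\ holomorphic_at g z & exists2 e : R, 0 < e &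
    forall w, w != z -> n1 (w - z) < e -> F w = g w / (w - z) ^+ n].
Proof.
split=> -[n [g [hg /dnearC h]]]; exists n, g; split => //.
Qed.

Lemma hol_mer f z : holomorphic_at f z -> meromorphic_at f z.
Proof.
move=> h; exists 0%N, f; split => //; apply/dnearC; exists 1 => // w _ _.
by rewrite expr0 divr1.
Qed.

Lemma hol_comb2 (op : C -> C -> C) f g z : (forall w,
   derivable f w 1 -> derivable g w 1 -> derivable (fun w => op (f w) (g w)) w 1) ->
  holomorphic_at f z -> holomorphic_at g z ->
  holomorphic_at (fun w => op (f w) (g w)) z.
Proof. by move=> h hf hg; apply: filterS2 hf hg => w; exact: h. Qed.

Lemma holB f g z : holomorphic_at f z -> holomorphic_at g z ->
  holomorphic_at (fun w => f w - g w) z.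
Proof. by apply: (@hol_comb2 (fun a b => a - b)) => w; exact: derB. Qed.

Lemma holM f g z : holomorphic_at f z -> holomorphic_at g z ->
  holomorphic_at (fun w => f w * g w) z.
Proof. by apply: (@hol_comb2 (fun a b => a * b)) => w; exact: (@derM R f g w). Qed.
Lemma hol_all f z : (forall w, derivable f w 1) -> holomorphic_at f z.
Proof. by move=> h; apply/holP; exists 1. Qed.

Lemma holXB n z : holomorphic_at (fun w => (w - z) ^+ n) z.
Proof.
by apply: hol_all => w; apply: derX; apply: derB (der_id w) (der_cst z w).
Qed.
Lemma hol_cont f z : holomorphic_at f z -> {for z, continuous f}.
Proof.
by move=> /holP[e e0 h]; apply: derivable_cont; apply: h; rewrite subrr n1_0.
Qed.
Lemma holV f z : holomorphic_at f z -> f z != 0 ->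
  holomorphic_at (fun w => (f w)^-1) z.
Proof.
move=> hf fz; have [e e0 he] := near_ne0 (hol_cont hf) fz.
move: hf => /holP[t t0 ht]; apply/holP; exists (Num.min e t).
  by rewrite lt_min e0.
move=> w; rewrite lt_min => /andP[we wt].
by apply: (@derV R f w); [exact: ht|exact: he].
Qed.

Lemma merB F1 F2 z : meromorphic_at F1 z -> meromorphic_at F2 z ->
  meromorphic_at (fun w => F1 w - F2 w) z.
Proof.
move=> /mer_near[n [f [hf [d d0 hd]]]] /mer_near[k [g [hg [e e0 he]]]].
apply/mer_near; exists (n + k)%N,
  (fun w => f w * (w - z) ^+ k - g w * (w - z) ^+ n); split.
  exact: (holB (holM hf (holXB k z)) (holM hg (holXB n z))).
exists (Num.min d e); first by rewrite lt_min d0.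
move=> w wz; rewrite lt_min => /andP[wd we].
rewrite (hd w wz wd) (he w wz we) exprD; field.
by rewrite !expf_neq0// subr_eq0.
Qed.

Lemma mer_quot f g z : holomorphic_at f z -> holomorphic_at g z ->
  ~ mzero g z -> meromorphic_at (fun w => f w / g w) z.
Proof.
move=> hf hg gz; case: (hol_order hg) => [[e e0 he]|[n [d [hd d0 [e e0 he]]]]].
  by exfalso; apply: gz; apply/mzeroP; exists e => // w _; exact: he.
apply/mer_near; exists n, (fun w => f w * (d w)^-1); split.
  exact: (holM hf (holV hd d0)).
exists e => // w wz we; rewrite (he w we) invfM.
by rewrite mulrA mulrAC.
Qed.

End Identity.

(** * Locally absolutely continuous functions *)

Section AC.
Context {R : realType}.
Local Notation C := (Cplx R).
Local Notation mu := (@lebesgue_measure R).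
Implicit Types (U V u v : R -> C).

Lemma prim_continuous (f : R -> R) (k b : R) : 0 <= b ->
  mu.-integrable `[0, b] (EFin \o f) ->
  {within `[0, b], continuous (fun x => k + \int[mu]_(t in `[0, x]) f t)}.
Proof.
move=> b0 fi; have h := parameterized_integral_continuous b0 fi.
by move=> x; apply: cvgD; [exact: cvg_cst|exact: h].
Qed.

Lemma within_eq (A : set R) (f g : R -> R) : (forall x, A x -> f x = g x) ->
  {within A, continuous f} -> {within A, continuous g}.
Proof.
move=> fg hf; apply: (@subspace_eq_continuous R A R f g _ hf).
by move=> x /set_mem; exact: fg.
Qed.

Lemma continuous_itv_le (f : R -> R) (a b a' b' : R) : a <= a' -> b' <= b ->
  {within `[a, b], continuous f} -> {within `[a', b'], continuous f}.
Proof. by move=> aa bb; apply: continuous_subspaceW; exact: sub_itvcc. Qed.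

Lemma AC_continuous U u b : 0 <= b -> AC_deriv U u ->
  {within `[0, b], continuous (fun x => Re (U x))} /\
  {within `[0, b], continuous (fun x => Im (U x))}.
Proof.
move=> b0 hU; have [[i1 i2] _] := hU b b0; split.
  apply: (within_eq _ (prim_continuous (k := Re (U 0)) b0 i1)) => x.
  by rewrite /= in_itv/= => /andP[x0 _]; rewrite (hU x x0).2 ReD.
apply: (within_eq _ (prim_continuous (k := Im (U 0)) b0 i2)) => x.
by rewrite /= in_itv/= => /andP[x0 _]; rewrite (hU x x0).2 ImD.
Qed.

Lemma le_prim (f : R -> R) (x b : R) : x <= b ->
  mu.-integrable `[0, b] (EFin \o f) -> (forall t, 0 <= f t) ->
  \int[mu]_(t in `[0, x]) f t <= \int[mu]_(t in `[0, b]) f t.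
Proof.
move=> xb fi f0; have [x0|x0] := leP 0 x; last first.
  by rewrite set_itv_ge ?bnd_simp -?ltNge// Rintegral_set0 Rintegral_ge0.
by rewrite (Rintegral_split x0 xb fi) lerDl Rintegral_ge0.
Qed.

Lemma AC_bm U u b : 0 <= b -> AC_deriv U u -> bm `[0, b]%classic U.
Proof.
move=> b0 hU; have [c1 c2] := AC_continuous b0 hU; have [ui _] := hU b b0.
split; [exact: subspace_continuous_measurable_fun|
  exact: subspace_continuous_measurable_fun|].
exists (n1 (U 0) + \int[mu]_(t in `[0, b]) n1 (u t)) => x.
rewrite /= in_itv/= => /andP[x0 xb]; have [uix ->] := hU x x0.
apply: (le_trans (n1D _ _)); rewrite lerD2l.
apply: (le_trans (n1_integralC _ uix)) => //.
by apply: le_prim => //; [exact: integrable_n1|move=> t; exact: n1_ge0].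
Qed.

Lemma AC_int U u b : 0 <= b -> AC_deriv U u -> integrableC `[0, b]%classic u.
Proof. by move=> b0 h; have [] := h b b0. Qed.

Lemma AC_diff U u (s t : R) : 0 <= s -> s <= t -> AC_deriv U u ->
  U t - U s = integralC `[s, t]%classic u.
Proof.
move=> s0 st h; have t0 := le_trans s0 st.
have [ti ->] := h t t0; have [si ->] := h s s0.
rewrite (integralC_split s0 st ti); ring.
Qed.

Lemma integrableC_sub (a b a' b' : R) u : a <= a' -> b' <= b ->
  integrableC `[a, b]%classic u -> integrableC `[a', b']%classic u.
Proof. by move=> aa bb; apply: integrableCS => //; exact: sub_itvcc. Qed.

(* If a function varies by at most the square of the variation of a continuous
   one, halving the latter by the intermediate value theorem shows that it is
   constant. *)
Lemma square_variation_const (P : R -> C) (N : R -> R) (b : R) :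
  {within `[0, b], continuous N} ->
  (forall s t, 0 <= s -> s <= t -> t <= b -> N s <= N t) ->
  (forall s t, 0 <= s -> s <= t -> t <= b -> n1 (P t - P s) <= (N t - N s) ^+ 2) ->
  forall t, 0 <= t <= b -> P t = P 0.
Proof.
move=> cN mN hP.
have key k s t : 0 <= s -> s <= t -> t <= b ->
    n1 (P t - P s) <= (N t - N s) ^+ 2 / 2 ^+ k.
  elim: k s t => [|k IH] s t s0 st tb; first by rewrite expr0 divr1 hP.
  have Nst := mN s t s0 st tb.
  have [r rst rE] : exists2 r, r \in `[s, t] & N r = (N s + N t) / 2.
    apply: IVT => //; first exact: continuous_itv_le cN.
    rewrite (min_idPl Nst) (max_idPr Nst).
    by apply/andP; split; clear -Nst; lra.
  move: rst; rewrite in_itv/= => /andP[sr rt].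
  rewrite -(subrK (P r) (P t)) -addrA; apply: (le_trans (n1D _ _)).
  apply: (le_trans (lerD (IH r t (le_trans s0 sr) rt tb) (IH s r s0 sr (le_trans rt tb)))).
  rewrite rE [2 ^+ k.+1]exprS le_eqVlt; apply/orP; left; apply/eqP.
  have c0 : 2 ^+ k != 0 :> R by rewrite expf_neq0.
  move: (2 ^+ k) c0 => c c0; field.
  by rewrite c0.
move=> t /andP[t0 tb]; apply/eqP; rewrite -subr_eq0; apply/eqP/n1_eq0.
rewrite leNgt; apply/negP => h.
have q0 : 0 <= (N t - N 0) ^+ 2 by exact: sqr_ge0.
have [k hk] := half_small q0 h.
by have := key k 0 t (lexx 0) t0 tb; rewrite leNgt hk.
Qed.

(** Integration by parts without differentiation almost everywhere: the defect [P] of the product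
    formula varies at most by the square of the variation of a primitive of [n1 u + n1 v], so
    [square_variation_const] makes it constant. *)
Lemma AC_mul U V u v : AC_deriv U u -> AC_deriv V v ->
  AC_deriv (fun x => U x * V x) (fun x => u x * V x + U x * v x).
Proof.
move=> hU hV x x0.
have ui := AC_int x0 hU; have vi := AC_int x0 hV.
have Ub := AC_bm x0 hU; have Vb := AC_bm x0 hV.
have uVi : integrableC `[0, x]%classic (fun t => u t * V t).
  have h := integrableC_bmul (measurable_itv _) Vb ui.
  by apply: (eq_integrableC _ _ h) => // t _; exact: mulrC.
have Uvi : integrableC `[0, x]%classic (fun t => U t * v t).
  exact: integrableC_bmul.
have wi := integrableCD (measurable_itv _) uVi Uvi.
split=> //.
(* The leading [0 +] matches the shape of [prim_continuous]. *)
pose N y := 0 + \int[mu]_(t in `[0, y]) (n1 (u t) + n1 (v t)).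
have ni : mu.-integrable `[0, x] (EFin \o (fun t => n1 (u t) + n1 (v t))).
  by apply: integrable_add => //; exact: integrable_n1.
pose w t := u t * V t + U t * v t.
pose P y := U y * V y - integralC `[0, y]%classic w.
suff : P x = P 0.
  rewrite /P set_itv1 => /eqP; rewrite subr_eq => /eqP ->.
  rewrite (_ : integralC [set 0] w = 0) ?subr0//.
  by apply: CP; rewrite /= Rintegral_set1.
have sub s t : 0 <= s -> t <= x -> `[s, t]%classic `<=` `[0, x]%classic.
  by move=> *; exact: sub_itvcc.
have NE s t : 0 <= s -> s <= t -> t <= x ->
    N t - N s = \int[mu]_(t in `[s, t]) (n1 (u t) + n1 (v t)).
  move=> s0 st tx; rewrite /N !add0r (Rintegral_split s0 st); first by rewrite addrC addKr.
  by apply: integrableS ni => //; exact: sub.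
apply: (@square_variation_const P N x); last by rewrite x0 lexx.
- exact: prim_continuous.
- move=> s t s0 st tx; rewrite -subr_ge0 NE//; apply: Rintegral_ge0 => r _.
  by rewrite addr_ge0 ?n1_ge0.
move=> s t s0 st tx; have t0 := le_trans s0 st.
have uis : integrableC `[s, t]%classic u by exact: integrableC_sub ui.
have vis : integrableC `[s, t]%classic v by exact: integrableC_sub vi.
have wis : integrableC `[s, t]%classic w by exact: integrableC_sub wi.
have nis : mu.-integrable `[s, t] (EFin \o (fun t => n1 (u t) + n1 (v t))).
  by apply: integrableS ni => //; exact: sub.
have e1 : integralC `[0, t]%classic w =
    integralC `[0, s]%classic w + integralC `[s, t]%classic w.
  by apply: integralC_split => //; exact: integrableC_sub wi.
have z1 : integrableC `[s, t]%classic (fun r => V t * u r) by exact: integrableCZ.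
have z2 : integrableC `[s, t]%classic (fun r => U s * v r) by exact: integrableCZ.
(* The increment of [U V] is [V t (U t - U s) + U s (V t - V s)], both brackets being integrals.
   What remains under the integral is an increment times a derivative, and each increment is at most
   [N t - N s]. *)
have -> : P t - P s =
    integralC `[s, t]%classic (fun r => V t * u r + U s * v r - w r).
  rewrite integralCB//; last exact: integrableCD.
  rewrite integralCD// !integralCZ// -(AC_diff s0 st hU) -(AC_diff s0 st hV).
  by rewrite /P e1; ring.
have Nst0 : 0 <= N t - N s.
  by rewrite NE// Rintegral_ge0// => r _; rewrite addr_ge0 ?n1_ge0.
apply: (@le_trans _ _
  (\int[mu]_(r in `[s, t]) ((N t - N s) * (n1 (u r) + n1 (v r))))); last first.
  by rewrite RintegralZl// -NE.
apply: integralC_le.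
- by apply: integrableCB => //; exact: integrableCD.
- exact: integrable_scale.
move=> r /andP[sr rt].
have -> : V t * u r + U s * v r - w r =
  (V t - V r) * u r - (U r - U s) * v r by rewrite /w; ring.
have r0 := le_trans s0 sr; have rx := le_trans rt tx.
have bnd (Z z : R -> C) a b : s <= a -> a <= b -> b <= t -> AC_deriv Z z ->
    (forall r, n1 (z r) <= n1 (u r) + n1 (v r)) -> n1 (Z b - Z a) <= N t - N s.
  move=> sa ab bt hZ hz; have a0 := le_trans s0 sa; have bx := le_trans bt tx.
  have zi : integrableC `[a, b]%classic z.
    exact: (integrableC_sub a0 (lexx b) (AC_int (le_trans a0 ab) hZ)).
  rewrite (AC_diff a0 ab hZ); apply: (@le_trans _ _ (N b - N a)).
    rewrite NE//; apply: integralC_le => //.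
    by apply: integrableS ni => //; exact: sub.
  rewrite lerB//.
    rewrite -subr_ge0 NE ?(le_trans a0 ab)//; apply: Rintegral_ge0 => y _.
    by rewrite addr_ge0 ?n1_ge0.
  rewrite -subr_ge0 NE ?(le_trans ab bx)//; apply: Rintegral_ge0 => y _.
  by rewrite addr_ge0 ?n1_ge0.
rewrite mulrDr; apply: (le_trans (n1B _ _)); rewrite lerD//.
  apply: (le_trans (n1M _ _)); rewrite ler_wpM2r ?n1_ge0//.
  by apply: bnd hV _ => // y; rewrite lerDr n1_ge0.
apply: (le_trans (n1M _ _)); rewrite ler_wpM2r ?n1_ge0//.
by apply: bnd hU _ => // y; rewrite lerDl n1_ge0.
Qed.

Lemma eq_AC U V u v : (forall x, 0 <= x -> U x = V x) ->
  (forall x, 0 <= x -> u x = v x) -> AC_deriv U u -> AC_deriv V v.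
Proof.
move=> UV uv h x x0; have [i e] := h x x0.
have uv' t : `[0, x]%classic t -> u t = v t.
  by rewrite /= in_itv/= => /andP[t0 _]; exact: uv.
split; first exact: eq_integrableC uv' i.
by rewrite -!UV// e; congr (_ + _); exact: eq_integralC.
Qed.

Lemma AC_add U V u v : AC_deriv U u -> AC_deriv V v ->
  AC_deriv (fun x => U x + V x) (fun x => u x + v x).
Proof.
move=> hU hV x x0; have [ui eU] := hU x x0; have [vi eV] := hV x x0.
split; first exact: integrableCD.
rewrite integralCD// eU eV; ring.
Qed.

Lemma AC_scale (k : C) U u : AC_deriv U u ->
  AC_deriv (fun x => k * U x) (fun x => k * u x).
Proof.
move=> hU x x0; have [ui eU] := hU x x0.
split; first exact: integrableCZ.
rewrite integralCZ// eU; ring.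
Qed.

Lemma AC_sub U V u v : AC_deriv U u -> AC_deriv V v ->
  AC_deriv (fun x => U x - V x) (fun x => u x - v x).
Proof.
move=> hU hV; have := AC_add hU (AC_scale (-1) hV).
by apply: eq_AC => x _; rewrite mulN1r.
Qed.

Lemma integrableC_conj (D : set R) u : measurable (D : set (measurableTypeR R)) ->
  integrableC D u -> integrableC D (fun x => cj (u x)).
Proof.
move=> mD [h1 h2]; split.
  by apply: eq_integrable h1 => // x _ /=; case: (u x).
have := integrable_scale (-1) mD h2.
by apply: eq_integrable => // x _ /=; case: (u x) => a b /=; rewrite mulN1r.
Qed.

Lemma integralC_conj (D : set R) u : measurable (D : set (measurableTypeR R)) ->
  integrableC D u ->
  integralC D (fun x => cj (u x)) = cj (integralC D u).
Proof.
move=> mD [h1 h2]; apply: CP => /=.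
  by apply: eq_Rintegral => x _; case: (u x).
rewrite -mulN1r -RintegralZl//; apply: eq_Rintegral => x _.
by case: (u x) => a b /=; rewrite mulN1r.
Qed.

Lemma AC_conj U u : AC_deriv U u ->
  AC_deriv (fun x => cj (U x)) (fun x => cj (u x)).
Proof.
move=> hU x x0; have [ui eU] := hU x x0.
split; first exact: integrableC_conj.
by rewrite integralC_conj// {1}eU cjD.
Qed.

Lemma aeS (P Q : R -> Prop) : (forall x, P x -> Q x) ->
  {ae mu, forall x, P x} -> {ae mu, forall x, Q x}.
Proof.
exact: (@filterS _ (almost_everywhere mu) (ae_filter_ringOfSetsType mu) P Q).
Qed.

Lemma aeS2 (P Q S : R -> Prop) : (forall x, P x -> Q x -> S x) ->
  {ae mu, forall x, P x} -> {ae mu, forall x, Q x} -> {ae mu, forall x, S x}.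
Proof.
exact: (@filterS2 _ (almost_everywhere mu) (ae_filter_ringOfSetsType mu) P Q S).
Qed.

(* Uniqueness of the a.e. derivative is never needed: changing it on a null set
   leaves its primitive unchanged. *)
Lemma AC_ae U u v : AC_deriv U u -> (forall b, 0 <= b ->
    measurable_fun (`[0, b]%classic : set (measurableTypeR R)) (fun x => Re (v x)) /\
    measurable_fun (`[0, b]%classic : set (measurableTypeR R)) (fun x => Im (v x))) ->
  {ae mu, forall x, 0 <= x -> u x = v x} -> AC_deriv U v.
Proof.
move=> hU mv uv x x0; have [ui eU] := hU x x0; have [m1 m2] := mv x x0.
have ae1 : ae_eq mu `[0, x]%classic (EFin \o (fun x => Re (u x))) (EFin \o (fun x => Re (v x))).
  by apply: aeS uv => y h /=; rewrite in_itv/= => /andP[y0 _]; rewrite h.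
have ae2 : ae_eq mu `[0, x]%classic (EFin \o (fun x => Im (u x))) (EFin \o (fun x => Im (v x))).
  by apply: aeS uv => y h /=; rewrite in_itv/= => /andP[y0 _]; rewrite h.
have int_ae (f g : R -> R) : ae_eq mu `[0, x]%classic (EFin \o f) (EFin \o g) ->
    measurable_fun (`[0, x]%classic : set (measurableTypeR R)) g ->
    mu.-integrable `[0, x] (EFin \o f) ->
    mu.-integrable `[0, x] (EFin \o g) /\
    \int[mu]_(t in `[0, x]) f t = \int[mu]_(t in `[0, x]) g t.
  move=> fg mg /[dup] fi /integrableP[mf fi'].
  have mg' : measurable_fun (`[0, x]%classic : set (measurableTypeR R)) (EFin \o g).
    exact/measurable_EFinP.
  split; last by rewrite /Rintegral; congr fine; apply: ae_eq_integral.
  apply/integrableP; split => //.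
  have -> : (\int[mu]_(t in `[0%R, x]%classic) `|(EFin \o g) t| =
    \int[mu]_(t in `[0%R, x]%classic) `|(EFin \o f) t|)%E.
    apply: ae_eq_integral => //.
    - exact: measurableT_comp.
    - exact: measurableT_comp.
    - by apply: aeS fg => y h /h /= [->].
  exact: fi'.
have [g1 e1] := int_ae _ _ ae1 m1 ui.1.
have [g2 e2] := int_ae _ _ ae2 m2 ui.2.
by split=> //; rewrite eU; congr (_ + _); apply: CP.
Qed.

End AC.

(** * Gronwall estimates with an integrable weight *)

Section Picard.
Context {R : realType}.
Local Notation C := (Cplx R).
Local Notation mu := (@lebesgue_measure R).
Local Notation mfun A g := (measurable_fun (A : set (measurableTypeR R)) g).

Definition locint (f : R -> R) :=
  forall b : R, 0 <= b -> mu.-integrable `[0, b] (EFin \o f).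

Lemma real_integrableC (D : set R) (f : R -> R) :
  measurable (D : set (measurableTypeR R)) ->
  mu.-integrable D (EFin \o f) -> integrableC D (fun x => (f x)%:C).
Proof. by move=> mD h; split=> //=; exact: integrable0. Qed.

Lemma integralC_real (D : set R) (f : R -> R) :
  integralC D (fun x => (f x)%:C) = (\int[mu]_(x in D) f x)%:C.
Proof. by apply: CP => //=; rewrite /Rintegral integral0_eq. Qed.

Lemma AC_prim (k : C) (f : R -> C) :
  (forall b : R, 0 <= b -> integrableC `[0, b]%classic f) ->
  AC_deriv (fun x => k + integralC `[0, x]%classic f) f.
Proof.
move=> fi x x0; split; first exact: fi.
congr (_ + _); rewrite set_itv1 (_ : integralC [set 0] f = 0) ?addr0//.
by apply: CP; rewrite /= Rintegral_set1.
Qed.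

Lemma AC_real (f : R -> R) : locint f ->
  AC_deriv (fun x => (\int[mu]_(t in `[0, x]) f t)%:C) (fun t => (f t)%:C).
Proof.
move=> fi; have h : forall b : R, 0 <= b -> integrableC `[0, b]%classic (fun t => (f t)%:C).
  by move=> b b0; apply: real_integrableC => //; exact: fi.
by apply: eq_AC (AC_prim 0 h) => // x _; rewrite add0r integralC_real.
Qed.

Section Gronwall.
Variables (w : R -> R).
Hypotheses (w0 : forall t, 0 <= w t) (wi : locint w).
Let W x := \int[mu]_(t in `[0, x]) w t.

(** The chain rule for powers of a primitive, by induction from [AC_mul]; it evaluates the integrals
    of [W^n w] that occur in Picard iteration. *)
Lemma AC_pow n : AC_deriv (fun x => (W x)%:C ^+ n.+1)
  (fun t => n.+1%:R * ((W t)%:C ^+ n * (w t)%:C)).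
Proof.
elim: n => [|n IH].
  by apply: eq_AC (AC_real wi) => x _; rewrite ?expr1// expr0 !mul1r.
apply: eq_AC (AC_mul (AC_real wi) IH) => x _; first by rewrite [RHS]exprS.
rewrite -/(W x) [_ ^+ n.+1]exprS -[n.+2]add1n natrD; ring.
Qed.

Lemma W_ge0 x : 0 <= W x.
Proof. by apply: Rintegral_ge0. Qed.

Lemma W_mono x y : 0 <= y -> x <= y -> W x <= W y.
Proof. by move=> y0 xy; apply: le_prim => //; exact: wi. Qed.

Lemma W_pow_int n x : 0 <= x ->
  mu.-integrable `[0, x] (EFin \o (fun t => W t ^+ n * w t)) /\
  \int[mu]_(t in `[0, x]) (W t ^+ n * w t) = W x ^+ n.+1 / n.+1%:R.
Proof.
move=> x0.
have eR t : (n.+1%:R * ((W t)%:C ^+ n * (w t)%:C) : C) =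
    (n.+1%:R * (W t ^+ n * w t))%:C.
  by rewrite !rmorphM /= rmorphXn rmorph_nat.
have [[i1 _] e] := AC_pow n x0.
have nz : n.+1%:R != 0 :> R by rewrite pnatr_eq0.
have ii : mu.-integrable `[0, x] (EFin \o (fun t => W t ^+ n * w t)).
  have := integrable_scale n.+1%:R^-1 (measurable_itv `[0, x]) i1.
  apply: eq_integrable => // t _ /=; congr (_%:E).
  by have -> := eR t; rewrite /= mulKf.
split=> //; move: e; rewrite (eq_integralC (fun t _ => eR t)) integralC_real.
rewrite RintegralZl//.
have W0 : W 0 = 0 by rewrite /W set_itv1 Rintegral_set1.
rewrite W0 -!rmorphXn /= expr0n /= add0r => /(congr1 (@Re R)) /= ->.
by rewrite mulrC mulKf.
Qed.

(** It serves twice: existence takes for [d n] the distance between successive Picard iterates,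
    uniqueness the constant sequence, which is then dominated by the terms of a convergent
    exponential series. *)
Lemma gronwall_iter (d : nat -> R -> R) (K b : R) : 0 <= b ->
  (forall n, mu.-integrable `[0, b] (EFin \o (fun t => d n t * w t))) ->
  (forall x, 0 <= x <= b -> d 0%N x <= K) ->
  (forall n x, 0 <= x <= b -> d n.+1 x <= \int[mu]_(t in `[0, x]) (d n t * w t)) ->
  forall n x, 0 <= x <= b -> d n x <= K * exp_coeff (W x) n.
Proof.
move=> b0 di d0 dS; elim=> [|n IH] x xb.
  by rewrite /exp_coeff /= expr0 divr1 mulr1 d0.
apply: (le_trans (dS n x xb)); have /andP[x0 xb'] := xb.
have [i1 e1] := W_pow_int n x0.
have -> : K * exp_coeff (W x) n.+1 =
    \int[mu]_(t in `[0, x]) (K / n`!%:R * (W t ^+ n * w t)).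
  rewrite RintegralZl// e1 /exp_coeff /= factS natrM.
  have f0 : n`!%:R != 0 :> R by rewrite pnatr_eq0 -lt0n fact_gt0.
  have nz : n.+1%:R != 0 :> R by rewrite pnatr_eq0.
  move: (n`!%:R) (n.+1%:R) f0 nz => u v u0 v0; field.
  by rewrite u0 v0.
apply: le_Rintegral => //.
- by apply: integrableS (di n) => //; exact: sub_itvcc.
- exact: integrable_scale.
move=> t /=; rewrite in_itv/= => /andP[t0 tx].
rewrite mulrA ler_wpM2r//.
have := IH t; rewrite t0 (le_trans tx xb') => /(_ isT); rewrite /exp_coeff /=.
by rewrite mulrA mulrAC.
Qed.

Lemma gronwall0 (d : R -> R) (K b : R) : 0 <= b -> 0 <= K ->
  mu.-integrable `[0, b] (EFin \o (fun t => d t * w t)) ->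
  (forall x, 0 <= x <= b -> 0 <= d x <= K) ->
  (forall x, 0 <= x <= b -> d x <= \int[mu]_(t in `[0, x]) (d t * w t)) ->
  forall x, 0 <= x <= b -> d x = 0.
Proof.
move=> b0 K0 di dK dS x xb; apply/eqP; rewrite eq_le.
have /andP[-> _] := dK x xb; rewrite andbT.
have h n : d x <= K * exp_coeff (W x) n.
  apply: (@gronwall_iter (fun=> d) K b) => //.
  by move=> y /dK/andP[].
have cv : (fun n => K * exp_coeff (W x) n) @ \oo --> K * 0.
  apply: cvgM; first exact: cvg_cst.
  by apply: cvg_series_cvg_0; exact: is_cvg_series_exp_coeff.
rewrite mulr0 in cv.
rewrite -(cvg_lim (@Rhausdorff R) cv); apply: limr_ge; first by apply/cvg_ex; exists 0.
by near=> n; exact: h.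
Unshelve. all: by end_near.
Qed.

End Gronwall.

(** Adding the partial sums of [B] to [a] produces a nondecreasing bounded sequence, so convergence
    follows from monotonicity. *)
Lemma seq_limit (a B : nat -> R) : (forall n, `|a n.+1 - a n| <= B n) ->
  cvgn (series B) ->
  (a @ \oo --> limn a) /\ forall n, `|limn a - a n| <= limn (series B) - series B n.
Proof.
move=> aB cB; set S := series B.
have SS n : S n.+1 = S n + B n by rewrite /S /series /= big_nat_recr.
have B0 n : 0 <= B n by apply: le_trans (aB n).
have ndS : nondecreasing_seq S.
  by apply/nondecreasing_seqP => n; rewrite SS lerDl.
have SL n : S n <= limn S by exact: nondecreasing_cvgn_le.
have diff n k : `|a (n + k)%N - a n| <= S (n + k)%N - S n.
  elim: k => [|k IH]; first by rewrite addn0 !subrr normr0.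
  rewrite addnS SS.
  have -> : a (n + k).+1 - a n = (a (n + k).+1 - a (n + k)%N) + (a (n + k)%N - a n) by ring.
  apply: (le_trans (ler_normD _ _)).
  by have := aB (n + k)%N; clear -IH; lra.
pose s n := a n + S n.
have nds : nondecreasing_seq s.
  apply/nondecreasing_seqP => n; rewrite /s SS.
  by have := aB n; rewrite ler_norml => /andP[h _]; clear -h; lra.
have cs : cvgn s.
  apply: (nondecreasing_is_cvgn nds); exists (a 0%N + limn S + limn S - S 0%N) => _ [n _ <-].
  have := diff 0%N n; rewrite add0n ler_norml => /andP[_ h].
  by have := SL n; rewrite /s; clear -h; lra.
have ca : cvgn a.
  have -> : a = (fun n => s n - S n) by apply/funext => n; rewrite /s addrK.
  by apply: is_cvgB.
split=> // n.
have h k : (n <= k)%N -> `|a k - a n| <= limn S - S n.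
  move=> nk; have := diff n (k - n)%N; rewrite subnKC// => h.
  by apply: (le_trans h); rewrite lerD2r.
have c1 : (fun k => `|a k - a n|) @ \oo --> `|limn a - a n|.
  by apply: cvg_norm; apply: cvgB => //; exact: cvg_cst.
rewrite -(cvg_lim (@Rhausdorff R) c1); apply: limr_le.
  by apply/cvg_ex; exists `|limn a - a n|.
by near=> k; apply: h; near: k; exists n.
Unshelve. all: by end_near.
Qed.

End Picard.

(** * The Dirac system *)

Section DiracODE.
Context {R : realType}.
Local Notation C := (Cplx R).
Local Notation mu := (@lebesgue_measure R).
Local Notation mfun A g := (measurable_fun (A : set (measurableTypeR R)) g).
Implicit Types (u v g : R -> C * C) (lam : C) (b : R).

Definition d2 (z w : C * C) : R := n1 (z.1 - w.1) + n1 (z.2 - w.2).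
Definition n2 (z : C * C) : R := n1 z.1 + n1 z.2.

Lemma d2_ge0 z w : 0 <= d2 z w. Proof. by rewrite addr_ge0 ?n1_ge0. Qed.
Lemma n2_ge0 z : 0 <= n2 z. Proof. by rewrite addr_ge0 ?n1_ge0. Qed.
Lemma d2_eq0 z w : d2 z w <= 0 -> z = w.
Proof.
move=> h; have h1 := n1_ge0 (z.1 - w.1); have h2 := n1_ge0 (z.2 - w.2).
rewrite (surjective_pairing z) (surjective_pairing w).
by congr pair; apply/eqP; rewrite -subr_eq0; apply/eqP/n1_eq0;
  move: h; rewrite /d2; clear -h1 h2; lra.
Qed.
Lemma n1_triB (x y z : C) : n1 (x - z) <= n1 (x - y) + n1 (y - z).
Proof. by rewrite -{1}(subrK y x) -addrA n1D. Qed.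
Lemma d2_tri z y w : d2 z w <= d2 z y + d2 y w.
Proof.
rewrite /d2; have := n1_triB z.1 y.1 w.1; have := n1_triB z.2 y.2 w.2; lra.
Qed.
Lemma d2_sym z w : d2 z w = d2 w z. Proof. by rewrite /d2 n1_dist [X in _ + X]n1_dist. Qed.
Lemma d20 z : d2 z 0 = n2 z. Proof. by rewrite /d2 /n2 !subr0. Qed.

Lemma mfun_n1 (D : set R) (f : R -> C) : bm D f -> mfun D (fun x => n1 (f x)).
Proof.
move=> [f1 f2 _]; apply: measurable_funD; exact: measurableT_comp.
Qed.

Definition bmp b u := bm `[0, b]%classic (fun x => (u x).1) /\
  bm `[0, b]%classic (fun x => (u x).2).
(** The space in which Picard iteration runs: its elements times the merely integrable coefficients
    remain integrable on segments. *)
Definition lbm u := forall b, 0 <= b -> bmp b u.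

Lemma bmp_bounded b u : bmp b u ->
  exists2 M : R, 0 <= M & forall x, 0 <= x <= b -> n2 (u x) <= M.
Proof.
move=> [[_ _ [M hM]] [_ _ [N hN]]]; exists (`|M| + `|N|); first by rewrite addr_ge0.
move=> x xb; rewrite /n2 lerD//.
  by apply: (le_trans (hM x _)); rewrite /= ?in_itv ?ler_norm.
by apply: (le_trans (hN x _)); rewrite /= ?in_itv ?ler_norm.
Qed.

Variables (m : R) (p1 p2 q : R -> R).
Hypotheses (p1i : locint p1) (p2i : locint p2) (qi : locint q).

(** The equation solved for the derivatives: the second row of [(H - lam) u = g] yields [u_1'], the
    first row yields [u_2']. *)
Definition rhs lam g u (t : R) : C * C :=
  (- (q t)%:C * (u t).1 + ((m - p2 t)%:C + lam) * (u t).2 + (g t).2,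
   ((m + p1 t)%:C - lam) * (u t).1 + (q t)%:C * (u t).2 - (g t).1).

(* [dsol lam g u] says that [u] solves [(H - lam) u = g] on the half-line,
   without boundary condition. *)
Definition dsol lam g u :=
  AC_deriv (fun x => (u x).1) (fun x => (rhs lam g u x).1) /\
  AC_deriv (fun x => (u x).2) (fun x => (rhs lam g u x).2).

(** The pointwise Lipschitz constant of [rhs] in [rhs_lip]; it is locally integrable but in general
    unbounded. *)
Definition wt lam (t : R) : R := `|q t| + `|p1 t| + `|p2 t| + (`|m| + n1 lam).

Lemma wt_ge0 lam t : 0 <= wt lam t.
Proof. by rewrite !addr_ge0 ?n1_ge0. Qed.

Lemma wt_int lam : locint (wt lam).
Proof.
move=> b b0; do ![apply: integrable_add => //]; first
  [exact: integrable_cst|idtac].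
- exact: integrable_absR (qi b0).
- exact: integrable_absR (p1i b0).
- exact: integrable_absR (p2i b0).
Qed.

Let cint b (f : R -> R) : 0 <= b -> locint f ->
  integrableC `[0, b]%classic (fun x => (f x)%:C).
Proof. by move=> b0 fi; apply: real_integrableC => //; exact: fi. Qed.

Let locintD (k : R) f : locint f -> locint (fun t => k + f t).
Proof. by move=> fi b b0; apply: integrable_add => //; [exact: integrable_cst|exact: fi]. Qed.

Let locintB (k : R) f : locint f -> locint (fun t => k - f t).
Proof. by move=> fi b b0; apply: integrable_sub => //; [exact: integrable_cst|exact: fi]. Qed.

Let cst_int b (k : C) : integrableC `[0, b]%classic (fun=> k).
Proof. by apply: bm_integrable; exact: bm_cst. Qed.

Lemma rhs_int lam g u b : 0 <= b -> bmp b u -> bmp b g ->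
  integrableC `[0, b]%classic (fun x => (rhs lam g u x).1) /\
  integrableC `[0, b]%classic (fun x => (rhs lam g u x).2).
Proof.
move=> b0 [u1 u2] [g1 g2].
have mI := measurable_itv `[0, b].
have qc := cint b0 qi.
have a1 := integrableCZ (-1) mI (integrableC_bmul mI u1 qc).
have a2 := integrableC_bmul mI u2 (integrableCD mI (cint b0 (locintB m p2i)) (cst_int b lam)).
have a3 := integrableC_bmul mI u1 (integrableCB mI (cint b0 (locintD m p1i)) (cst_int b lam)).
have a4 := integrableC_bmul mI u2 qc.
split.
  apply: (eq_integrableC mI _ (integrableCD mI (integrableCD mI a1 a2) (bm_integrable g2))).
  by move=> x _ /=; ring.
apply: (eq_integrableC mI _ (integrableCB mI (integrableCD mI a3 a4) (bm_integrable g1))).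
by move=> x _ /=; ring.
Qed.

Lemma rhs_lip lam g u v t : d2 (rhs lam g u t) (rhs lam g v t) <= d2 (u t) (v t) * wt lam t.
Proof.
rewrite /d2 /=.
set x := (u t).1 - (v t).1; set y := (u t).2 - (v t).2.
have -> : - (q t)%:C * (u t).1 + ((m - p2 t)%:C + lam) * (u t).2 + (g t).2 -
   (- (q t)%:C * (v t).1 + ((m - p2 t)%:C + lam) * (v t).2 + (g t).2) =
   - (q t)%:C * x + ((m - p2 t)%:C + lam) * y by rewrite /x /y; ring.
have -> : ((m + p1 t)%:C - lam) * (u t).1 + (q t)%:C * (u t).2 - (g t).1 -
   (((m + p1 t)%:C - lam) * (v t).1 + (q t)%:C * (v t).2 - (g t).1) =
   ((m + p1 t)%:C - lam) * x + (q t)%:C * y by rewrite /x /y; ring.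
have h1 := n1D (- (q t)%:C * x) (((m - p2 t)%:C + lam) * y).
have h2 := n1D (((m + p1 t)%:C - lam) * x) ((q t)%:C * y).
have h3 := n1M (- (q t)%:C) x; have h4 := n1M (q t)%:C y.
have h5 := n1M ((m - p2 t)%:C + lam) y; have h6 := n1M ((m + p1 t)%:C - lam) x.
rewrite n1N n1_real in h3; rewrite n1_real in h4.
have h7 : n1 ((m - p2 t)%:C + lam) <= `|m| + `|p2 t| + n1 lam.
  by apply: (le_trans (n1D _ _)); rewrite n1_real lerD2r ler_normB.
have h8 : n1 ((m + p1 t)%:C - lam) <= `|m| + `|p1 t| + n1 lam.
  by apply: (le_trans (n1B _ _)); rewrite n1_real lerD2r ler_normD.
have x0 := n1_ge0 x; have y0 := n1_ge0 y.
have h9 := ler_wpM2r y0 h7; have h10 := ler_wpM2r x0 h8.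
have k1 := mulr_ge0 (normr_ge0 (p1 t)) y0; have k2 := mulr_ge0 (normr_ge0 (p2 t)) x0.
rewrite /wt; move: h1 h2 h3 h4 h5 h6 h9 h10 k1 k2; lra.
Qed.

Lemma d2w_int lam b u v : 0 <= b -> bmp b u -> bmp b v ->
  mu.-integrable `[0, b] (EFin \o (fun t => d2 (u t) (v t) * wt lam t)).
Proof.
move=> b0 ub vb; have [M M0 hM] := bmp_bounded ub; have [N N0 hN] := bmp_bounded vb.
have [u1 u2] := ub; have [v1 v2] := vb.
apply: (@integrable_bmul _ _ _ _ (M + N)) => //; last exact: wt_int.
  by apply: measurable_funD; apply: mfun_n1; exact: bmB.
move=> x; rewrite /= in_itv/= => xb; rewrite ger0_norm ?d2_ge0//.
apply: (le_trans (d2_tri _ 0 _)); rewrite d20 d2_sym d20 lerD//; [exact: hM|exact: hN].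
Qed.

Lemma dsol_lbm lam g u : dsol lam g u -> lbm u.
Proof. by move=> [h1 h2] b b0; split; [exact: AC_bm h1|exact: AC_bm h2]. Qed.

Lemma int_d2 b (f1 f2 g1 g2 : R -> C) (h : R -> R) : 0 <= b ->
  integrableC `[0, b]%classic f1 -> integrableC `[0, b]%classic f2 ->
  integrableC `[0, b]%classic g1 -> integrableC `[0, b]%classic g2 ->
  mu.-integrable `[0, b] (EFin \o h) ->
  (forall t, n1 (f1 t - g1 t) + n1 (f2 t - g2 t) <= h t) ->
  n1 (integralC `[0, b]%classic f1 - integralC `[0, b]%classic g1) +
  n1 (integralC `[0, b]%classic f2 - integralC `[0, b]%classic g2)
    <= \int[mu]_(t in `[0, b]) h t.
Proof.
move=> b0 i1 i2 j1 j2 hi hh; have mI := measurable_itv `[0, b].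
have k1 := integrableCB mI i1 j1; have k2 := integrableCB mI i2 j2.
rewrite -!integralCB//.
apply: (le_trans (lerD (n1_integralC mI k1) (n1_integralC mI k2))).
have l1 := integrable_n1 mI k1; have l2 := integrable_n1 mI k2.
rewrite -RintegralD//; apply: le_Rintegral => //.
exact: integrable_add.
Qed.

Lemma dsol_unique lam g u v : dsol lam g u -> dsol lam g v -> u 0 = v 0 ->
  forall x, 0 <= x -> u x = v x.
Proof.
move=> hu hv uv x x0; apply: d2_eq0.
have ub := dsol_lbm hu; have vb := dsol_lbm hv.
have [M M0 hM] := bmp_bounded (ub x x0); have [N N0 hN] := bmp_bounded (vb x x0).
rewrite le_eqVlt; apply/orP; left; apply/eqP.
apply: (@gronwall0 R (wt lam) (wt_ge0 lam) (@wt_int lam) (fun t => d2 (u t) (v t)) (M + N) x)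
  => //; last by rewrite x0 lexx.
- by rewrite addr_ge0.
- exact: (d2w_int lam x0 (ub x x0) (vb x x0)).
- move=> y yx; rewrite d2_ge0; apply: (le_trans (d2_tri _ 0 _)).
  by rewrite d20 d2_sym d20 lerD//; [exact: hM|exact: hN].
move=> y /andP[y0 yx]; rewrite {1}/d2.
have [i1 ->] := hu.1 y y0; have [i2 ->] := hu.2 y y0.
have [j1 ->] := hv.1 y y0; have [j2 ->] := hv.2 y y0.
have aux (k I J : C) : k + I - (k + J) = I - J by ring.
rewrite uv !aux.
apply: int_d2 => //; first by apply: d2w_int => //; [exact: ub|exact: vb].
by move=> t; exact: rhs_lip.
Qed.

Lemma seqC_limit (f : nat -> R -> C) (B : nat -> R) b :
  (forall n, bm `[0, b]%classic (f n)) ->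
  (forall n x, 0 <= x <= b -> n1 (f n.+1 x - f n x) <= B n) ->
  cvgn (series B) ->
  let F x : C := limn (fun n => Re (f n x)) +i* limn (fun n => Im (f n x)) in
  bm `[0, b]%classic F /\
  forall n x, 0 <= x <= b -> n1 (F x - f n x) <= 2 * (limn (series B) - series B n).
Proof.
move=> fb fB cB F.
have hR x : 0 <= x <= b -> (fun n => Re (f n x)) @ \oo --> limn (fun n => Re (f n x)) /\
    forall n, `|limn (fun n => Re (f n x)) - Re (f n x)| <= limn (series B) - series B n.
  move=> xb; apply: (@seq_limit R (fun n => Re (f n x)) B) => // n.
  by rewrite -ReN -ReD (le_trans (Re_le_n1 _))// fB.
have hI x : 0 <= x <= b -> (fun n => Im (f n x)) @ \oo --> limn (fun n => Im (f n x)) /\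
    forall n, `|limn (fun n => Im (f n x)) - Im (f n x)| <= limn (series B) - series B n.
  move=> xb; apply: (@seq_limit R (fun n => Im (f n x)) B) => // n.
  by rewrite -ImN -ImD (le_trans (Im_le_n1 _))// fB.
have bnd n x : 0 <= x <= b -> n1 (F x - f n x) <= 2 * (limn (series B) - series B n).
  move=> xb; have [_ h1] := hR x xb; have [_ h2] := hI x xb.
  by rewrite /n1 !ReImE /=; have := h1 n; have := h2 n; lra.
split=> //; split.
- apply: (@measurable_fun_cvg _ _ _ _ (fun n x => Re (f n x))) => //.
    by move=> n; case: (fb n).
  by move=> x; rewrite /= in_itv/= => xb; exact: (hR x xb).1.
- apply: (@measurable_fun_cvg _ _ _ _ (fun n x => Im (f n x))) => //.
    by move=> n; case: (fb n).
  by move=> x; rewrite /= in_itv/= => xb; exact: (hI x xb).1.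
have [_ _ [M hM]] := fb 0%N.
exists (2 * (limn (series B) - series B 0%N) + M) => x xI.
have xb : 0 <= x <= b by move: xI; rewrite /= in_itv.
rewrite -(subrK (f 0%N x) (F x)); apply: (le_trans (n1D _ _)).
by rewrite lerD ?bnd ?hM.
Qed.

(** Picard iteration from zero. The bound is kept because holomorphy in [lam] depends on it; its
    factor 4 arises because real and imaginary parts of both components pass to the limit
    separately. *)
Theorem dsol_exists lam (c : C * C) g : lbm g ->
  exists u, [/\ dsol lam g u, u 0 = c &
    forall b Gb, 0 <= b -> (forall x, 0 <= x <= b -> n2 (g x) <= Gb) ->
    forall x, 0 <= x <= b ->
    n2 (u x) <= 4 * ((n2 c + b * Gb) * expR (\int[mu]_(t in `[0, b]) wt lam t))].
Proof.
move=> gb.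
pose T u (x : R) : C * C :=
  (c.1 + integralC `[0, x]%classic (fun t => (rhs lam g u t).1),
   c.2 + integralC `[0, x]%classic (fun t => (rhs lam g u t).2)).
have rint u b : lbm u -> 0 <= b ->
    integrableC `[0, b]%classic (fun x => (rhs lam g u x).1) /\
    integrableC `[0, b]%classic (fun x => (rhs lam g u x).2).
  by move=> ub b0; apply: rhs_int => //; [exact: ub|exact: gb].
have TAC u : lbm u -> AC_deriv (fun x => (T u x).1) (fun x => (rhs lam g u x).1) /\
    AC_deriv (fun x => (T u x).2) (fun x => (rhs lam g u x).2).
  by move=> ub; split; apply: AC_prim => b b0; [exact: (rint u b ub b0).1|
    exact: (rint u b ub b0).2].
have Tb u : lbm u -> lbm (T u).
  by move=> ub b b0; have [h1 h2] := TAC u ub; split; [exact: AC_bm h1|exact: AC_bm h2].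
pose un n := iter n T (fun=> 0).
have unb n : lbm (un n).
  elim: n => [|n IH]; last exact: Tb.
  by move=> b b0; split; exact: bm_cst.
have Tlip u v x : lbm u -> lbm v -> 0 <= x ->
    d2 (T u x) (T v x) <= \int[mu]_(t in `[0, x]) (d2 (u t) (v t) * wt lam t).
  have aux (k I J : C) : k + I - (k + J) = I - J by ring.
  move=> ub vb x0; rewrite /d2 /= !aux.
  have [i1 i2] := rint u x ub x0; have [j1 j2] := rint v x vb x0.
  apply: int_d2 => //; first by apply: d2w_int => //; [exact: ub|exact: vb].
  by move=> t; exact: rhs_lip.
pose W x := \int[mu]_(t in `[0, x]) wt lam t.
have main b Gb : 0 <= b -> (forall x, 0 <= x <= b -> n2 (g x) <= Gb) ->
    let B n := (n2 c + b * Gb) * exp_coeff (W b) n in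
    cvgn (series B) /\ forall n x, 0 <= x <= b -> d2 (un n.+1 x) (un n x) <= B n.
  move=> b0 hG B.
  have Gb0 : 0 <= Gb by apply: le_trans (hG 0 _); rewrite ?n2_ge0// lexx.
  have K0 : 0 <= n2 c + b * Gb by rewrite addr_ge0 ?n2_ge0 ?mulr_ge0.
  split.
    have -> : series B = (fun n => (n2 c + b * Gb) * series (exp_coeff (W b)) n).
      by apply/funext => n; rewrite /series /= -mulr_sumr.
    apply: is_cvgM; first exact: is_cvg_cst.
    exact: is_cvg_series_exp_coeff.
  move=> n x xb; have /andP[x0 xb'] := xb.
  have h := @gronwall_iter R (wt lam) (wt_ge0 lam) (@wt_int lam)
    (fun n t => d2 (un n.+1 t) (un n t)) (n2 c + b * Gb) b b0.
  apply: (@le_trans _ _ ((n2 c + b * Gb) * exp_coeff (W x) n)).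
    apply: h => //.
    - by move=> k; apply: d2w_int => //; exact: unb.
    (* The iteration starts from zero, so the first iterate is the datum plus the integrated source;
       hence the constant [n2 c + b * Gb]. *)
    - move=> y /andP[y0 yb]; rewrite d20 /n2 /=.
      have bi : integrableC `[0, y]%classic (fun t => (g t).1) by apply: bm_integrable; case: (gb y y0).
      have ci : integrableC `[0, y]%classic (fun t => (g t).2) by apply: bm_integrable; case: (gb y y0).
      rewrite (@eq_integralC _ _ _ (fun t => (g t).2)); last by move=> t _ /=; ring.
      rewrite (@eq_integralC _ _ (fun t => (rhs lam g (fun=> 0) t).2) (fun t => (-1) * (g t).1));
        last by move=> t _ /=; ring.
      rewrite integralCZ// mulN1r.
      have := n1D c.1 (integralC `[0, y]%classic (fun t => (g t).2)).
      have := n1B c.2 (integralC `[0, y]%classic (fun t => (g t).1)).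
      have := n1_integralC (measurable_itv _) bi; have := n1_integralC (measurable_itv _) ci.
      have : \int[mu]_(t in `[0, y]) n1 (g t).1 + \int[mu]_(t in `[0, y]) n1 (g t).2 <= b * Gb.
        have l1 := integrable_n1 (measurable_itv _) bi.
        have l2 := integrable_n1 (measurable_itv _) ci.
        rewrite -RintegralD//; apply: (@le_trans _ _ (\int[mu]_(t in `[0, y]) Gb)).
          apply: le_Rintegral => //; first exact: integrable_add.
            exact: integrable_cst.
          move=> t /=; rewrite in_itv/= => /andP[t0 ty].
          by apply: hG; rewrite t0 (le_trans ty).
        by rewrite Rintegral_cst_itv// subr0 mulrC ler_wpM2r.
      by rewrite /n2; lra.
    - by move=> k y /andP[y0 yb]; exact: (Tlip _ _ _ (unb k.+1) (unb k) y0).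
  rewrite /B ler_wpM2l// /exp_coeff /= ler_wpM2r ?invr_ge0//.
  by rewrite lerXn2r ?nnegrE ?W_ge0//; [exact: wt_ge0|exact: wt_ge0|
    exact: (@W_mono _ (wt lam) (wt_ge0 lam) (@wt_int lam))].
pose L (f : nat -> R -> C) x : C := limn (fun n => Re (f n x)) +i* limn (fun n => Im (f n x)).
pose f1 n x := (un n x).1; pose f2 n x := (un n x).2.
pose u x := (L f1 x, L f2 x).
have lim b Gb : 0 <= b -> (forall x, 0 <= x <= b -> n2 (g x) <= Gb) ->
    let B n := (n2 c + b * Gb) * exp_coeff (W b) n in
    bmp b u /\ forall n x, 0 <= x <= b ->
      d2 (u x) (un n x) <= 4 * (limn (series B) - series B n).
  move=> b0 hG B; have [cB hB] := main b Gb b0 hG.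
  have [k1 l1] : bm `[0, b]%classic (L f1) /\ forall n x, 0 <= x <= b ->
      n1 (L f1 x - f1 n x) <= 2 * (limn (series B) - series B n).
    apply: seqC_limit => //; first by move=> n; case: (unb n b b0).
    by move=> n x xb; apply: le_trans (hB n x xb); rewrite lerDl n1_ge0.
  have [k2 l2] : bm `[0, b]%classic (L f2) /\ forall n x, 0 <= x <= b ->
      n1 (L f2 x - f2 n x) <= 2 * (limn (series B) - series B n).
    apply: seqC_limit => //; first by move=> n; case: (unb n b b0).
    by move=> n x xb; apply: le_trans (hB n x xb); rewrite lerDr n1_ge0.
  split=> // n x xb; rewrite /d2 /=.
  by have := l1 n x xb; have := l2 n x xb; rewrite /f1 /f2; lra.
have ub : lbm u.
  move=> b b0; have [Gb _ hG] := bmp_bounded (gb b b0).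
  by have [] := lim b Gb b0 hG.
have fixp x : 0 <= x -> u x = T u x.
  move=> x0; apply: d2_eq0.
  have [Gb _ hG] := bmp_bounded (gb x x0).
  have [_ hl] := lim x Gb x0 hG; have [cB _] := main x Gb x0 hG.
  set S := series _ in hl cB.
  have h n : d2 (u x) (T u x) <= 4 * (limn S - S n.+1) + 4 * (limn S - S n) * W x.
    apply: (le_trans (d2_tri _ (un n.+1 x) _)); rewrite lerD//.
      by apply: hl; rewrite x0 lexx.
    apply: (le_trans (Tlip _ _ _ (unb n) ub x0)).
    rewrite -RintegralZl//; last exact: wt_int.
    apply: le_Rintegral => //.
    - by apply: d2w_int => //; [exact: unb|exact: ub].
    - by apply: integrable_scale => //; exact: wt_int.
    move=> t /=; rewrite in_itv/= => tx; rewrite ler_wpM2r ?wt_ge0//.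
    by rewrite d2_sym hl.
  have c1 : (fun n => 4 * (limn S - S n.+1) + 4 * (limn S - S n) * W x) @ \oo -->
      4 * (limn S - limn S) + 4 * (limn S - limn S) * W x.
    apply: cvgD; [|apply: cvgM; last exact: cvg_cst]; (apply: cvgM; first exact: cvg_cst);
      (apply: cvgB; first exact: cvg_cst) => //.
    by rewrite (cvg_shiftS S).
  rewrite subrr mulr0 mul0r addr0 in c1.
  rewrite -(cvg_lim (@Rhausdorff R) c1); apply: limr_ge; first by apply/cvg_ex; exists 0.
  by near=> n; exact: h.
exists u; split.
- have [h1 h2] := TAC u ub; split.
    by apply: eq_AC h1 => // x x0; rewrite (fixp x x0).
  by apply: eq_AC h2 => // x x0; rewrite (fixp x x0).
- rewrite fixp// /T set_itv1 (surjective_pairing c).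
  by congr pair; rewrite -[RHS]addr0; congr (_ + _); apply: CP; rewrite /= Rintegral_set1.
move=> b Gb b0 hG x xb; have [_ h] := lim b Gb b0 hG; have := h 0%N x xb.
rewrite d20 {2}/series /= big_geq// subr0.
set B := fun n => _.
have -> : series B = (fun n => (n2 c + b * Gb) * series (exp_coeff (W b)) n).
  by apply/funext => n; rewrite /series /= -mulr_sumr.
have cE : (fun n => (n2 c + b * Gb) * series (exp_coeff (W b)) n) @ \oo -->
    (n2 c + b * Gb) * expR (W b).
  by apply: cvgM; [exact: cvg_cst|exact: is_cvg_series_exp_coeff].
by rewrite (cvg_lim (@Rhausdorff R) cE).
Unshelve. all: by end_near.
Qed.

End DiracODE.

(** * Lagrange's identity and holomorphic dependence on the spectral parameter *)

Section Sol.
Context {R : realType}.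
Local Notation C := (Cplx R).
Local Notation mu := (@lebesgue_measure R).
Implicit Types (u v g h k : R -> C * C) (lam nu : C) (b : R).
Variables (m : R) (p1 p2 q : R -> R).
Hypotheses (p1i : locint p1) (p2i : locint p2) (qi : locint q).
Local Notation dsol := (dsol m p1 p2 q).
Local Notation Wt := (wt m p1 p2 q).

Lemma lbm_comb (a1 a2 : C) g h : lbm g -> lbm h ->
  lbm (fun t => (a1 * (g t).1 + a2 * (h t).1, a1 * (g t).2 + a2 * (h t).2)).
Proof.
move=> hg hh b b0; have [g1 g2] := hg b b0; have [h1 h2] := hh b b0.
by split; apply: bmD; apply: bmM => //; exact: bm_cst.
Qed.

Lemma dsol_comb (a1 a2 : C) lam g h u v : dsol lam g u -> dsol lam h v ->
  dsol lam (fun t => (a1 * (g t).1 + a2 * (h t).1, a1 * (g t).2 + a2 * (h t).2))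
    (fun t => (a1 * (u t).1 + a2 * (v t).1, a1 * (u t).2 + a2 * (v t).2)).
Proof.
move=> [u1 u2] [v1 v2]; split.
  by apply: eq_AC (AC_add (AC_scale a1 u1) (AC_scale a2 v1)) => // x _ /=; ring.
by apply: eq_AC (AC_add (AC_scale a1 u2) (AC_scale a2 v2)) => // x _ /=; ring.
Qed.

Lemma eq_dsol lam g h u v : (forall x, 0 <= x -> g x = h x) ->
  (forall x, 0 <= x -> u x = v x) -> dsol lam g u -> dsol lam h v.
Proof.
move=> gh uv [h1 h2]; split.
  by apply: eq_AC h1 => x x0; rewrite /rhs ?uv ?gh.
by apply: eq_AC h2 => x x0; rewrite /rhs ?uv ?gh.
Qed.

(** A change of spectral parameter is moved into the source, so that solutions for different
    parameters can be subtracted by [dsol_comb]. *)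
Lemma dsol_shift lam nu g u : dsol nu g u ->
  dsol lam (fun t => (1 * (g t).1 + (nu - lam) * (u t).1,
    1 * (g t).2 + (nu - lam) * (u t).2)) u.
Proof.
move=> [h1 h2]; split.
  by apply: eq_AC h1 => // x _ /=; ring.
by apply: eq_AC h2 => // x _ /=; ring.
Qed.

Definition wron u v (x : R) : C := (u x).1 * (v x).2 - (u x).2 * (v x).1.
Definition dotp u v (x : R) : C := (u x).1 * (v x).1 + (u x).2 * (v x).2.

(** The potential terms cancel because [V] is symmetric. The pairing [dotp] is bilinear; inserting
    [cc] gives the Hermitian form of the identity. *)
Lemma lagrange lam nu g h u v : dsol lam g u -> dsol nu h v ->
  AC_deriv (wron u v) (fun t => (lam - nu) * dotp u v t + dotp g v t - dotp u h t).
Proof.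
move=> [u1 u2] [v1 v2].
apply: eq_AC (AC_sub (AC_mul u1 v2) (AC_mul u2 v1)) => // x _.
rewrite /dotp /= !rmorphD !rmorphN /=; ring.
Qed.

Lemma dotp_bm b u v : bmp b u -> bmp b v -> bm `[0, b]%classic (dotp u v).
Proof. by move=> [u1 u2] [v1 v2]; apply: bmD; exact: bmM. Qed.

Lemma dotp_int b u v : bmp b u -> bmp b v -> integrableC `[0, b]%classic (dotp u v).
Proof. by move=> hu hv; apply: bm_integrable; exact: dotp_bm. Qed.

Definition cc u (x : R) : C * C := (cj (u x).1, cj (u x).2).

Lemma lbm_cc u : lbm u -> lbm (cc u).
Proof. by move=> h b b0; have [h1 h2] := h b b0; split; exact: bm_conj. Qed.

Lemma dsol_cc lam g u : dsol lam g u -> dsol (cj lam) (cc g) (cc u).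
Proof.
move=> [h1 h2]; split.
  by apply: eq_AC (AC_conj h1) => // x _; rewrite /= !(cjD, cjM, cjN, cjR).
by apply: eq_AC (AC_conj h2) => // x _; rewrite /= !(cjD, cjM, cjN, cjR).
Qed.

Lemma dsol_zero_bound lam g u b (G : R) : lbm g -> dsol lam g u -> u 0 = 0 ->
  0 <= b -> (forall x, 0 <= x <= b -> n2 (g x) <= G) ->
  forall x, 0 <= x <= b ->
  n2 (u x) <= 4 * (b * G * expR (\int[mu]_(t in `[0, b]) Wt lam t)).
Proof.
move=> gb hu u0 b0 hG x xb.
have [v [hv v0 hb]] := @dsol_exists R m p1 p2 q p1i p2i qi lam 0 g gb.
have /andP[x0 _] := xb.
rewrite (@dsol_unique R m p1 p2 q p1i p2i qi lam g u v hu hv) ?u0//.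
by have := hb b G b0 hG x xb; rewrite /n2 /= n1_0 !add0r.
Qed.

Definition sol lam (c : C * C) g : R -> C * C :=
  xget (fun=> 0) [set u | dsol lam g u /\ u 0 = c].

Lemma solP lam c g : lbm g -> dsol lam g (sol lam c g) /\ sol lam c g 0 = c.
Proof.
move=> gb; have [u [h1 h2 _]] := @dsol_exists R m p1 p2 q p1i p2i qi lam c g gb.
exact: (@xgetPex _ (fun=> 0) [set u | dsol lam g u /\ u 0 = c]
  (ex_intro _ u (conj h1 h2))).
Qed.

Lemma sol_lbm lam c g : lbm g -> lbm (sol lam c g).
Proof. by move=> /(solP lam c)[h _]; exact: dsol_lbm h. Qed.

Lemma sol_bound lam c g b (G : R) : lbm g -> 0 <= b ->
  (forall x, 0 <= x <= b -> n2 (g x) <= G) ->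
  forall x, 0 <= x <= b -> n2 (sol lam c g x) <=
    4 * ((n2 c + b * G) * expR (\int[mu]_(t in `[0, b]) Wt lam t)).
Proof.
move=> gb b0 hG x xb; have [h1 h2] := solP lam c gb.
have [v [hv v0 hb]] := @dsol_exists R m p1 p2 q p1i p2i qi lam c g gb.
have /andP[x0 _] := xb.
rewrite (@dsol_unique R m p1 p2 q p1i p2i qi lam g _ v h1 hv) ?h2//.
exact: hb.
Qed.

(** This makes the exponential bounds uniform for [nu] within distance 1 of [lam], at the price of a
    factor [expR b]. *)
Lemma wt_shift lam nu b : 0 <= b -> n1 (nu - lam) <= 1 ->
  \int[mu]_(t in `[0, b]) Wt nu t <= \int[mu]_(t in `[0, b]) Wt lam t + b.
Proof.
move=> b0 d1.
have -> : \int[mu]_(t in `[0, b]) Wt lam t + b =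
    \int[mu]_(t in `[0, b]) (Wt lam t + 1).
  rewrite RintegralD//; [|exact: wt_int|exact: integrable_cst].
  by rewrite Rintegral_cst_itv// mul1r subr0.
apply: le_Rintegral => //.
- exact: wt_int.
- by apply: integrable_add => //; [exact: wt_int|exact: integrable_cst].
move=> t _; rewrite /wt.
by have := n1D (nu - lam) lam; rewrite subrK; move: d1; lra.
Qed.

(** The derivative in the parameter is the solution [v] with source [u] and zero data. The increment
    [e] has source [dl u'], and [e - dl v] has source [dl e]; bounding twice with [dsol_zero_bound]
    gives one factor [dl] each time. *)
Lemma sol_quad lam c g b : lbm g -> 0 <= b ->
  let v := sol lam 0 (sol lam c g) in
  exists2 K : R, 0 <= K & forall nu, n1 (nu - lam) < 1 -> forall x, 0 <= x <= b ->
    n1 ((sol nu c g x).1 - (sol lam c g x).1 - (nu - lam) * (v x).1) +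
    n1 ((sol nu c g x).2 - (sol lam c g x).2 - (nu - lam) * (v x).2) <=
      K * n1 (nu - lam) ^+ 2.
Proof.
move=> gb b0 v; have [G G0 hG] := bmp_bounded (gb b b0).
pose W := \int[mu]_(t in `[0, b]) Wt lam t.
pose M := 4 * ((n2 c + b * G) * expR (W + b)).
have M0 : 0 <= M by rewrite !mulr_ge0 ?expR_ge0 ?addr_ge0 ?n2_ge0 ?mulr_ge0.
pose A := 4 * (b * M * expR W).
have nn (x y z : R) : 0 <= x -> 0 <= y -> 0 <= z -> 0 <= 4 * (x * y * z).
  by move=> *; rewrite !mulr_ge0.
have A0 : 0 <= A by apply: nn => //; exact: expR_ge0.
exists (4 * (b * A * expR W)); first by apply: nn => //; exact: expR_ge0.
move=> nu d1 x xb; set dl := nu - lam.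
have [hu u0] := solP lam c gb; have [hu' u'0] := solP nu c gb.
have ub := sol_lbm lam c gb; have ub' := sol_lbm nu c gb.
have [hv v0] := solP lam 0 ub.
set u := sol lam c g in hu u0 ub hv v0 v *; set u' := sol nu c g in hu' u'0 ub' *.
have u'M y : 0 <= y <= b -> n2 (u' y) <= M.
  move=> yb; apply: (le_trans (sol_bound nu c gb b0 hG yb)).
  rewrite /M ler_pM2l// ler_wpM2l ?addr_ge0 ?n2_ge0 ?mulr_ge0//.
  by rewrite ler_expR; apply: wt_shift => //; exact: ltW.
pose e t : C * C := (1 * (u' t).1 + -1 * (u t).1, 1 * (u' t).2 + -1 * (u t).2).
(* The zero summand only puts the source in the shape of [lbm_comb]. *)
pose s1 t : C * C := (dl * (u' t).1 + 0 * (u' t).1, dl * (u' t).2 + 0 * (u' t).2).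
have s1b : lbm s1 by exact: lbm_comb.
have he : dsol lam s1 e.
  have := dsol_comb 1 (-1) (dsol_shift lam hu') hu.
  apply: eq_dsol => // t _; rewrite /s1 /dl.
  by move: (u t) (u' t) (g t) => a1 a2 a3 /=; congr pair; ring.
have e0 : e 0 = 0 by rewrite /e u0 u'0 !mul1r !mulN1r !subrr.
have n2Z (a : C) (z : C * C) : n2 (a * z.1, a * z.2) <= n1 a * n2 z.
  by rewrite /n2 /= mulrDr lerD// n1M.
have s1M y : 0 <= y <= b -> n2 (s1 y) <= n1 dl * M.
  move=> yb; rewrite /s1 !mul0r !addr0; apply: (le_trans (n2Z _ _)).
  by rewrite ler_wpM2l ?n1_ge0 ?u'M.
have eM y : 0 <= y <= b -> n2 (e y) <= n1 dl * A.
  move=> yb; apply: (le_trans (dsol_zero_bound s1b he e0 b0 s1M yb)).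
  by rewrite le_eqVlt; apply/orP; left; apply/eqP; rewrite /A /W; ring.
pose s2 t : C * C := (dl * (e t).1 + 0 * (e t).1, dl * (e t).2 + 0 * (e t).2).
have eb : lbm e by exact: lbm_comb.
have s2b : lbm s2 by exact: lbm_comb.
pose r t : C * C := (1 * (e t).1 + - dl * (v t).1, 1 * (e t).2 + - dl * (v t).2).
have hr : dsol lam s2 r.
  have := dsol_comb 1 (- dl) he hv.
  apply: eq_dsol => // t _; rewrite /s2 /s1 /e.
  by move: (u t) (u' t) (v t) => a1 a2 a3 /=; congr pair; ring.
have r0 : r 0 = 0.
  by rewrite /r e0 [v 0]v0 /= !mulr0 !addr0.
have s2M y : 0 <= y <= b -> n2 (s2 y) <= n1 dl * (n1 dl * A).
  move=> yb; rewrite /s2 !mul0r !addr0; apply: (le_trans (n2Z _ _)).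
  by rewrite ler_wpM2l ?n1_ge0 ?eM.
have := dsol_zero_bound s2b hr r0 b0 s2M xb.
rewrite /n2 /r /e /= !mul1r !mulN1r !mulNr => h; apply: (le_trans h).
by rewrite le_eqVlt; apply/orP; left; apply/eqP; rewrite /W; ring.
Qed.

Lemma sol_derivable1 c g x lam : lbm g -> 0 <= x ->
  derivable (fun nu => (sol nu c g x).1) lam 1.
Proof.
move=> gb x0; have [K K0 h] := sol_quad lam c gb x0.
apply: (@derivable_quad _ _ _ (sol lam 0 (sol lam c g) x).1 K 1) => // nu nl.
have := h nu nl x; rewrite x0 lexx => /(_ isT).
by apply: le_trans; rewrite [in leLHS]mulrC lerDl n1_ge0.
Qed.

Lemma sol_derivable2 c g x lam : lbm g -> 0 <= x ->
  derivable (fun nu => (sol nu c g x).2) lam 1.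
Proof.
move=> gb x0; have [K K0 h] := sol_quad lam c gb x0.
apply: (@derivable_quad _ _ _ (sol lam 0 (sol lam c g) x).2 K 1) => // nu nl.
have := h nu nl x; rewrite x0 lexx => /(_ isT).
by apply: le_trans; rewrite [in leLHS]mulrC lerDr n1_ge0.
Qed.

(** The remainder in [sol_quad] is uniform in [x], so it may be integrated against a bounded [k]. *)
Lemma sol_derivable_int c g k b lam : lbm g -> 0 <= b -> bmp b k ->
  derivable (fun nu => integralC `[0, b]%classic (dotp (sol nu c g) k)) lam 1.
Proof.
move=> gb b0 kb; have [K K0 h] := sol_quad lam c gb b0.
have [N N0 hN] := bmp_bounded kb.
pose v := sol lam 0 (sol lam c g).
have ub nu := sol_lbm nu c gb b0; have vb : bmp b v := sol_lbm lam 0 (sol_lbm lam c gb) b0.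
apply: (@derivable_quad _ _ _ (integralC `[0, b]%classic (dotp v k)) (K * N * b) 1) => //.
move=> nu nl; rewrite mulrC -integralCZ//; last exact: dotp_int.
have i1 := dotp_int (ub nu) kb; have i2 := dotp_int (ub lam) kb.
have i3 := integrableCZ (nu - lam) (measurable_itv `[0, b]) (dotp_int vb kb).
have mI := measurable_itv `[0, b]; have i4 := integrableCB mI i1 i2.
have i5 := integrableCB mI i4 i3.
rewrite -(integralCB mI i1 i2) -(integralCB mI i4 i3).
have -> : K * N * b * n1 (nu - lam) ^+ 2 = K * n1 (nu - lam) ^+ 2 * N * (b - 0).
  by rewrite subr0; ring.
apply: (integralC_bound b0 i5) => x xb; rewrite /dotp.
have alg (y1 y2 z1 z2 w1 w2 k1 k2 d : C) :
   y1 * k1 + y2 * k2 - (z1 * k1 + z2 * k2) - d * (w1 * k1 + w2 * k2) =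
   (y1 - z1 - d * w1) * k1 + (y2 - z2 - d * w2) * k2 by ring.
rewrite alg.
set a := (sol nu c g x).1 - (sol lam c g x).1 - (nu - lam) * (v x).1.
set d := (sol nu c g x).2 - (sol lam c g x).2 - (nu - lam) * (v x).2.
have hK := h nu nl x xb; rewrite -/a -/d in hK.
have hk := hN x xb.
have n_1 := n1_ge0 a; have n_2 := n1_ge0 d.
have n_3 := n1_ge0 (k x).1; have n_4 := n1_ge0 (k x).2.
apply: (@le_trans _ _ ((n1 a + n1 d) * n2 (k x))).
  apply: (le_trans (n1D _ _)); have := n1M a (k x).1; have := n1M d (k x).2.
  have := mulr_ge0 n_1 n_4; have := mulr_ge0 n_2 n_3.
  by rewrite /n2; lra.
by rewrite ler_pM ?addr_ge0 ?n2_ge0.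
Qed.

End Sol.

(** * Square-integrable solutions *)

Section SquareIntegrable.
Context {R : realType}.
Local Notation C := (Cplx R).
Local Notation mu := (@lebesgue_measure R).
Local Notation mfun A g := (measurable_fun (A : set (measurableTypeR R)) g).
Implicit Types (f : R -> R).

Let H : set (measurableTypeR R) := @halfline R.

Lemma halfline_meas : measurable H.
Proof. exact: measurable_itv. Qed.

Lemma L2realP f : L2real f <->
  mfun H f /\ (\int[mu]_(x in H) ((f x) ^+ 2)%:E < +oo)%E.
Proof.
have sq x : ((f \_ H) x) ^+ 2 = ((fun x => f x ^+ 2) \_ H) x.
  by rewrite /patch; case: ifPn => // _; rewrite expr0n.
have iE : (\int[mu]_(x in H) ((f x) ^+ 2)%:E = \int[mu]_x (((f \_ H) x) ^+ 2)%:E)%E.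
  rewrite integral_mkcond; apply: eq_integral => x _; rewrite sq.
  by rewrite /patch; case: ifPn.
rewrite /L2real -/H; split.
  move=> h; have hm : mfun setT (f \_ H).
    by move: h; rewrite inE => /andP[+ _]; rewrite inE.
  split; first by apply/(measurable_restrictT f halfline_meas).
  have /integrableP[_] := Lfun2_integrable_sqr h.
  rewrite iE; apply: le_lt_trans; rewrite le_eqVlt; apply/orP; left; apply/eqP.
  by apply: eq_integral => x _ /=; rewrite ger0_norm// sqr_ge0.
move=> [mf fi]; have hm : mfun setT (f \_ H).
  exact/(measurable_restrictT f halfline_meas).
rewrite inE; apply/andP; split; rewrite inE//=.
rewrite /finite_norm unlock; apply: poweR_lty.
move: fi; rewrite iE; apply: le_lt_trans; rewrite le_eqVlt; apply/orP; left; apply/eqP.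
apply: eq_integral => x _ /=.
by rewrite powR_mulrn// real_normK// num_real.
Qed.

Lemma halflineE : H = \bigcup_n (`[0, n%:R]%classic : set R).
Proof.
apply/seteqP; split=> x; rewrite /H /halfline /= in_itv/= ?andbT.
  move=> x0; exists (Num.bound x) => //=; rewrite in_itv/= x0.
  by rewrite ltW// archi_boundP.
by move=> [n _] /=; rewrite in_itv/= => /andP[].
Qed.

Lemma sub_halfline b : `[0, b]%classic `<=` H.
Proof. by move=> x; rewrite /H /halfline /= !in_itv/= => /andP[->]. Qed.

Lemma L2real_sqr_int f : L2real f -> exists2 B : R, 0 <= B &
  forall b : R, 0 <= b -> mu.-integrable `[0, b] (EFin \o (fun x => f x ^+ 2)) /\
    \int[mu]_(x in `[0, b]) (f x ^+ 2) <= B.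
Proof.
move=> /L2realP[mf fi].
have iH : mu.-integrable H (EFin \o (fun x => f x ^+ 2)).
  apply/integrableP; split; first by apply/measurable_EFinP; exact: measurable_funX.
  move: fi; apply: le_lt_trans; rewrite le_eqVlt; apply/orP; left; apply/eqP.
  by apply: eq_integral => x _ /=; rewrite ger0_norm// sqr_ge0.
exists (\int[mu]_(x in H) (f x ^+ 2)); first by apply: Rintegral_ge0 => x _; exact: sqr_ge0.
move=> b b0.
have ib : mu.-integrable `[0, b] (EFin \o (fun x => f x ^+ 2)).
  by apply: (integrableS halfline_meas _ _ iH) => //; exact: sub_halfline.
split=> //; rewrite /Rintegral fine_le//.
- by apply: integrable_fin_num => //; exact: ib.
- by apply: integrable_fin_num; [exact: halfline_meas|exact: iH].
apply: ge0_subset_integral.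
- exact: measurable_itv.
- exact: halfline_meas.
- by apply/measurable_EFinP; exact: measurable_funX.
- by move=> x _; rewrite lee_fin sqr_ge0.
- exact: sub_halfline.
Qed.

Lemma L2real_mfun f b : L2real f -> mfun `[0, b]%classic f.
Proof.
move=> /L2realP[mf _].
apply: (measurable_funS _ _ mf); [exact: halfline_meas|exact: sub_halfline].
Qed.

Lemma L2real_locint f : L2real f -> locint f.
Proof.
move=> hf b b0; have [B _ hB] := L2real_sqr_int hf.
have [ib _] := hB b b0.
have gi : mu.-integrable `[0, b] (EFin \o (fun x => 1 + f x ^+ 2)).
  by apply: integrable_add => //; exact: integrable_cst.
apply: (le_integrable _ _ _ gi) => //.
  by apply/measurable_EFinP; exact: L2real_mfun.
move=> x _ /=; rewrite lee_fin.
rewrite [leRHS]ger0_norm ?addr_ge0 ?sqr_ge0//.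
rewrite -(real_normK (num_real (f x))).
have := sqr_ge0 (`|f x| - 1); have := normr_ge0 (f x); nra.
Qed.

(** Monotone convergence along the segments from 0 to [n]. *)
Lemma L2real_bounded f (B : R) : (forall b : R, 0 <= b -> mfun `[0, b]%classic f) ->
  (forall b : R, 0 <= b -> mu.-integrable `[0, b] (EFin \o (fun x => f x ^+ 2)) /\
    \int[mu]_(x in `[0, b]) (f x ^+ 2) <= B) -> L2real f.
Proof.
move=> mf fi; apply/L2realP.
have mH : mfun H f.
  rewrite halflineE; apply/measurable_fun_bigcup => // n; exact: mf.
split=> //.
rewrite halflineE.
have h1 : {homo (fun n => (`[0, n%:R]%classic : set (measurableTypeR R))) :
    n k / (n <= k)%N >-> (n <= k)%O}.
  move=> n k nk; rewrite subsetEset; apply: subset_itvl.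
  by rewrite bnd_simp ler_nat.
have h2 n : measurable (`[0, n%:R]%classic : set (measurableTypeR R)).
  exact: measurable_itv.
have h3 n : mfun `[0, n%:R]%classic (EFin \o (fun x => f x ^+ 2)).
  by apply/measurable_EFinP; apply: measurable_funX; exact: mf.
have h4 n x : (`[0, n%:R]%classic : set R) x -> (0%:E <= ((f x ^+ 2)%R)%:E)%E.
  by move=> _; rewrite lee_fin sqr_ge0.
have hc := ge0_nondecreasing_set_cvg_integral (mu := mu) h1 h2 h3 h4.
rewrite -(cvg_lim _ hc)//; apply: (@le_lt_trans _ _ B%:E); last exact: ltry.
apply: lime_le; first by apply/cvg_ex; eexists; exact: hc.
near=> n; have [i1 i2] := fi n%:R (ler0n _ n).
rewrite -[leLHS]fineK ?lee_fin//.
by apply: integrable_fin_num => //; exact: i1.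
Unshelve. all: by end_near.
Qed.

End SquareIntegrable.

(** * Square integrability of solutions and self-adjointness *)

Section Uniqueness.
Context {R : realType}.
Local Notation C := (Cplx R).
Local Notation mu := (@lebesgue_measure R).
Local Notation mfun A g := (measurable_fun (A : set (measurableTypeR R)) g).

Definition sqn (z : C) : R := Re z ^+ 2 + Im z ^+ 2.
Lemma sqn_ge0 z : 0 <= sqn z. Proof. by rewrite addr_ge0 ?sqr_ge0. Qed.
Lemma mul_cj z : z * cj z = (sqn z)%:C.
Proof. by apply: CP; rewrite !ReImE /= /sqn; ring. Qed.
Lemma sqn_eq0 z : sqn z <= 0 -> z = 0.
Proof.
move=> h; have h1 := sqr_ge0 (Re z); have h2 := sqr_ge0 (Im z).
apply: CP; apply/eqP; rewrite -sqrf_eq0; apply/eqP; move: h h1 h2; rewrite /sqn /=; lra.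
Qed.
Lemma sqnM z w : sqn (z * w) = sqn z * sqn w.
Proof. by rewrite /sqn !ReImE; ring. Qed.

Lemma sqn_bm b (f : R -> C) : 0 <= b -> bm `[0, b]%classic f ->
  mu.-integrable `[0, b] (EFin \o (fun x => sqn (f x))).
Proof.
move=> b0 hf; have [h _] := bm_integrable (bmM hf (bm_conj hf)).
by apply: eq_integrable h => // x _ /=; rewrite mul_cj.
Qed.

Lemma AC_pos (E e : R -> C) (a b : R) : AC_deriv E e -> 0 <= a -> a < b ->
  (forall x, a <= x <= b -> 0 <= Re (E x)) -> 0 < Re (E a) ->
  0 < \int[mu]_(x in `[a, b]) Re (E x).
Proof.
move=> hE a0 ab E0 Ea; have b0 := le_trans a0 (ltW ab).
have [c1 _] := AC_continuous b0 hE.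
have c2 := continuous_itv_le a0 (lexx b) c1.
have [_ /cvgrPdist_lt cR _] := (continuous_within_itvP (fun x => Re (E x)) ab).1 c2.
have e2 : 0 < Re (E a) / 2 by rewrite divr_gt0.
have := cR _ e2; rewrite /at_right /within /= => /nbhs_ballP[d /= d0 hd].
pose c := Num.min b (a + d / 2).
have ac : a < c by rewrite lt_min ab ltrDl divr_gt0.
have cb : c <= b by rewrite ge_min lexx.
have [ii _] := bm_integrable (AC_bm b0 hE).
have ib : mu.-integrable `[a, b] (EFin \o (fun x => Re (E x))).
  by apply: integrableS ii => //; exact: sub_itvcc.
rewrite (Rintegral_split (ltW ac) cb ib) ltr_pwDl//; last first.
  apply: Rintegral_ge0 => x /=; rewrite in_itv/= => /andP[cx xb].
  by apply: E0; rewrite xb (le_trans (ltW ac)).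
apply: (@lt_le_trans _ _ (Re (E a) / 2 * (c - a))).
  by rewrite mulr_gt0// subr_gt0.
rewrite -Rintegral_cst_itv ?(ltW ac)//.
apply: le_Rintegral => //; first exact: integrable_cst.
  by apply: integrableS ib => //; exact: sub_itvcc.
move=> x /=; rewrite in_itv/= => /andP[ax xc].
have [->|xa] := eqVneq x a; first by lra.
have ax' : a < x by rewrite lt_neqAle eq_sym xa.
have := hd x; rewrite /ball /= => /(_ _ ax').
have -> : (`|a - x| < d) = true.
  rewrite distrC ger0_norm ?subr_ge0//.
  have : x <= a + d / 2 by rewrite (le_trans xc)// ge_min lexx orbT.
  by move: d0; lra.
by move=> /(_ isT); rewrite ltr_norml => /andP[_]; lra.
Qed.

Lemma L2_sqn (f : R -> C) : L2 f -> exists2 B : R, 0 <= B & forall b : R, 0 <= b ->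
  mu.-integrable `[0, b] (EFin \o (fun x => sqn (f x))) /\
  \int[mu]_(x in `[0, b]) sqn (f x) <= B.
Proof.
move=> [h1 h2]; have [B1 B10 k1] := L2real_sqr_int h1.
have [B2 B20 k2] := L2real_sqr_int h2.
exists (B1 + B2); first by rewrite addr_ge0.
move=> b b0; have [i1 l1] := k1 b b0; have [i2 l2] := k2 b b0.
split; first exact: integrable_add.
by rewrite /sqn RintegralD// lerD.
Qed.

Lemma L2_of_tail (f : R -> C) (b B : R) : 0 <= b ->
  (forall X : R, 0 <= X -> bm `[0, X]%classic f) ->
  (forall X : R, b <= X -> \int[mu]_(x in `[b, X]) sqn (f x) <= B) -> L2 f.
Proof.
move=> b0 fb hB.
have key X : 0 <= X -> \int[mu]_(x in `[0, X]) sqn (f x) <=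
    \int[mu]_(x in `[0, b]) sqn (f x) + B.
  move=> X0; have M0 : 0 <= Num.max X b by rewrite le_max X0.
  have bM : b <= Num.max X b by rewrite le_max lexx orbT.
  have iM := sqn_bm M0 (fb _ M0).
  apply: (@le_trans _ _ (\int[mu]_(x in `[0, Num.max X b]) sqn (f x))).
    have hX : X <= Num.max X b by rewrite le_max lexx.
    exact: (le_prim hX iM (fun t => sqn_ge0 (f t))).
  by rewrite (Rintegral_split b0 bM iM) lerD2l hB.
have part (g : R -> R) : (forall X : R, 0 <= X -> mfun `[0, X]%classic g) ->
    (forall x, g x ^+ 2 <= sqn (f x)) -> L2real g.
  move=> mg gle; apply: (@L2real_bounded _ _ (\int[mu]_(x in `[0, b]) sqn (f x) + B)) => //.
  move=> X X0; have iX := sqn_bm X0 (fb X X0).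
  have ig : mu.-integrable `[0, X] (EFin \o (fun x => g x ^+ 2)).
    apply: (le_integrable _ _ _ iX) => //.
      by apply/measurable_EFinP; apply: measurable_funX; exact: mg.
    move=> x _ /=; rewrite lee_fin !ger0_norm ?sqn_ge0 ?sqr_ge0//.
  split=> //; apply: le_trans (key X X0); apply: le_Rintegral => //.
split.
  by apply: part => [X X0|x]; [case: (fb X X0)|rewrite /sqn lerDl sqr_ge0].
by apply: part => [X X0|x]; [case: (fb X X0)|rewrite /sqn lerDr sqr_ge0].
Qed.

Variables (m : R) (p1 p2 q : R -> R).
Hypotheses (p1i : locint p1) (p2i : locint p2) (qi : locint q).
Local Notation dsol := (dsol m p1 p2 q).

Lemma dotp_cc (w : R -> C * C) x :
  dotp w (cc w) x = (sqn (w x).1 + sqn (w x).2)%:C.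
Proof. by rewrite /dotp /= !mul_cj; apply: CP; rewrite !ReImE /= ?addr0. Qed.

Lemma dotp_AC lam nu g h (u v : R -> C * C) : dsol lam g u -> dsol nu h v ->
  exists e, AC_deriv (dotp u v) e.
Proof.
move=> [u1 u2] [v1 v2]; eexists; exact: (AC_add (AC_mul u1 v1) (AC_mul u2 v2)).
Qed.

Lemma dotp_cc_pos lam g (w : R -> C * C) (a b : R) : dsol lam g w -> 0 <= a -> a < b ->
  w a != 0 -> 0 < \int[mu]_(x in `[a, b]) Re (dotp w (cc w) x).
Proof.
move=> hw a0 ab wa; have [e he] := dotp_AC hw (dsol_cc hw).
apply: (AC_pos he a0 ab) => [x _|].
  by rewrite dotp_cc /= addr_ge0 ?sqn_ge0.
rewrite dotp_cc /= lt_neqAle addr_ge0 ?sqn_ge0// andbT eq_sym.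
apply: contra wa => /eqP h; have h1 := sqn_ge0 (w a).1; have h2 := sqn_ge0 (w a).2.
have z1 : (w a).1 = 0 by apply: sqn_eq0; lra.
have z2 : (w a).2 = 0 by apply: sqn_eq0; lra.
by apply/eqP; rewrite [LHS]surjective_pairing z1 z2.
Qed.

(* Self-adjointness: the Lagrange identity for [w] and its conjugate bounds
   [2 Im lam] times the mass of [w] on [0, X] by [|w X|^2], which tends to zero
   along a sequence. *)
Lemma dsol_L2_zero lam (w : R -> C * C) : 0 < Im lam -> dsol lam (fun=> 0) w ->
  (w 0).1 = 0 -> L2 (fun x => (w x).1) -> L2 (fun x => (w x).2) ->
  forall x, 0 <= x -> w x = 0.
Proof.
move=> l0 hw w0 /L2_sqn[B1 B10 k1] /L2_sqn[B2 B20 k2].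
pose e x := Re (dotp w (cc w) x).
have eE x : e x = sqn (w x).1 + sqn (w x).2 by rewrite /e dotp_cc.
have e0 x : 0 <= e x by rewrite eE addr_ge0 ?sqn_ge0.
have wb := dsol_lbm hw.
have ei b : 0 <= b -> mu.-integrable `[0, b] (EFin \o e).
  by move=> b0; case: (dotp_int (wb b b0) (lbm_cc wb b0)).
have eB b : 0 <= b -> \int[mu]_(x in `[0, b]) e x <= B1 + B2.
  move=> b0; have [i1 l1] := k1 b b0; have [i2 l2] := k2 b b0.
  have -> : \int[mu]_(x in `[0, b]) e x =
      \int[mu]_(x in `[0, b]) (sqn (w x).1 + sqn (w x).2).
    by apply: eq_Rintegral => x _; exact: eE.
  by rewrite RintegralD// lerD.
pose S X := \int[mu]_(x in `[0, X]) e x.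
have key X : 0 <= X -> 2 * Im lam * S X <= e X.
  move=> X0; have LL := lagrange hw (dsol_cc hw); have [_ hX] := LL X X0.
  have iX : Im (wron w (cc w) X) = 2 * Im lam * S X.
    rewrite hX /wron w0 mul0r /= w0 cj0 mulr0 subr0 add0r /S -RintegralZl//; last exact: ei.
    apply: eq_Rintegral => x _; rewrite dotp_cc -eE /dotp /= cj0.
    by rewrite !mulr0 !mul0r !addr0 subr0 !ReImE /= eE /sqn; ring.
  rewrite -iX eE /wron /sqn /= !ReImE /=.
  set a := Re (w X).1; set b := Im (w X).1; set c := Re (w X).2; set d := Im (w X).2.
  have := sqr_ge0 (b - c); have := sqr_ge0 (a + d); nra.
have S0 X : 0 <= X -> S X = 0.
  move=> X0; apply/eqP; rewrite eq_le; apply/andP; split; last exact: Rintegral_ge0.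
  rewrite leNgt; apply/negP => SX.
  pose eta := 2 * Im lam * S X; have eta0 : 0 < eta by rewrite !mulr_gt0.
  (* [S] is nondecreasing, so by [key] the density is at least [eta] after [X]. On an interval of
     this length its mass reaches [B1 + B2 + 1], more than the total allows. *)
  pose t := (B1 + B2 + 1) / eta.
  have t0 : 0 < t by rewrite divr_gt0// ltr_wpDl ?addr_ge0.
  have Xt : X <= X + t by rewrite lerDl ltW.
  have Xt0 := le_trans X0 Xt.
  have := eB (X + t) Xt0; rewrite (Rintegral_split X0 Xt (ei _ Xt0)) leNgt => /negP; apply.
  apply: (@lt_le_trans _ _ (eta * (X + t - X))).
    have -> : eta * (X + t - X) = B1 + B2 + 1 by rewrite /t; field; rewrite gt_eqF.
    by rewrite ltrDl.
  apply: (@le_trans _ _ (\int[mu]_(x in `[X, (X + t)]) e x)); last first.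
    by rewrite lerDr Rintegral_ge0.
  rewrite -Rintegral_cst_itv//; apply: le_Rintegral => //.
  - exact: integrable_cst.
  - by apply: integrableS (ei _ Xt0) => //; exact: sub_itvcc.
  move=> x /=; rewrite in_itv/= => /andP[Xx xt].
  have x0 := le_trans X0 Xx.
  apply: le_trans (key x x0); rewrite /eta ler_wpM2l ?mulr_ge0 ?(ltW l0)//.
  by apply: le_prim => //; exact: ei.
move=> x x0; apply/eqP; apply: contraT => wx.
have xx : x < x + 1 by rewrite ltrDl.
have x10 : 0 <= x + 1 by rewrite (le_trans x0)// ltW.
have := dotp_cc_pos hw x0 xx wx.
have := S0 (x + 1) x10; rewrite /S (Rintegral_split x0 (ltW xx) (ei _ x10)) -/(S x) (S0 _ x0) add0r.
by rewrite /e => ->; rewrite ltxx.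
Qed.

End Uniqueness.

(** * Exterior solutions and the resolvent *)

Section Resolvent.
Context {R : realType}.
Local Notation C := (Cplx R).
Local Notation mu := (@lebesgue_measure R).
Local Notation mfun A g := (measurable_fun (A : set (measurableTypeR R)) g).
Implicit Types (u g h : R -> C * C) (lam s : C) (b x : R).

Lemma AC_const_after (U u : R -> C) b : 0 <= b -> AC_deriv U u ->
  {ae mu, forall x, b <= x -> u x = 0} -> forall x, b <= x -> U x = U b.
Proof.
move=> b0 hU ae0 x bx; have x0 := le_trans b0 bx.
have [i1 i2] := integrableC_sub b0 (lexx x) (AC_int x0 hU).
have z (f : R -> R) : mu.-integrable `[b, x] (EFin \o f) ->
    {ae mu, forall y, b <= y -> f y = 0} -> \int[mu]_(y in `[b, x]) f y = 0.
  move=> fi fae; rewrite /Rintegral.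
  rewrite (ae_eq_integral (cst 0%E)) ?integral0//.
    exact: measurable_int fi.
  by apply: aeS fae => y h; rewrite /= in_itv/= => /andP[/h -> _].
apply/eqP; rewrite -subr_eq0 (AC_diff b0 bx hU); apply/eqP; apply: CP => /=; apply: z => //.
  by apply: aeS ae0 => y h /h ->.
by apply: aeS ae0 => y h /h ->.
Qed.

(** Where [V] vanishes, the free system has the solution [(lam + m, s) exp (s x)], annihilated by
    this form; the form detects the component along the other exponential, [exp (- s x)]. Applied to
    [phi] at [gamma] it is [D_s]. *)
Definition bform lam s (m : R) u x : C := (u x).1 * s - (u x).2 * (lam + m%:C).

Section Free.
Variables (m : R).
Let zero : R -> R := fun=> 0.
Let gz : R -> C * C := fun=> 0.

Lemma zero_locint : locint zero.
Proof. by move=> b b0; exact: integrable_cst. Qed.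

Lemma gz_lbm : lbm gz.
Proof. by move=> b b0; split; exact: bm_cst. Qed.

(** Complex exponentials are taken from the free system itself, so that their holomorphy in [lam] is
    an instance of that of solutions. *)
Definition free lam := sol m zero zero zero lam (1, 0) gz.

Lemma freeP lam : dsol m zero zero zero lam gz (free lam) /\ free lam 0 = (1, 0).
Proof. by apply: solP; try exact: zero_locint; exact: gz_lbm. Qed.

(* [efac lam s x] is a multiple of [exp (- s x)]. *)
Definition efac lam s x := bform lam s m (free lam) x.

Lemma efac0 lam s : efac lam s 0 = s.
Proof. by rewrite /efac /bform (freeP lam).2 /=; ring. Qed.

Lemma efac_AC lam s : s ^+ 2 = m%:C ^+ 2 - lam ^+ 2 ->
  AC_deriv (efac lam s) (fun x => - s * efac lam s x).
Proof.
move=> hs; have [[h1 h2] _] := freeP lam.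
apply: eq_AC (AC_sub (AC_scale s h1) (AC_scale (lam + m%:C) h2)) => x x0.
  by rewrite /efac /bform; ring.
rewrite /efac /bform /= /zero subr0 addr0.
move: (free lam x) => [u1 u2] /=.
have -> : - s * (u1 * s - u2 * (lam + m%:C)) = - (s ^+ 2) * u1 + s * u2 * (lam + m%:C) by ring.
rewrite hs (_ : (0 : R)%:C = 0 :> C)//; ring.
Qed.

(** The product of the factors for [s] and [- s] is constant, equal to [- s^2]. *)
Lemma efac_neq0 lam s x : s ^+ 2 = m%:C ^+ 2 - lam ^+ 2 -> s != 0 -> 0 <= x ->
  efac lam s x != 0.
Proof.
move=> hs s0 x0.
have hs' : (- s) ^+ 2 = m%:C ^+ 2 - lam ^+ 2 by rewrite sqrrN.
have h := AC_mul (efac_AC hs) (efac_AC hs').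
have : efac lam s x * efac lam (- s) x = efac lam s 0 * efac lam (- s) 0.
  apply: (AC_const_after (lexx 0) h) => //.
  by apply: aeW => y _; ring.
rewrite !efac0 => e; apply: contra_neq s0 => z; move: e; rewrite z mul0r => /esym/eqP.
by rewrite mulrN oppr_eq0 mulf_eq0 => /orP[]/eqP.
Qed.

End Free.

Section Tail.
Variables (m gamma : R) (p1 p2 q : R -> R).
Hypotheses (p1i : locint p1) (p2i : locint p2) (qi : locint q).
Hypothesis gamma0 : 0 <= gamma.
Hypothesis V0 : {ae mu, forall x, gamma <= x -> [/\ p1 x = 0, p2 x = 0 & q x = 0]}.
Local Notation dsol := (dsol m p1 p2 q).
Local Notation bf lam s := (bform lam s m).
Local Notation efac := (efac m).

Lemma bform_AC lam s g u : dsol lam g u -> AC_deriv (bf lam s u)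
  (fun x => s * (rhs m p1 p2 q lam g u x).1 - (lam + m%:C) * (rhs m p1 p2 q lam g u x).2).
Proof.
move=> [h1 h2]; apply: eq_AC (AC_sub (AC_scale s h1) (AC_scale (lam + m%:C) h2)) => // x _.
by rewrite /bform; ring.
Qed.

(** Past the supports of [V] and [g] the form has derivative [- s] times itself, while
    [efac lam (- s)] has derivative [s] times itself; so their product is constant. *)
Lemma bform_efac lam s g u b : s ^+ 2 = m%:C ^+ 2 - lam ^+ 2 -> dsol lam g u ->
  gamma <= b -> (forall x, b <= x -> g x = 0) ->
  forall x, b <= x ->
  bf lam s u x * efac lam (- s) x = bf lam s u b * efac lam (- s) b.
Proof.
move=> hs hu gb g0; have b0 := le_trans gamma0 gb.
have hs' : (- s) ^+ 2 = m%:C ^+ 2 - lam ^+ 2 by rewrite sqrrN.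
apply: (AC_const_after b0 (AC_mul (bform_AC s hu) (efac_AC hs'))).
apply: aeS V0 => x V bx; have [e1 e2 e3] := V (le_trans gb bx).
rewrite /rhs /= g0//= e1 e2 e3 !subr0 !addr0 /bform (_ : (0 : R)%:C = 0 :> C)//.
move: (u x) (efac lam (- s) x) => [u1 u2] E /=.
have -> : s * (- 0 * u1 + (m%:C + lam) * u2) -
   (lam + m%:C) * ((m%:C - lam) * u1 + 0 * u2) =
   s * (m%:C + lam) * u2 - (m%:C ^+ 2 - lam ^+ 2) * u1 by ring.
by rewrite -hs; ring.
Qed.

Lemma bform_zero_after lam s g u b : s ^+ 2 = m%:C ^+ 2 - lam ^+ 2 -> s != 0 ->
  dsol lam g u -> gamma <= b -> (forall x, b <= x -> g x = 0) ->
  bf lam s u b = 0 -> forall x, b <= x -> bf lam s u x = 0.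
Proof.
move=> hs s0 hu gb g0 ub x bx.
have hs' : (- s) ^+ 2 = m%:C ^+ 2 - lam ^+ 2 by rewrite sqrrN.
have x0 := le_trans (le_trans gamma0 gb) bx.
have := bform_efac hs hu gb g0 bx; rewrite ub mul0r => /eqP.
rewrite mulf_eq0 => /orP[/eqP //|].
have ns0 : - s != 0 by rewrite oppr_eq0.
by rewrite (negbTE (efac_neq0 hs' ns0 x0)).
Qed.

(** Vanishing of the form makes [u_2] a multiple of [u_1] and gives [u_1' = s u_1]. Then [sqn u_1]
    has derivative [2 Re s sqn u_1], which bounds its integral without any explicit exponential. *)
Lemma tail_L2 lam s g u b : s ^+ 2 = m%:C ^+ 2 - lam ^+ 2 -> Re s < 0 ->
  lam + m%:C != 0 -> dsol lam g u -> gamma <= b -> (forall x, b <= x -> g x = 0) ->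
  bf lam s u b = 0 -> L2 (fun x => (u x).1) /\ L2 (fun x => (u x).2).
Proof.
move=> hs res lm hu gb g0 ub; have b0 := le_trans gamma0 gb.
have s0 : s != 0 by apply: contraTneq res => ->; rewrite /= ltxx.
have bz := bform_zero_after hs s0 hu gb g0 ub.
have u2E x : b <= x -> (u x).2 = s / (lam + m%:C) * (u x).1.
  move=> /bz; rewrite /bform => /eqP; rewrite subr_eq0 => /eqP e.
  by apply: (mulIf lm); rewrite -e; field.
have ulb := dsol_lbm hu.
have b1 X : 0 <= X -> bm `[0, X]%classic (fun x => (u x).1) by move=> /ulb[].
have b2 X : 0 <= X -> bm `[0, X]%classic (fun x => (u x).2) by move=> /ulb[].
have [h1 _] := hu.
have li : locint (fun x => sqn (u x).1) by move=> X X0; apply: sqn_bm => //; exact: b1.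
have hK := AC_sub (AC_mul h1 (AC_conj h1)) (AC_scale (2 * Re s)%:C (AC_real li)).
have K0 := AC_const_after b0 hK.
pose P x := \int[mu]_(t in `[0, x]) sqn (u t).1.
have cK X : b <= X -> sqn (u X).1 - 2 * Re s * P X = sqn (u b).1 - 2 * Re s * P b.
  move=> bX; have := K0 _ X bX; rewrite !mul_cj -!rmorphM -!rmorphB /= => h.
  apply: complexI; apply: h.
  apply: aeS V0 => x V bx; have [e1 e2 e3] := V (le_trans gb bx).
  rewrite /rhs /= g0//= e2 e3 (u2E x bx) !subr0 addr0 (_ : (0 : R)%:C = 0 :> C)//.
  have e : - 0 * (u x).1 + (m%:C + lam) * (s / (lam + m%:C) * (u x).1) = s * (u x).1.
    by field.
  rewrite e cjM; apply: CP; rewrite !ReImE /= ?ReImE /= /sqn; ring.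
have bnd X : b <= X -> \int[mu]_(x in `[b, X]) sqn (u x).1 <= sqn (u b).1 / (- 2 * Re s).
  move=> bX; have X0 := le_trans b0 bX.
  have e : P X = P b + \int[mu]_(x in `[b, X]) sqn (u x).1.
    by apply: Rintegral_split => //; exact: li.
  rewrite ler_pdivlMr; last by move: res; lra.
  have := cK X bX; rewrite e; have := sqn_ge0 (u X).1; nra.
split; first exact: L2_of_tail b0 b1 bnd.
apply: (L2_of_tail (B := sqn (s / (lam + m%:C)) * (sqn (u b).1 / (- 2 * Re s))) b0 b2).
move=> X bX; have X0 := le_trans b0 bX.
have ib : mu.-integrable `[b, X] (EFin \o (fun x => sqn (u x).1)).
  by apply: integrableS (li _ X0) => //; exact: sub_itvcc.
have -> : \int[mu]_(x in `[b, X]) sqn (u x).2 =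
    \int[mu]_(x in `[b, X]) (sqn (s / (lam + m%:C)) * sqn (u x).1).
  apply: eq_Rintegral => x; rewrite inE /= in_itv/= => /andP[bx _].
  by rewrite u2E// sqnM.
by rewrite RintegralZl// ler_wpM2l ?sqn_ge0 ?bnd.
Qed.

End Tail.

End Resolvent.

(** * The resolvent in terms of solutions *)

Section GreenFunction.
Context {R : realType}.
Local Notation C := (Cplx R).
Local Notation mu := (@lebesgue_measure R).
Local Notation mfun A g := (measurable_fun (A : set (measurableTypeR R)) g).
Implicit Types (u g h : R -> C * C) (lam s : C) (b x : R).

Lemma Re_continuous : continuous (fun z : C => Re z).
Proof.
move=> z A /nbhs_ballP[e /= e0 hA]; apply/nearC; exists e => // w wz.
apply: hA; rewrite /ball /= -ReN -ReD; apply: le_lt_trans wz.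
by rewrite n1_dist; exact: Re_le_n1.
Qed.

Lemma Im_continuous : continuous (fun z : C => Im z).
Proof.
move=> z A /nbhs_ballP[e /= e0 hA]; apply/nearC; exists e => // w wz.
apply: hA; rewrite /ball /= -ImN -ImD; apply: le_lt_trans wz.
by rewrite n1_dist; exact: Im_le_n1.
Qed.

Lemma within_comp (f : R -> C * C) (k : C * C -> R) (A : set R) :
  {within A, continuous f} -> continuous k -> {within A, continuous (fun x => k (f x))}.
Proof. by move=> hf hk x; apply: (cvg_comp _ _ (hf x)); exact: hk. Qed.

Lemma pair_continuous (k : C -> R) : continuous k ->
  continuous (fun z : C * C => k z.1) /\ continuous (fun z : C * C => k z.2).
Proof.
move=> hk; split=> z.
  by apply: (cvg_comp _ _ (@cvg_fst _ _ (nbhs z.1) (nbhs z.2) _)); exact: hk.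
by apply: (cvg_comp _ _ (@cvg_snd _ _ (nbhs z.1) (nbhs z.2) _)); exact: hk.
Qed.

Lemma within_bounded (f : R -> R) b : 0 <= b -> {within `[0, b], continuous f} ->
  exists M : R, forall x, `[0, b]%classic x -> `|f x| <= M.
Proof.
move=> b0 hf.
have hn : {within `[0, b], continuous (fun x => `|f x|)}.
  by move=> x; apply: (cvg_comp _ _ (hf x)); exact: norm_continuous.
have [c _ hc] := EVT_max b0 hn.
by exists `|f c| => x xb; apply: hc.
Qed.

Lemma C0_comp h (k : C * C -> R) b : C0 h -> continuous k -> 0 <= b ->
  mfun `[0, b]%classic (fun x => k (h x)) /\
  exists M : R, forall x, `[0, b]%classic x -> `|k (h x)| <= M.
Proof.
move=> [hc _] hk b0.
have h1 : {within `[0, b], continuous (fun x => k (h x))}.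
  apply: within_comp hk; apply: continuous_subspaceW hc.
  exact: sub_halfline.
by split; [exact: subspace_continuous_measurable_fun|exact: within_bounded].
Qed.

Lemma C0_lbm h : C0 h -> lbm h.
Proof.
move=> hc b b0.
have [r1 r2] := pair_continuous Re_continuous; have [i1 i2] := pair_continuous Im_continuous.
have [a1 [M1 k1]] := C0_comp hc r1 b0; have [a2 [M2 k2]] := C0_comp hc r2 b0.
have [a3 [M3 k3]] := C0_comp hc i1 b0; have [a4 [M4 k4]] := C0_comp hc i2 b0.
split; split => //.
  by exists (M1 + M3) => x xb; rewrite /n1 lerD ?k1 ?k3.
by exists (M2 + M4) => x xb; rewrite /n1 lerD ?k2 ?k4.
Qed.

Lemma lbm_L2 h b : 0 <= b -> lbm h -> (forall x, b <= x -> h x = 0) ->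
  L2 (fun x => (h x).1) /\ L2 (fun x => (h x).2).
Proof.
move=> b0 hb h0.
have z (f : R -> C) : (forall x, b <= x -> f x = 0) -> forall X : R, b <= X ->
    \int[mu]_(x in `[b, X]) sqn (f x) <= 0.
  move=> fz X bX; rewrite (@eq_Rintegral _ _ _ _ _ (fun=> 0)).
    by rewrite /Rintegral integral0.
  move=> x; rewrite inE /= in_itv/= => /andP[bx _].
  by rewrite fz// /sqn /= expr0n /= addr0.
split; apply: (L2_of_tail (B := 0) b0); try by move=> X /hb[].
  by apply: z => x /h0 ->.
by apply: z => x /h0 ->.
Qed.

Lemma lbm1 u : lbm u -> forall b, 0 <= b -> bm `[0, b]%classic (fun x => (u x).1).
Proof. by move=> h b /h[]. Qed.
Lemma lbm2 u : lbm u -> forall b, 0 <= b -> bm `[0, b]%classic (fun x => (u x).2).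
Proof. by move=> h b /h[]. Qed.

Lemma L2_comb (a1 a2 : C) (f g : R -> C) :
  (forall b, 0 <= b -> bm `[0, b]%classic f) -> (forall b, 0 <= b -> bm `[0, b]%classic g) ->
  L2 f -> L2 g -> L2 (fun x => a1 * f x + a2 * g x).
Proof.
move=> fb gb /L2_sqn[B1 _ k1] /L2_sqn[B2 _ k2].
have cb b : 0 <= b -> bm `[0, b]%classic (fun x => a1 * f x + a2 * g x).
  by move=> b0; apply: bmD; apply: bmM; try exact: bm_cst; [exact: fb|exact: gb].
apply: (L2_of_tail (B := 2 * sqn a1 * B1 + 2 * sqn a2 * B2) (lexx 0) cb) => X X0.
have [i1 l1] := k1 X X0; have [i2 l2] := k2 X X0.
have j1 := integrable_scale (2 * sqn a1) (measurable_itv _) i1.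
have j2 := integrable_scale (2 * sqn a2) (measurable_itv _) i2.
apply: (@le_trans _ _ (\int[mu]_(x in `[0, X])
    (2 * sqn a1 * sqn (f x) + 2 * sqn a2 * sqn (g x)))).
  apply: le_Rintegral => //.
  - by apply: sqn_bm => //; exact: cb.
  - exact: integrable_add.
  move=> x _; rewrite -!mulrA -!sqnM /sqn !ReD !ImD.
  set r1 := Re _; set r2 := Re _; set s1 := Im _; set s2 := Im _.
  by have := sqr_ge0 (r1 - r2); have := sqr_ge0 (s1 - s2); lra.
rewrite RintegralD// !RintegralZl//.
by apply: lerD; rewrite ler_wpM2l ?mulr_ge0 ?sqn_ge0.
Qed.

Section Graph.
Variables (m : R) (p1 p2 q : R -> R).
Hypotheses (p1i : locint p1) (p2i : locint p2) (qi : locint q).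
Local Notation dsol := (dsol m p1 p2 q).

Lemma graph_of_dsol lam h u : lbm h -> dsol lam h u -> (u 0).1 = 0 ->
  L2 (fun x => (u x).1) /\ L2 (fun x => (u x).2) ->
  L2 (fun x => (h x).1) /\ L2 (fun x => (h x).2) ->
  dirac_graph m p1 p2 q u (fun x => h x + lam *: u x).
Proof.
move=> hb hu u0 [l1 l2] [k1 k2]; have ub := dsol_lbm hu.
split => //.
- split.
    have := L2_comb 1 lam (lbm1 hb) (lbm1 ub) k1 l1.
    by under eq_fun do rewrite mul1r.
  have := L2_comb 1 lam (lbm2 hb) (lbm2 ub) k2 l2.
  by under eq_fun do rewrite mul1r.
exists (rhs m p1 p2 q lam h u); case: hu => h1 h2; split => //.
apply: aeW => x x0 /=; rewrite /GRing.scale /= !rmorphD !rmorphN /=.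
by split; ring.
Qed.

(** The graph gives the equation almost everywhere only; [AC_ae] turns it into the integral equation
    for [rhs], whose measurability comes from [rhs_int]. *)
Lemma dsol_of_graph lam h u : lbm h ->
  dirac_graph m p1 p2 q u (fun x => h x + lam *: u x) -> dsol lam h u.
Proof.
move=> hb [_ _ _ [v [v1 v2 hv]]].
have ub : lbm u by move=> b b0; split; [exact: AC_bm v1|exact: AC_bm v2].
have mr b : 0 <= b -> [/\ mfun `[0, b]%classic (fun x => Re (rhs m p1 p2 q lam h u x).1),
    mfun `[0, b]%classic (fun x => Im (rhs m p1 p2 q lam h u x).1),
    mfun `[0, b]%classic (fun x => Re (rhs m p1 p2 q lam h u x).2) &
    mfun `[0, b]%classic (fun x => Im (rhs m p1 p2 q lam h u x).2)].
  move=> b0; have [[i1 i2] [i3 i4]] := rhs_int m p1i p2i qi lam b0 (ub b b0) (hb b b0).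
  by split; [move: i1|move: i2|move: i3|move: i4] => /integrableP[/measurable_EFinP].
split.
  apply: (AC_ae v1); first by move=> b /mr[].
  apply: aeS hv => x hx x0; have [_] := hx x0.
  rewrite /= /GRing.scale /= !rmorphD !rmorphN /= => e.
  have -> : (v x).1 = ((v x).1 + (q x)%:C * (u x).1 + (- m%:C + (p2 x)%:C) * (u x).2)
     - (q x)%:C * (u x).1 - (- m%:C + (p2 x)%:C) * (u x).2 by ring.
  by rewrite -e; ring.
apply: (AC_ae v2); first by move=> b /mr[].
apply: aeS hv => x hx x0; have [+ _] := hx x0.
rewrite /= /GRing.scale /= !rmorphD /= => e.
have -> : (v x).2 = - ((m%:C + (p1 x)%:C) * (u x).1 + (- (v x).2 + (q x)%:C * (u x).2))
   + (m%:C + (p1 x)%:C) * (u x).1 + (q x)%:C * (u x).2 by ring.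
by rewrite -e; ring.
Qed.

(** The chosen value of [resolvent] and [u] differ by a square-integrable homogeneous solution with
    the boundary condition, which [dsol_L2_zero] annihilates. *)
Lemma resolvent_unique lam h u : 0 < Im lam -> lbm h -> dsol lam h u -> (u 0).1 = 0 ->
  L2 (fun x => (u x).1) /\ L2 (fun x => (u x).2) ->
  L2 (fun x => (h x).1) /\ L2 (fun x => (h x).2) ->
  forall x, 0 <= x -> resolvent m p1 p2 q lam h x = u x.
Proof.
move=> l0 hb hu u0 ul hl x x0.
have gu := graph_of_dsol hb hu u0 ul hl.
have gr := @xgetPex _ (fun=> 0) [set u | dirac_graph m p1 p2 q u (fun x => h x + lam *: u x)]
  (ex_intro _ u gu).
rewrite -/(resolvent m p1 p2 q lam h) /= in gr.
move: (resolvent m p1 p2 q lam h) gr => r gr.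
have hr := dsol_of_graph hb gr.
have [[rl1 rl2] _ r0 _] := gr; have [ul1 ul2] := ul.
have rb := dsol_lbm hr; have ub := dsol_lbm hu.
have hw := dsol_comb 1 (-1) hr hu.
have hw' : dsol lam (fun=> 0) (fun t => (1 * (r t).1 + -1 * (u t).1, 1 * (r t).2 + -1 * (u t).2)).
  by apply: eq_dsol hw => // t _; rewrite !mul1r !mulN1r !subrr.
have w0 : 1 * (r 0).1 + -1 * (u 0).1 = 0 by rewrite r0 u0 !mulr0 addr0.
have L1 := L2_comb 1 (-1) (lbm1 rb) (lbm1 ub) rl1 ul1.
have L2' := L2_comb 1 (-1) (lbm2 rb) (lbm2 ub) rl2 ul2.
have [e1 e2] := dsol_L2_zero l0 hw' w0 L1 L2' x0.
rewrite [LHS]surjective_pairing [RHS]surjective_pairing.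
by congr pair; apply/eqP; rewrite -subr_eq0; apply/eqP;
  [move: e1|move: e2]; rewrite mul1r mulN1r.
Qed.

Section Formula.
Variable gamma : R.
Hypothesis gamma0 : 0 <= gamma.
Hypothesis V0 : {ae mu, forall x, gamma <= x -> [/\ p1 x = 0, p2 x = 0 & q x = 0]}.

Definition phi lam : R -> C * C := sol m p1 p2 q lam (0, 1) (fun=> 0).
Definition chi h lam : R -> C * C := sol m p1 p2 q lam 0 h.

Lemma phiP lam : dsol lam (fun=> 0) (phi lam) /\ phi lam 0 = (0, 1).
Proof. by apply: solP => //; exact: gz_lbm. Qed.

Lemma chiP h lam : lbm h -> dsol lam h (chi h lam) /\ chi h lam 0 = 0.
Proof. exact: solP. Qed.

Lemma upper_shift_neq0 lam (a : R) : 0 < Im lam -> lam + a%:C != 0.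
Proof.
move=> l0; apply/eqP => /(congr1 (@Im R)); rewrite !ReImE /= addr0 => e.
by move: l0; rewrite e ltxx.
Qed.

(** A zero would make [phi] square integrable by [tail_L2], that is an eigenfunction for a nonreal
    [lam]. *)
Lemma bform_phi_neq0 lam s b : 0 < Im lam -> s ^+ 2 = m%:C ^+ 2 - lam ^+ 2 -> Re s < 0 ->
  gamma <= b -> bform lam s m (phi lam) b != 0.
Proof.
move=> l0 hs res gb; apply/eqP => z; have [hp p0] := phiP lam.
have [k1 k2] := tail_L2 gamma0 V0 hs res (upper_shift_neq0 m l0) hp gb
  (fun x _ => erefl) z.
have := dsol_L2_zero l0 hp _ k1 k2 (lexx 0).
by rewrite p0 => /(_ erefl) [/eqP]; rewrite oner_eq0.
Qed.

Lemma integralC_supp (f : R -> C) b : 0 <= b -> (forall x, b <= x -> f x = 0) ->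
  integralC halfline f = integralC `[0, b]%classic f.
Proof.
move=> b0 fz.
have z (k : R -> R) : (forall x, b <= x -> k x = 0) ->
    \int[mu]_(x in halfline) k x = \int[mu]_(x in `[0, b]) k x.
  move=> kz; have -> : (`[0, b]%classic : set R) = halfline `&` `[0, b]%classic.
    by rewrite setIidr//; exact: sub_halfline.
  rewrite Rintegral_mkcondr; apply: eq_Rintegral => x.
  rewrite inE /halfline /= in_itv/= andbT => x0.
  rewrite /patch; case: ifPn => //; rewrite notin_setE /= in_itv/= x0 /= => /negP.
  by rewrite -ltNge => /ltW; exact: kz.
by apply: CP; apply: z => x /fz ->.
Qed.

(** The resolvent is [chi - k phi]: both terms satisfy the boundary condition, and [k] is chosen to
    make the form vanish at [b], which gives square integrability. *)
Theorem G_formula h b lam s : C0 h -> gamma <= b -> (forall x, b <= x -> h x = 0) ->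
  0 < Im lam -> s ^+ 2 = m%:C ^+ 2 - lam ^+ 2 -> Re s < 0 ->
  G m p1 p2 q h lam = integralC `[0, b]%classic (dotp (chi h lam) (cc h)) -
    integralC `[0, b]%classic (dotp (phi lam) (cc h)) *
    bform lam s m (chi h lam) b / bform lam s m (phi lam) b.
Proof.
move=> hC gb h0 l0 hs res; have hb := C0_lbm hC; have b0 := le_trans gamma0 gb.
have D0 := bform_phi_neq0 l0 hs res gb.
have [hc c0] := chiP lam hb; have [hp p0] := phiP lam.
set k := bform lam s m (chi h lam) b / bform lam s m (phi lam) b.
pose u t : C * C := (1 * (chi h lam t).1 + - k * (phi lam t).1,
  1 * (chi h lam t).2 + - k * (phi lam t).2).
have hu : dsol lam h u.
  apply: eq_dsol (dsol_comb 1 (- k) hc hp) => // t _.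
  by rewrite /= !mulr0 !addr0 !mul1r -surjective_pairing.
have u0 : (u 0).1 = 0 by rewrite /u c0 p0 /= !mulr0 addr0.
have hl := lbm_L2 b0 hb h0.
have ul : L2 (fun x => (u x).1) /\ L2 (fun x => (u x).2).
  apply: (tail_L2 gamma0 V0 hs res (upper_shift_neq0 m l0) hu gb h0).
  have -> : bform lam s m u b = bform lam s m (chi h lam) b - k * bform lam s m (phi lam) b.
    by rewrite /bform /u /=; ring.
  by rewrite /k divfK// subrr.
have ru := resolvent_unique l0 hb hu u0 ul hl.
have cb := dsol_lbm hc b0; have pb := dsol_lbm hp b0.
have hcb := lbm_cc hb b0.
rewrite /G /inner (@eq_integralC _ _ _ (dotp u (cc h))); last first.
  move=> x; rewrite /halfline /= in_itv/= andbT => x0.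
  by rewrite ru// /dotp /cc /= !cjE.
rewrite (integralC_supp b0); last by move=> x /h0 e; rewrite /dotp /cc /= e /= !cj0 !mulr0 addr0.
rewrite -[RHS]/(_ - _ * _ / _) -mulrA [X in _ - X]mulrC -/k.
have mI := measurable_itv `[0, b].
rewrite -(integralCZ k mI (dotp_int pb hcb)).
rewrite -(integralCB mI (dotp_int cb hcb) (integrableCZ k mI (dotp_int pb hcb))).
by apply: eq_integralC => x _; rewrite /dotp /u /=; ring.
Qed.

End Formula.
End Graph.
End GreenFunction.

(** * Square roots of m^2 - lam^2 *)

Section SquareRoot.
Context {R : realType}.
Local Notation C := (Cplx R).
Implicit Types (z w : C).

Lemma sqrtc_Re_ge0 z : 0 <= Re (sqrtc z).
Proof. by case: z => a b /=; rewrite sqrtr_ge0. Qed.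

Lemma sqrtc_Re_gt0 z : ~ (Im z = 0 /\ Re z <= 0) -> 0 < Re (sqrtc z).
Proof.
move=> h; rewrite lt_neqAle sqrtc_Re_ge0 andbT eq_sym; apply/eqP => r0; apply: h.
have := sqr_sqrtc z; set r := sqrtc z in r0 * => e; rewrite -e expr2.
rewrite !ReImE r0 !mul0r mulr0 add0r; split=> //.
by have := sqr_ge0 (Im r); rewrite expr2; lra.
Qed.

Lemma n1V_Re z (a : R) : 0 < a -> a <= Re z -> n1 z^-1 <= 2 / a.
Proof.
move=> a0 az; apply: (le_trans (n1V z)).
have h : a <= n1 z by rewrite /n1 (le_trans az)// (le_trans (ler_norm _))// lerDl.
by rewrite ler_wpM2l// lef_pV2// posrE; exact: lt_le_trans h.
Qed.

(** Since [s w + s z] has real part at least [Re (s z)], the identity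
    [s w - s z = (P w - P z) / (s w + s z)] makes [s] Lipschitz at [z]; continuity of the root is
    not presupposed. The error of the linear approximation is then that of [P] minus the square of
    an increment, over [2 s z]. *)
Lemma sqrt_derivable (P s : C -> C) z : (forall w, s w ^+ 2 = P w) ->
  (forall w, 0 <= Re (s w)) -> 0 < Re (s z) -> derivable P z 1 -> derivable s z 1.
Proof.
move=> sP s0 sz /derivableCP[d hd]; apply/derivableCP; exists (d / (2 * s z)) => e e0.
set a := Re (s z) in sz; set M := 2 / a; set L := M * (1 + n1 d).
have M0 : 0 < M by rewrite divr_gt0.
have nd := n1_ge0 d.
have L0 : 0 < L by rewrite mulr_gt0// ltr_pwDl.
have sn w : n1 (s w + s z)^-1 <= M.
  by apply: n1V_Re => //; rewrite !ReImE lerDr.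
have ss w : s w + s z != 0.
  apply/eqP => /(congr1 (@Re R)); rewrite !ReImE /= -/a => k.
  by have := s0 w; clear -sz k; lra.
have sz0 : s z != 0 by apply/eqP => k; move: sz; rewrite /a k ltxx.
have e1 : 0 < e / (2 * M) by rewrite divr_gt0// mulr_gt0.
have [t1 t10 h1] := hd 1 ltr01; have [t2 t20 h2] := hd _ e1.
have Q0 : 0 < 2 * M * L ^+ 2 by exact: (mulr_gt0 (mulr_gt0 (ltr0Sn R 1) M0) (exprn_gt0 2 L0)).
(* [t1] yields the Lipschitz constant [L], [t2] limits the linear error to half of [e], and the last
   radius does the same for the quadratic error [M * L ^+ 2]. *)
exists (Num.min t1 (Num.min t2 (e / (2 * M * L ^+ 2)))).
  by rewrite !lt_min t10 t20 divr_gt0.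
move=> w; rewrite !lt_min => /and3P[wt1 wt2 wt3].
have hP : n1 (P w - P z) <= (1 + n1 d) * n1 (w - z).
  have -> : P w - P z = (P w - P z - d * (w - z)) + d * (w - z) by ring.
  apply: (le_trans (n1D _ _)).
  by have := h1 w wt1; have := n1M d (w - z); clear; lra.
have hs : n1 (s w - s z) <= L * n1 (w - z).
  have -> : s w - s z = (s w + s z)^-1 * (P w - P z).
    by rewrite -!sP; field.
  apply: (le_trans (n1M _ _)); rewrite /L -mulrA.
  by apply: ler_pM => //; exact: n1_ge0.
have hz : n1 (2 * s z)^-1 <= M by have := sn z; rewrite -mulr2n mulr_natl.
have -> : s w - s z - d / (2 * s z) * (w - z) =
    (2 * s z)^-1 * (P w - P z - d * (w - z) - (s w - s z) ^+ 2).
  by rewrite -!sP; field.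
apply: (le_trans (n1M _ _)).
have hsq : n1 ((s w - s z) ^+ 2) <= L ^+ 2 * n1 (w - z) ^+ 2.
  apply: (le_trans (n1X _ _)); rewrite -exprMn ler_pXn2r// ?nnegrE ?n1_ge0//.
  by rewrite mulr_ge0 ?n1_ge0// ltW.
apply: (@le_trans _ _ (M * (e / (2 * M) * n1 (w - z) + L ^+ 2 * n1 (w - z) ^+ 2))).
  apply: ler_pM => //; try exact: n1_ge0.
  by apply: (le_trans (n1B _ _)); apply: lerD => //; exact: h2.
have k : L ^+ 2 * n1 (w - z) ^+ 2 <= e / (2 * M) * n1 (w - z).
  rewrite expr2 mulrA ler_wpM2r ?n1_ge0//.
  have -> : e / (2 * M) = L ^+ 2 * (e / (2 * M * L ^+ 2)).
    by field; rewrite !gt_eqF// -?invr_gt0 ?invrK.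
  by rewrite ler_wpM2l ?sqr_ge0// ltW.
have -> : e * n1 (w - z) = M * (e / (2 * M) * n1 (w - z) + e / (2 * M) * n1 (w - z)).
  by field; rewrite gt_eqF.
by apply: ler_wpM2l; rewrite ?(ltW M0)//; move: k; clear; lra.
Qed.

Lemma eq_sqr_Re (z w : C) : z ^+ 2 = w ^+ 2 -> 0 < Re z -> 0 < Re w -> z = w.
Proof.
move=> /eqP; rewrite eqf_sqr => /orP[/eqP//|/eqP ->]; rewrite !ReImE => h1 h2.
by exfalso; clear -h1 h2; lra.
Qed.

Section Branches.
Variable m : R.
Hypothesis m0 : 0 < m.
Local Notation Lambda := (@Lambda R m).

(* The root of [m^2 - lam^2] analytic off the two half-lines [|lam| >= m]. *)
Definition kap (lam : C) : C := sqrtc (m%:C ^+ 2 - lam ^+ 2).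

(* [i k(lam)], the root of [m^2 - lam^2] analytic on [Lambda]. *)
Definition sLam (lam : C) : C := 'i * lam * sqrtc (1 - (m%:C / lam) ^+ 2).

Lemma kap2 lam : kap lam ^+ 2 = m%:C ^+ 2 - lam ^+ 2.
Proof. exact: sqr_sqrtc. Qed.

Lemma Lambda_neq0 lam : Lambda lam -> lam != 0.
Proof. by move=> h; apply/eqP => l0; apply: h; rewrite l0 /=; split=> //; rewrite oppr_le0 !ltW. Qed.

Lemma sLam2 lam : Lambda lam -> sLam lam ^+ 2 = m%:C ^+ 2 - lam ^+ 2.
Proof.
move=> /Lambda_neq0 l0; rewrite /sLam !exprMn sqr_i sqr_sqrtc.
by field.
Qed.

Lemma Im_Lambda lam : Im lam != 0 -> Lambda lam.
Proof. by move=> /eqP h [k _]; apply: h. Qed.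

Lemma sqrm_Re lam : Im (m%:C ^+ 2 - lam ^+ 2) = - (2 * (Re lam * Im lam)) /\
  Re (m%:C ^+ 2 - lam ^+ 2) = m ^+ 2 - Re lam ^+ 2 + Im lam ^+ 2.
Proof. by rewrite !expr2 !ReImE /=; split; ring. Qed.

(** [m^2 - lam^2] is real only on the two axes; on the imaginary axis it is at least [m^2], and on
    the real axis it is nonpositive only for [lam] at distance at least [m] from 0. *)
Lemma kap_Re_gt0 lam : Im lam != 0 \/ - m < Re lam < m -> 0 < Re (kap lam).
Proof.
move=> h; apply: sqrtc_Re_gt0; have [-> ->] := sqrm_Re lam => -[h1 h2].
have [i0|i0] := eqVneq (Im lam) 0.
  case: h => [|/andP[h3 h4]]; first by rewrite i0 eqxx.
  by move: h2; rewrite i0; clear -h3 h4; nra.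
have r0 : Re lam = 0.
  apply/eqP; have : Re lam * Im lam == 0.
    by move/eqP: h1; rewrite oppr_eq0 mulf_eq0 pnatr_eq0.
  by rewrite mulf_eq0 (negbTE i0) orbF.
by move: h2; rewrite r0 expr0n /= subr0 leNgt ltr_wpDr ?exprn_gt0 ?sqr_ge0.
Qed.

Lemma sqm_derivable lam : derivable ((fun w => m%:C ^+ 2 - w ^+ 2) : C -> C) lam 1.
Proof. exact: (@derB R (fun=> m%:C ^+ 2) (fun w => w ^+ 2) lam (der_cst _ _)
  (@derX R (fun w => w) lam 2 (der_id lam))). Qed.

Lemma kap_hol lam : - m < Re lam < m -> holomorphic_at kap lam.
Proof.
move=> /andP[h1 h2]; apply/holP; exists (Num.min (m - Re lam) (Re lam + m)).
  by rewrite lt_min; apply/andP; split; lra.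
move=> w; rewrite lt_min => /andP[k1 k2].
have k := Re_le_n1 (w - lam); rewrite !ReImE in k.
apply: (sqrt_derivable (P := fun w => m%:C ^+ 2 - w ^+ 2) kap2) => [v||].
- exact: sqrtc_Re_ge0.
- apply: kap_Re_gt0; right.
  by move: k; rewrite ler_norml => /andP[k3 k4]; apply/andP; split; clear -k1 k2 k3 k4; lra.
- exact: sqm_derivable.
Qed.

Lemma Lambda_open lam : Lambda lam -> exists2 e : R, 0 < e &
  forall w, n1 (w - lam) < e -> Lambda w.
Proof.
move=> h; have [i0|i0] := eqVneq (Im lam) 0; last first.
  exists `|Im lam|; rewrite ?normr_gt0// => w wl; apply: Im_Lambda; apply/eqP => w0.
  by have := Im_le_n1 (w - lam); rewrite !ReImE w0 add0r normrN leNgt wl.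
have [k|k] : Re lam < - m \/ m < Re lam.
  have [|k1] := ltP (Re lam) (- m); first by left.
  by have [|k2] := ltP m (Re lam); [right|exfalso; apply: h; rewrite /= k1 k2].
  exists (- m - Re lam); first by rewrite subr_gt0.
  move=> w wl [_ /andP[w1 _]]; have := Re_le_n1 (w - lam).
  by rewrite !ReImE => /(le_trans (ler_norm _)); clear -wl w1; lra.
exists (Re lam - m); first by rewrite subr_gt0.
move=> w wl [_ /andP[_ w1]]; have := Re_le_n1 (w - lam).
by rewrite !ReImE ler_norml => /andP[]; clear -wl w1; lra.
Qed.

(** If the radicand were a real [T <= 0], then [(1 - T) lam^2 = m^2] with [1 - T >= 1], which puts
    [lam] on the cut. *)
Lemma sLam_sqrt_Re lam : Lambda lam -> 0 < Re (sqrtc (1 - (m%:C / lam) ^+ 2)).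
Proof.
move=> L; have l0 := Lambda_neq0 L; apply: sqrtc_Re_gt0 => -[h1 h2]; apply: L.
set t := 1 - (m%:C / lam) ^+ 2 in h1 h2.
have e : (1 - t) * lam ^+ 2 = m%:C ^+ 2 by rewrite /t; field.
have et : t = (Re t)%:C by apply: CP => //=.
move: e; rewrite et; move: (Re t) h2 => T h2 e.
have r1 := congr1 (@Re R) e; have r2 := congr1 (@Im R) e.
move: r1 r2; rewrite !expr2 !ReImE /= => r1 r2.
have t1 : 1 <= 1 - T by rewrite lerDl oppr_ge0.
have ab : Re lam * Im lam = 0.
  have : (1 - T) * (Re lam * Im lam) == 0 by apply/eqP;  clear -r2; lra.
  by rewrite mulf_eq0 => /orP[/eqP k|/eqP//]; clear -k t1; lra.
have b0 : Im lam = 0.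
  have [//|b0] := eqVneq (Im lam) 0.
  have a0 : Re lam = 0 by apply/eqP; move/eqP: ab; rewrite mulf_eq0 (negbTE b0) orbF.
  move: r1; rewrite a0; have := sqr_ge0 (Im lam); rewrite expr2; clear -t1 m0 => ? ?; nra.
split => //; move: r1; rewrite b0 => r1.
have le : Re lam * Re lam <= m * m.
  by have := sqr_ge0 (Re lam); rewrite expr2; clear -r1 t1 => ?; nra.
by rewrite -ler_norml -(ler_pXn2r (n := 2))// ?nnegrE ?(ltW m0)// real_normK ?num_real// !expr2.
Qed.

Lemma sLam_hol lam : Lambda lam -> holomorphic_at sLam lam.
Proof.
move=> /Lambda_open[e e0 h]; apply/holP; exists e => // w /h L.
apply: (@derM R (fun w => 'i * w) (fun w => sqrtc (1 - (m%:C / w) ^+ 2))).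
  exact: (@derM R (fun=> 'i) id w (der_cst _ _) (der_id w)).
apply: (sqrt_derivable (P := fun w => 1 - (m%:C / w) ^+ 2)) => [v|v||].
- exact: sqr_sqrtc.
- exact: sqrtc_Re_ge0.
- exact: sLam_sqrt_Re.
- have d : derivable ((fun w => m%:C / w) : C -> C) w 1.
    exact: (@derM R (fun=> m%:C) (fun w => w^-1) w (der_cst _ _)
      (@derV R (fun w => w) w (der_id w) (Lambda_neq0 L))).
  exact: (@derB R (fun=> 1) (fun w => (m%:C / w) ^+ 2) w (der_cst _ _)
    (@derX R (fun w => m%:C / w) w 2 d)).
Qed.

(* With [r = sqrtc (1 - (m / lam)^2)], [2 Re r Im r = 2 m^2 Re lam Im lam / |lam|^4],
   so [Re (i lam r)] is [- Im lam] times a positive number. *)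
Lemma sLam_Re lam : Im lam != 0 -> exists2 c : R, 0 < c & Re (sLam lam) = - c * Im lam.
Proof.
move=> i0; have L := Im_Lambda i0; have l0 := Lambda_neq0 L.
have r0 := sLam_sqrt_Re L; set r := sqrtc _ in r0.
set a := Re lam; set b := Im lam; set x := Re r; set y := Im r.
have e : (r ^+ 2 - 1) * lam ^+ 2 = - m%:C ^+ 2 by rewrite sqr_sqrtc; field.
have n0 : 0 < a ^+ 2 + b ^+ 2.
  by rewrite ltr_wpDl ?sqr_ge0// lt_neqAle eq_sym sqrf_eq0 i0 sqr_ge0.
have k : x * y * (a ^+ 2 + b ^+ 2) ^+ 2 = m ^+ 2 * (a * b).
  rewrite /x /y; clear x y; clearbody r.
  have r1 := congr1 (@Re R) e; have r2 := congr1 (@Im R) e.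
  move: r1 r2; rewrite !expr2 !ReImE /= -/a -/b => r1 r2.
  have k1 := congr1 (fun v => (a * a - b * b) * v) r2.
  have k2 := congr1 (fun v => (a * b) * v) r1.
  by move: k1 k2; clear; lra.
have N0 : 0 < (a ^+ 2 + b ^+ 2) ^+ 2 * x by rewrite mulr_gt0// exprn_gt0.
exists (x + m ^+ 2 * a ^+ 2 / ((a ^+ 2 + b ^+ 2) ^+ 2 * x)).
  exact: (ltr_pwDl r0 (divr_ge0 (mulr_ge0 (sqr_ge0 _) (sqr_ge0 _)) (ltW N0))).
have -> : Re (sLam lam) = - (x * b + a * y).
  by rewrite /sLam -/r !ReImE /= -/a -/b -/x -/y; ring.
have -> : y = m ^+ 2 * (a * b) / ((a ^+ 2 + b ^+ 2) ^+ 2 * x).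
  by rewrite -k; field; rewrite !gt_eqF.
by field; rewrite !gt_eqF.
Qed.

(** Two roots of one number with real parts of the same sign coincide. This is where the sheets
    receive their signs: [sLam] is analytic on [Lambda], [kap] across the gap. *)
Lemma sLam_up lam : 0 < Im lam -> sLam lam = - kap lam.
Proof.
move=> i0; have i1 : Im lam != 0 by rewrite gt_eqF.
apply: oppr_inj; rewrite opprK; apply: eq_sqr_Re.
- by rewrite sqrrN kap2 sLam2//; exact: Im_Lambda.
- by rewrite ReN; have [c c0 ->] := sLam_Re i1; rewrite mulNr opprK mulr_gt0.
- by apply: kap_Re_gt0; left.
Qed.

Lemma sLam_down lam : Im lam < 0 -> sLam lam = kap lam.
Proof.
move=> i0; have i1 : Im lam != 0 by rewrite lt_eqF.
apply: eq_sqr_Re.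
- by rewrite kap2 sLam2//; exact: Im_Lambda.
- by have [c c0 ->] := sLam_Re i1; rewrite mulNr -mulrN mulr_gt0// oppr_gt0.
- by apply: kap_Re_gt0; left.
Qed.

End Branches.
End SquareRoot.

(** * Poles of the continued resolvent *)

Section PoleOrder.
Context {R : realType}.
Local Notation C := (Cplx R).
Implicit Types (f g A B N D d : C -> C) (z w v : C).

Lemma near_point z (e : R) : 0 < e -> exists2 w, w != z & n1 (w - z) < e.
Proof.
move=> e0; exists (z + (e / 2)%:C).
  rewrite -subr_eq0 addrC addKr; apply/eqP => /(congr1 (@Re R)) /= k.
  by clear -e0 k; lra.
by rewrite addrC addKr n1_real ger0_norm; clear -e0; lra.
Qed.

Lemma mzero_congr f g z (e : R) : 0 < e -> (forall w, n1 (w - z) < e -> f w = g w) ->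
  mzero f z -> mzero g z.
Proof.
move=> e0 fg /mzeroP[t t0 h]; apply/mzeroP; exists (Num.min e t); rewrite ?lt_min ?e0//.
by move=> w wz; rewrite lt_min => /andP[/fg <- /(h w wz)].
Qed.

Lemma has_pole_congr f g z n : mzero (fun w => f w - g w) z -> has_pole f z n ->
  has_pole g z n.
Proof.
move=> /mzeroP[t t0 h] [n0 [k [hk k0 /dnearC[e e0 he]]]]; split => //.
exists k; split => //; apply/dnearC; exists (Num.min e t); rewrite ?lt_min ?e0//.
move=> w wz; rewrite lt_min => /andP[/(he w wz) <- /(h w wz)/eqP].
by rewrite subr_eq0 => /eqP.
Qed.

Lemma quo_near A B N D d z n : holomorphic_at d z -> d z != 0 ->
  (exists2 e : R, 0 < e & forall w, n1 (w - z) < e -> D w = (w - z) ^+ n * d w) ->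
  exists2 e : R, 0 < e & forall w, w != z -> n1 (w - z) < e ->
    A w - B w * N w / D w =
    (A w * (w - z) ^+ n - B w * N w * (d w)^-1) / (w - z) ^+ n.
Proof.
move=> hd d0 [e e0 he]; have [t t0 ht] := near_ne0 (hol_cont hd) d0.
exists (Num.min e t); rewrite ?lt_min ?e0// => w wz.
rewrite lt_min => /andP[/he -> /ht dw]; field.
by rewrite dw expf_neq0// subr_eq0.
Qed.

Lemma quo_num_hol A B N d z n : holomorphic_at A z -> holomorphic_at B z ->
  holomorphic_at N z -> holomorphic_at d z -> d z != 0 ->
  holomorphic_at (fun w => A w * (w - z) ^+ n - B w * N w * (d w)^-1) z.
Proof.
by move=> hA hB hN hd d0; exact: (holB (holM hA (holXB n z)) (holM (holM hB hN) (holV hd d0))).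
Qed.

(** If [k > n], comparing the two representations gives [g = h (w - z)^(k - n)] off [z], which
    contradicts [g z != 0] by continuity. *)
Lemma quo_pole_le A B N D d z n k : holomorphic_at A z -> holomorphic_at B z ->
  holomorphic_at N z -> holomorphic_at d z -> d z != 0 ->
  (exists2 e : R, 0 < e & forall w, n1 (w - z) < e -> D w = (w - z) ^+ n * d w) ->
  has_pole (fun w => A w - B w * N w / D w) z k -> (k <= n)%N.
Proof.
move=> hA hB hN hd d0 hD [k0 [g [hg g0 /dnearC[t t0 ht]]]].
rewrite leqNgt; apply/negP => nk.
have [e e0 he] := quo_near A B N hd d0 hD.
have hq := quo_num_hol n hA hB hN hd d0.
set h := (fun w => A w * (w - z) ^+ n - B w * N w * (d w)^-1) in hq.
have hu := holB hg (holM hq (holXB (k - n) z)).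
have [|r r0 hr] := near_ne0 (hol_cont hu).
  by rewrite subrr expr0n subn_eq0 leqNgt nk mulr0 subr0.
have [w wz] := near_point z (e := Num.min r (Num.min e t)) ltac:(by rewrite !lt_min r0 e0).
rewrite !lt_min => /and3P[/hr/eqP nw we wt]; apply: nw.
have := he w wz we; rewrite (ht w wz wt) -/(h w).
have -> : (w - z) ^+ k = (w - z) ^+ n * (w - z) ^+ (k - n) by rewrite -exprD subnKC// ltnW.
have p i : (w - z) ^+ i != 0 by rewrite expf_neq0// subr_eq0.
have pn := p n; have pk := p (k - n)%N.
move=> /(congr1 (fun x => x * ((w - z) ^+ n * (w - z) ^+ (k - n)))).
rewrite divfK ?mulf_neq0// => ->; field.
by rewrite pn.
Qed.

(** For [n > 0] the term with [A] drops out at [z], and the numerator there is [- B N / d], which is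
    nonzero. *)
Lemma quo_has_pole A B N D d z n : holomorphic_at A z -> holomorphic_at B z ->
  holomorphic_at N z -> holomorphic_at d z -> d z != 0 ->
  (exists2 e : R, 0 < e & forall w, n1 (w - z) < e -> D w = (w - z) ^+ n * d w) ->
  (0 < n)%N -> B z != 0 -> N z != 0 ->
  has_pole (fun w => A w - B w * N w / D w) z n.
Proof.
move=> hA hB hN hd d0 hD n0 B0 N0; split => //.
exists (fun w => A w * (w - z) ^+ n - B w * N w * (d w)^-1); split.
- exact: quo_num_hol.
- by rewrite subrr expr0n eqn0Ngt n0 mulr0 sub0r oppr_eq0 !mulf_neq0// invr_eq0.
- by apply/dnearC; exact: quo_near.
Qed.

End PoleOrder.

(** * The continued resolvent and its denominator *)

Section States.
Context {R : realType}.
Local Notation C := (Cplx R).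
Local Notation mu := (@lebesgue_measure R).
Implicit Types (h g k : R -> C * C) (z w v lam : C) (x b : R) (sh : sheet).
Variables (m gamma : R) (p1 p2 q : R -> R).
Hypotheses (p1i : locint p1) (p2i : locint p2) (qi : locint q).
Hypotheses (m0 : 0 < m) (gamma0 : 0 < gamma).
Hypothesis V0 : {ae mu, forall x, gamma <= x -> [/\ p1 x = 0, p2 x = 0 & q x = 0]}.
Local Notation phi := (phi m p1 p2 q).
Local Notation chi := (chi m p1 p2 q).
Local Notation Lambda := (@Lambda R m).

Lemma bform_sol_hol (s : C -> C) (c : C * C) g b z : holomorphic_at s z -> lbm g -> 0 <= b ->
  holomorphic_at (fun w => bform w (s w) m (sol m p1 p2 q w c g) b) z.
Proof.
move=> hs hg b0.
have h1 : holomorphic_at (fun w => (sol m p1 p2 q w c g b).1) z.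
  by apply: hol_all => w; exact: sol_derivable1.
have h2 : holomorphic_at (fun w => (sol m p1 p2 q w c g b).2) z.
  by apply: hol_all => w; exact: sol_derivable2.
have h3 : holomorphic_at (fun w => w + m%:C) z.
  by apply: hol_all => w; exact: (derD (der_id w) (der_cst m%:C w)).
exact: (holB (holM h1 hs) (holM h2 h3)).
Qed.

(** These are the pieces of [G_formula] with the root [s] left free: [sLam] gives the continuation
    on [Lambda], and the rim roots give its germs across the gap. *)
Definition dsc (s : C -> C) b w : C := bform w (s w) m (phi w) b.
Definition Ach h b w : C := integralC `[0, b]%classic (dotp (chi h w) (cc h)).
Definition Bph h b w : C := integralC `[0, b]%classic (dotp (phi w) (cc h)).
Definition Nch (s : C -> C) h b w : C := bform w (s w) m (chi h w) b.
Definition green s h b w : C := Ach h b w - Bph h b w * Nch s h b w / dsc s b w.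

Lemma dsc_hol s b z : holomorphic_at s z -> 0 <= b -> holomorphic_at (dsc s b) z.
Proof. by move=> hs b0; exact: (bform_sol_hol (0, 1) hs (@gz_lbm R) b0). Qed.

Lemma Nch_hol s h b z : holomorphic_at s z -> lbm h -> 0 <= b ->
  holomorphic_at (Nch s h b) z.
Proof. by move=> hs hh b0; exact: (bform_sol_hol 0 hs hh b0). Qed.

Lemma Ach_hol h b z : lbm h -> 0 <= b -> holomorphic_at (Ach h b) z.
Proof.
move=> hh b0; apply: hol_all => w.
exact: sol_derivable_int hh b0 (lbm_cc hh b0).
Qed.

Lemma Bph_hol h b z : lbm h -> 0 <= b -> holomorphic_at (Bph h b) z.
Proof.
move=> hh b0; apply: hol_all => w.
exact: sol_derivable_int (@gz_lbm R) b0 (lbm_cc hh b0).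
Qed.

Lemma green_mer s h b z : holomorphic_at s z -> lbm h -> 0 <= b ->
  ~ mzero (dsc s b) z -> meromorphic_at (green s h b) z.
Proof.
move=> hs hh b0 nz; apply: (merB (hol_mer (Ach_hol z hh b0))).
exact: (mer_quot (holM (Bph_hol z hh b0) (Nch_hol hs hh b0)) (dsc_hol hs b0) nz).
Qed.

(** Segments from nonreal points to [m + 1] stay in [Lambda], since they meet the real axis only at
    that end. Continuation through this point joins the two half-planes. *)
Lemma mzero_half (F : C -> C) z w : (forall v, Lambda v -> meromorphic_at F v) ->
  Im z != 0 -> Im w != 0 -> mzero F z -> mzero F w.
Proof.
move=> hF.
have hL v (t : R) : Im v != 0 -> 0 <= t <= 1 ->
    Lambda (v + t%:C * ((m + 1)%:C - v)).
  move=> /eqP v0 /andP[t0 t1]; rewrite /Defs.Lambda /= !ReImE /= => -[h1 /andP[_ h2]].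
  have [t1'|t1'] := eqVneq t 1.
    by move: h2; rewrite t1'; lra.
  have : (1 - t) * Im v == 0 by apply/eqP; lra.
  by rewrite mulf_eq0 => /orP[/eqP k|/eqP//]; move: t1'; rewrite -subr_eq0 -oppr_eq0 opprB k eqxx.
move=> z0 w0 hz.
have h1 : mzero F (m + 1)%:C.
  by apply: mzero_segment hz => t ht; apply: hF; exact: hL.
apply: mzero_segment h1 => t /andP[t0 t1]; apply: hF.
have -> : (m + 1)%:C + t%:C * (w - (m + 1)%:C) = w + (1 - t)%:C * ((m + 1)%:C - w).
  by rewrite rmorphB rmorph1; ring.
by apply: hL => //; apply/andP; split; lra.
Qed.

Lemma dsc_up b lam : gamma <= b -> 0 < Im lam -> dsc (sLam m) b lam != 0.
Proof.
move=> gb l0; have L : Lambda lam by apply: Im_Lambda; rewrite gt_eqF.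
apply: (bform_phi_neq0 p1i p2i qi (ltW gamma0) V0 l0) => //; first exact: sLam2.
by rewrite sLam_up// ReN oppr_lt0; apply: kap_Re_gt0 => //; left; rewrite gt_eqF.
Qed.

(** A vanishing germ would propagate to ['i], but in the upper half-plane [dsc_up] excludes every
    zero. *)
Lemma dsc_nz b z : gamma <= b -> Im z != 0 -> ~ mzero (dsc (sLam m) b) z.
Proof.
move=> gb z0 hz; have b0 : 0 <= b by rewrite (le_trans (ltW gamma0)).
have h : mzero (dsc (sLam m) b) 'i.
  apply: mzero_half z0 _ hz; last by rewrite /= oner_eq0.
  by move=> v hv; apply: hol_mer; apply: dsc_hol => //; exact: sLam_hol.
have [e e0 he] := (mzeroP _ _).1 h.
have [w wi] := near_point 'i (e := Num.min e 1) ltac:(by rewrite lt_min e0 ltr01).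
rewrite lt_min => /andP[we w1]; have k := dsc_up (b := b) (lam := w) gb.
have : ~~ (0 < Im w) by apply/negP => /k; rewrite (he w wi we) eqxx.
rewrite -leNgt => k1; have := Im_le_n1 (w - 'i); rewrite !ReImE /=.
by rewrite ler_norml => /andP[]; lra.
Qed.

Lemma dsc_nz_all b z : gamma <= b -> ~ mzero (dsc (sLam m) b) z.
Proof.
move=> gb /mzero_open[e e0 he].
have h (t : R) : `|t| < e -> mzero (dsc (sLam m) b) (Re z +i* (Im z + t)).
  move=> te; apply: he; have -> : (Re z +i* (Im z + t)) - z = 0 +i* t :> C.
    by apply: CP; rewrite !ReImE /=; ring.
  by rewrite /n1 /= normr0 add0r.
have [i0|i0] := eqVneq (Im z) 0.
  apply: (@dsc_nz b (Re z +i* (Im z + e / 2)) gb); first by rewrite /= i0 add0r gt_eqF// divr_gt0.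
  by apply: h; rewrite ger0_norm; lra.
apply: (@dsc_nz b (Re z +i* (Im z + 0)) gb); first by rewrite /= addr0.
by apply: h; rewrite normr0.
Qed.

End States.

(** * Germs at the rims and uniqueness of the continuation *)

Section Germs.
Context {R : realType}.
Local Notation C := (Cplx R).
Local Notation mu := (@lebesgue_measure R).
Implicit Types (h g : R -> C * C) (z w v lam : C) (x b : R) (sh : sheet).
Variables (m gamma : R) (p1 p2 q : R -> R).
Hypotheses (p1i : locint p1) (p2i : locint p2) (qi : locint q).
Hypotheses (m0 : 0 < m) (gamma0 : 0 < gamma).
Hypothesis V0 : {ae mu, forall x, gamma <= x -> [/\ p1 x = 0, p2 x = 0 & q x = 0]}.
Local Notation phi := (phi m p1 p2 q).
Local Notation chi := (chi m p1 p2 q).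
Local Notation Lambda := (@Lambda R m).
Local Notation Dsc := (dsc m p1 p2 q).
Local Notation Green := (green m p1 p2 q).

(** The extension across the gap of [sLam] restricted to the half-plane of the sheet. *)
Definition rim_root sh lam : C :=
  match sh with physical => - kap m lam | nonphysical => kap m lam end.

Lemma rim_root2 sh lam : rim_root sh lam ^+ 2 = m%:C ^+ 2 - lam ^+ 2.
Proof. by case: sh; rewrite /= ?sqrrN kap2. Qed.

Lemma half_Im sh v : half_plane sh v -> Im v != 0.
Proof. by case: sh => /= h; [rewrite gt_eqF|rewrite lt_eqF]. Qed.

Lemma rim_root_half sh v : half_plane sh v -> sLam m v = rim_root sh v.
Proof. by case: sh => /= h; [exact: sLam_up|exact: sLam_down]. Qed.

Lemma half_open sh v : half_plane sh v -> exists2 e : R, 0 < e &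
  forall w, n1 (w - v) < e -> half_plane sh w.
Proof.
move=> h; exists `|Im v|; first by rewrite normr_gt0 (half_Im h).
move=> w wv; have := le_lt_trans (Im_le_n1 (w - v)) wv; rewrite !ReImE ltr_norml => /andP[].
case: sh h => /= h; first by rewrite ger0_norm ?ltW// => k1 k2; lra.
by rewrite ler0_norm ?ltW// => k1 k2; lra.
Qed.

Lemma half_near sh x (e : R) : 0 < e -> exists2 v, half_plane sh v & n1 (v - x%:C) < e.
Proof.
move=> e0; have h (t : R) : n1 ((x +i* t) - x%:C : C) = `|t|.
  by rewrite /n1 !ReImE /= subrr normr0 add0r subr0.
case: sh; [exists (x +i* (e / 2))|exists (x +i* (- (e / 2)))];
  rewrite ?h ?normrN ?ger0_norm /=; lra.
Qed.

Lemma rim_root_hol sh x : in_gap m x -> holomorphic_at (rim_root sh) x%:C.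
Proof.
move=> hx; have h : holomorphic_at (kap m) x%:C by apply: kap_hol.
by case: sh; [exact: (filterS (fun w => @derN R (kap m) w) h)|exact: h].
Qed.

Lemma rim_root_neq0 sh x : in_gap m x -> rim_root sh x%:C != 0.
Proof.
move=> hx; have h : 0 < Re (kap m x%:C) by apply: kap_Re_gt0 => //; right.
have k : kap m x%:C != 0 by apply/eqP => k; move: h; rewrite k ltxx.
by case: sh; rewrite /= ?oppr_eq0.
Qed.

Lemma dsc_rim_nz sh b x : gamma <= b -> ~ mzero (Dsc (rim_root sh) b) x%:C.
Proof.
move=> gb /mzero_open[e e0 he]; have [v hv vx] := half_near sh x e0.
have [t t0 ht] := half_open hv.
apply: (dsc_nz p1i p2i qi m0 gamma0 V0 gb (half_Im hv)).
apply: mzero_congr t0 _ (he v vx) => w /ht /rim_root_half e1.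
by rewrite /dsc e1.
Qed.

(** In the upper half-plane [sLam] has negative real part, so [G_formula] applies there with this
    root; elsewhere only meromorphy is required. *)
Lemma green_cont h b : C0 h -> gamma <= b -> (forall y, b <= y -> h y = 0) ->
  continuation m p1 p2 q h (Green (sLam m) h b).
Proof.
move=> hC gb hb; have b0 : 0 <= b by rewrite (le_trans (ltW gamma0)).
split=> z hz.
  apply: green_mer => //; [exact: sLam_hol|exact: C0_lbm|].
  exact: (dsc_nz_all p1i p2i qi m0 gamma0 V0 gb).
have L : Lambda z by apply: Im_Lambda; rewrite gt_eqF.
rewrite (G_formula p1i p2i qi (ltW gamma0) V0 hC gb hb hz (sLam2 m0 L))//.
by rewrite sLam_up// ReN oppr_lt0; apply: kap_Re_gt0 => //; left; rewrite gt_eqF.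
Qed.

(** Any continuation has the explicit germ at ['i], hence at every nonreal point by [mzero_half]. So
    [Phi] agrees with the explicit germ at points of the half-plane arbitrarily close to [x], and
    [mzero_closed] carries the agreement to [x] itself. *)
Lemma pole_green sh h b x n : in_gap m x -> C0 h -> gamma <= b ->
  (forall y, b <= y -> h y = 0) ->
  pole m p1 p2 q sh h x%:C n <-> has_pole (Green (rim_root sh) h b) x%:C n.
Proof.
move=> hx hC gb hb; have b0 : 0 <= b by rewrite (le_trans (ltW gamma0)).
have [hm hG] := green_cont hC gb hb; split; last first.
  move=> hp; exists (Green (sLam m) h b), (Green (rim_root sh) h b); split=> //.
  by apply/nearC; exists 1 => // w _ /rim_root_half e; rewrite /green /dsc /Nch e.
move=> [F [Phi [[Fm FG] /nearC[e e0 he] hp]]]; apply: has_pole_congr (hp).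
have mP : meromorphic_at Phi x%:C by case: hp => _ [g [g1 _ g2]]; exists n, g.
have mg : meromorphic_at (Green (rim_root sh) h b) x%:C.
  apply: green_mer => //; [exact: rim_root_hol|exact: C0_lbm|exact: dsc_rim_nz].
apply: (mzero_closed (merB mP mg)) => r r0.
have [v hv vx] := half_near sh x (e := Num.min (e / 2) r) ltac:(by rewrite lt_min r0 divr_gt0).
move: vx; rewrite lt_min => /andP[ve vr]; exists v => //.
have [t t0 ht] := half_open hv.
have : mzero (fun w => F w - Green (sLam m) h b w) v.
  apply: (mzero_half (F := fun w => F w - Green (sLam m) h b w) (z := 'i) (m := m)) => [u hu|||].
  - exact: (merB (Fm u hu) (hm u hu)).
  - by rewrite /= oner_eq0.
  - exact: half_Im hv.
  - apply/mzeroP; exists 1 => // w wi w1; rewrite FG ?hG ?subrr//;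
    have := Im_le_n1 (w - 'i); rewrite !ReImE /= => /le_lt_trans/(_ w1);
    by rewrite ltr_norml => /andP[] ? ?; lra.
have tt : 0 < Num.min t (e / 2) by rewrite lt_min t0 divr_gt0.
apply: (mzero_congr tt) => w; rewrite lt_min => /andP[/ht hw wv].
rewrite he //; last first.
  have -> : w - x%:C = (w - v) + (v - x%:C) by ring.
  by apply: (le_lt_trans (n1D _ _)); lra.
by rewrite /green /dsc /Nch (rim_root_half hw).
Qed.

Lemma dsc_efac sh b w : gamma <= b ->
  Dsc (rim_root sh) b w * efac m w (- rim_root sh w) b =
  Dsc (rim_root sh) gamma w * efac m w (- rim_root sh w) gamma.
Proof.
move=> gb; have [hp _] := phiP m p1i p2i qi w.
exact: (bform_efac (ltW gamma0) V0 (rim_root2 sh w) hp (lexx gamma)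
  (fun _ _ => erefl) gb).
Qed.

Lemma efac_hol sh x b : in_gap m x -> 0 <= b ->
  holomorphic_at (fun w => efac m w (- rim_root sh w) b) x%:C.
Proof.
move=> hx b0; have hs : holomorphic_at (fun w => - rim_root sh w) x%:C.
  exact: (filterS (fun w => @derN R (rim_root sh) w) (rim_root_hol sh hx)).
have z := @zero_locint R.
exact: (bform_sol_hol (s := fun w => - rim_root sh w) m z z z (1, 0) hs (@gz_lbm R) b0).
Qed.

(** The order of the zero at [x], with [n = 0] when there is none. It is measured at [gamma];
    [dsc_order_after] moves it to any later [b]. *)
Definition dsc_order sh x n (d : C -> C) :=
  [/\ holomorphic_at d x%:C, d x%:C != 0 & exists2 e : R, 0 < e &
    forall w, n1 (w - x%:C) < e -> Dsc (rim_root sh) gamma w = (w - x%:C) ^+ n * d w].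

Lemma dsc_order_exists sh x : in_gap m x -> exists n d, dsc_order sh x n d.
Proof.
move=> hx.
have := hol_order (dsc_hol m p1i p2i qi (rim_root_hol sh hx) (ltW gamma0)).
move=> [[e e0 he]|//]; exfalso; apply: (dsc_rim_nz (sh := sh) (x := x) (lexx gamma)).
by apply/mzeroP; exists e => // w _; exact: he.
Qed.

(** By [dsc_efac] the denominators at [b] and at [gamma] differ by a quotient of nonvanishing
    holomorphic factors. Hence the order is the same for all [h], whatever their support. *)
Lemma dsc_order_after sh x n d b : in_gap m x -> gamma <= b -> dsc_order sh x n d ->
  exists d', [/\ holomorphic_at d' x%:C, d' x%:C != 0 & exists2 e : R, 0 < e &
    forall w, n1 (w - x%:C) < e -> Dsc (rim_root sh) b w = (w - x%:C) ^+ n * d' w].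
Proof.
move=> hx gb [hd d0 [e e0 he]]; have b0 : 0 <= b by rewrite (le_trans (ltW gamma0)).
have hs2 : (- rim_root sh x%:C) ^+ 2 = m%:C ^+ 2 - x%:C ^+ 2.
  by rewrite sqrrN rim_root2.
have hs0 : - rim_root sh x%:C != 0 by rewrite oppr_eq0 rim_root_neq0.
have hE := efac_hol sh hx b0; have hEg := efac_hol sh hx (ltW gamma0).
have E0 := efac_neq0 hs2 hs0 b0; have Eg0 := efac_neq0 hs2 hs0 (ltW gamma0).
have [t t0 ht] := near_ne0 (hol_cont hE) E0.
exists (fun w => d w * efac m w (- rim_root sh w) gamma * (efac m w (- rim_root sh w) b)^-1).
split.
- exact: (holM (holM hd hEg) (holV hE E0)).
- by rewrite !mulf_neq0// invr_eq0.
- exists (Num.min e t); rewrite ?lt_min ?e0// => w; rewrite lt_min => /andP[/he we /ht wt].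
  by rewrite !mulrA -we -(dsc_efac _ _ gb) mulfK.
Qed.

Lemma C0_bound h : C0 h -> exists2 b, gamma <= b & forall y, b <= y -> h y = 0.
Proof.
move=> [_ [b hb]]; exists (Num.max gamma b); first by rewrite le_max lexx.
by move=> y; rewrite ge_max => /andP[_]; exact: hb.
Qed.

Lemma pole_le sh x n d h k : in_gap m x -> dsc_order sh x n d -> C0 h ->
  pole m p1 p2 q sh h x%:C k -> (k <= n)%N.
Proof.
move=> hx hd hC; have [b gb hb] := C0_bound hC.
have b0 : 0 <= b by rewrite (le_trans (ltW gamma0)).
move=> /(pole_green sh k hx hC gb hb).
have [d' [hd' d0' hD]] := dsc_order_after hx gb hd.
have hl := C0_lbm hC.
exact: (quo_pole_le (Ach_hol m p1i p2i qi _ hl b0) (Bph_hol m p1i p2i qi _ hl b0)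
  (Nch_hol m p1i p2i qi (rim_root_hol sh hx) hl b0) hd' d0' hD).
Qed.

Lemma phi_real x y : 0 <= y -> cc (phi x%:C) y = phi x%:C y.
Proof.
move=> y0; have [hp p0] := phiP m p1i p2i qi x%:C.
have := dsol_cc hp; rewrite cjR => hc.
have hz : cc (fun=> 0) = (fun=> 0) :> (R -> C * C).
  by apply/funext => t; rewrite /cc /= cj0.
rewrite hz in hc; apply: (dsol_unique p1i p2i qi hc hp) => //.
by rewrite /cc p0 /= cj0 (cjR 1).
Qed.

(** The Wronskian with the solution of data [(1, 0)] is constant and equals 1 at the origin. *)
Lemma phi_neq0 lam b : 0 <= b -> phi lam b != 0.
Proof.
move=> b0; apply/eqP => z; have [hp p0] := phiP m p1i p2i qi lam.
have [ht t0] := solP m p1i p2i qi lam (1, 0) (@gz_lbm R).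
have [_] := lagrange ht hp b0.
rewrite /wron z p0 t0 /= !(mulr0, mul0r, mulr1, subr0).
under [integralC _ _]eq_integralC => t _.
  rewrite subrr mul0r add0r /dotp /= !mul0r !mulr0 addr0 subr0; over.
by rewrite integralC0 addr0 => /eqP; rewrite eq_sym oner_eq0.
Qed.

End Germs.

(** * Test functions that attain the full pole order *)

Section TestFunction.
Context {R : realType}.
Local Notation C := (Cplx R).
Local Notation mu := (@lebesgue_measure R).
Implicit Types (h g : R -> C * C) (x b : R) (sh : sheet).

Lemma halfline_within (f : R -> R) :
  (forall b, 0 <= b -> {within `[0, b], continuous f}) -> {within halfline, continuous f}.
Proof.
move=> h; apply/subspace_continuousP => x hx.
have x0 : 0 <= x by move: hx; rewrite /halfline /= in_itv/= andbT.
have := h (x + 1); rewrite addr_ge0// => /(_ isT)/subspace_continuousP/(_ x).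
rewrite /= in_itv/= x0 lerDl ler01 => /(_ isT) c A /c.
rewrite /nbhs /= /within /= => hA.
have n1 : \forall y \near x, y < x + 1 by apply: lt_nbhsl; rewrite ltrDl.
near=> y; rewrite /halfline /= in_itv/= andbT => y0.
have yx : y < x + 1 by near: y.
have : y \in `[0, x + 1] -> A (f y) by near: y.
by apply; rewrite in_itv/= y0 ltW.
Unshelve. all: by end_near. Qed.

Lemma within_CC (A : set R) h :
  {within A, continuous (fun x => Re (h x).1)} -> {within A, continuous (fun x => Im (h x).1)} ->
  {within A, continuous (fun x => Re (h x).2)} -> {within A, continuous (fun x => Im (h x).2)} ->
  {within A, continuous h}.
Proof.
have C1 (f : R -> C) : {within A, continuous (fun x => Re (f x))} ->
    {within A, continuous (fun x => Im (f x))} -> {within A, continuous f}.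
  move=> hr hi x B /nearC[e e0 hB].
  have e20 : 0 < e / 2 by rewrite divr_gt0.
  have /cvgrPdist_lt/(_ _ e20) h1 := hr x; have /cvgrPdist_lt/(_ _ e20) h2 := hi x.
  apply: filterS2 h1 h2 => y h1 h2; apply: hB; rewrite n1_dist /n1 !ReImE; lra.
move=> h1 h2 h3 h4 x.
have -> : h = (fun y => ((h y).1, (h y).2)) by apply/funext => y; rewrite -surjective_pairing.
exact: (cvg_pair (C1 _ h1 h2 x) (C1 _ h3 h4 x)).
Qed.

Lemma AC_halfline (U u : R -> C) : AC_deriv U u ->
  {within halfline, continuous (fun x => Re (U x))} /\
  {within halfline, continuous (fun x => Im (U x))}.
Proof.
by move=> h; split; apply: halfline_within => b b0; have [] := AC_continuous b0 h.
Qed.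

Lemma AC_linear (gamma : R) : AC_deriv (fun t => (gamma - t)%:C : C) (fun=> -1).
Proof.
have i b : 0 <= b -> integrableC `[0, b]%classic (fun=> -1 : C).
  by move=> _; apply: bm_integrable; exact: bm_cst.
have h := AC_prim gamma%:C i.
apply: eq_AC h => // x x0; rewrite integralC_cst// rmorphB /=; ring.
Qed.

(** An abrupt cut at [gamma] would in general break continuity; the linear factor preserves it and
    is positive before [gamma], which makes the integral in [test_pole] positive. *)
Definition cutoff (gamma : R) (u : R -> C * C) (t : R) : C * C :=
  ((Num.max 0 (gamma - t))%:C * (u t).1, (Num.max 0 (gamma - t))%:C * (u t).2).

Lemma cutoff_C0 gamma m p1 p2 q lam u : dsol m p1 p2 q lam (fun=> 0) u ->
  C0 (cutoff gamma u).
Proof.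
move=> [/AC_halfline[h1 h2] /AC_halfline[h3 h4]]; split; last first.
  exists gamma => y gy; rewrite /cutoff (max_idPl _) ?subr_le0//.
  by rewrite (_ : (0 : R)%:C = 0 :> C)// !mul0r.
have hr : {within halfline, continuous (fun t : R => Num.max 0 (gamma - t))}.
  apply: continuous_subspaceT => t; apply/cvgrPdist_lt => e e0.
  apply: filterS (nbhsx_ballx t e e0) => y; rewrite /ball /= !ltr_norml => /andP[k1 k2].
  by have [|] := leP 0 (gamma - t); have [|] := leP 0 (gamma - y) => k3 k4;
    apply/andP; split; lra.
by apply: within_CC => x; rewrite /cutoff /=;
  under eq_fun do rewrite !ReImE /= mul0r ?subr0 ?addr0;
  apply: cvgM (hr x) _; [exact: h1|exact: h2|exact: h3|exact: h4].
Qed.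

Section State.
Variables (m gamma : R) (p1 p2 q : R -> R).
Hypotheses (p1i : locint p1) (p2i : locint p2) (qi : locint q).
Hypotheses (m0 : 0 < m) (gamma0 : 0 < gamma).
Hypothesis V0 : {ae mu, forall x, gamma <= x -> [/\ p1 x = 0, p2 x = 0 & q x = 0]}.
Local Notation phi := (phi m p1 p2 q).
Local Notation chi := (chi m p1 p2 q).
Local Notation Dsc := (dsc m p1 p2 q).
Local Notation dsc_order := (dsc_order m gamma p1 p2 q).

(* With [h = (gamma - t) phi], both [int phi . conj h] and the Wronskian of [chi]
   and [phi] at [gamma] equal [int (gamma - t) |phi|^2]. *)
Lemma test_pole sh x n d : in_gap m x -> dsc_order sh x n d -> (0 < n)%N ->
  exists h, [/\ C0 h, nonzero h & pole m p1 p2 q sh h x%:C n].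
Proof.
move=> hx [hd d0 hD] n0; have g0 := ltW gamma0.
have [hp ph0] := phiP m p1i p2i qi x%:C.
pose h := cutoff gamma (phi x%:C); exists h.
have hC : C0 h := cutoff_C0 gamma hp.
have hl := C0_lbm hC; have [hc ch0] := chiP m p1i p2i qi x%:C hl.
pose E t := (gamma - t)%:C * dotp (phi x%:C) (cc (phi x%:C)) t.
pose I := integralC `[0, gamma]%classic E.
have I0 : I != 0.
  have [e he] := dotp_AC hp (dsol_cc hp).
  have k : 0 < \int[mu]_(t in `[0, gamma]) Re (E t).
    apply: (AC_pos (AC_mul (AC_linear gamma) he) (lexx 0) gamma0).
      move=> t /andP[t0 tg]; rewrite dotp_cc !ReImE /= mul0r subr0.
      by rewrite mulr_ge0 ?subr_ge0// addr_ge0// sqn_ge0.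
    rewrite dotp_cc ph0 !ReImE /= mul0r subr0 subr0 mulr_gt0// /sqn /=.
    by rewrite !expr0n /= expr1n; lra.
  by apply/eqP => /(congr1 (@Re R)) /= e0; move: k; rewrite e0 ltxx.
have mx t : t <= gamma -> Num.max 0 (gamma - t) = gamma - t.
  by move=> tg; apply/max_idPr; rewrite subr_ge0.
have hB : Bph m p1 p2 q h gamma x%:C = I.
  apply: eq_integralC => t /=; rewrite in_itv/= => /andP[t0 tg].
  by rewrite /E /dotp /cc /h /cutoff /= mx// !cjM !cjR; ring.
have hW : wron (chi h x%:C) (phi x%:C) gamma = I.
  have [_ ->] := lagrange hc hp g0; rewrite /wron ch0 /= !mul0r subr0 add0r.
  apply: eq_integralC => t /=; rewrite in_itv/= => /andP[t0 tg].
  rewrite subrr mul0r add0r /E /dotp /cc /h /cutoff /= mx//.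
  have [-> ->] : cj (phi x%:C t).1 = (phi x%:C t).1 /\ cj (phi x%:C t).2 = (phi x%:C t).2.
    by move: (phi_real m p1i p2i qi x t0); rewrite /cc; case: (phi x%:C t) => f1 f2 [-> ->].
  by ring.
have D0 : Dsc (rim_root m sh) gamma x%:C = 0.
  case: hD => e e0 he; rewrite he ?subrr ?n1_0//.
  by rewrite expr0n eqn0Ngt n0 mul0r.
(* If the form annihilated both [phi] and [chi] at [gamma], these vectors would be parallel and
   their Wronskian [I] would vanish; here [x + m] is nonzero in the gap. *)
have N0 : Nch m p1 p2 q (rim_root m sh) h gamma x%:C != 0.
  apply/eqP => N0; have : (x%:C + m%:C) * I = 0.
    rewrite -hW /wron; move: D0 N0; rewrite /dsc /Nch /bform.
    move: (phi x%:C gamma) (chi h x%:C gamma) (rim_root m sh x%:C) => [f1 f2] [c1 c2] s /=.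
    move=> /subr0_eq D0 /subr0_eq N0.
    have -> : (x%:C + m%:C) * (c1 * f2 - c2 * f1) =
      c1 * (f2 * (x%:C + m%:C)) - f1 * (c2 * (x%:C + m%:C)) by ring.
    by rewrite -D0 -N0; ring.
  move/eqP; rewrite mulf_eq0 (negbTE I0) orbF -rmorphD /= => /eqP/(congr1 (@Re R)) /=.
  by move: hx => /andP[h1 h2] e; lra.
split => //.
  exists 0 => //; apply/eqP => /(congr1 (fun u : C * C => Re u.2)).
  by rewrite /h /cutoff ph0 /= mx// mulr0 subr0 subr0 mulr1 => e; move: gamma0; rewrite e ltxx.
apply/(pole_green p1i p2i qi m0 gamma0 V0 sh n hx hC (lexx gamma)).
  move=> y gy; rewrite /h /cutoff (max_idPl _) ?subr_le0//.
  by rewrite (_ : (0 : R)%:C = 0 :> C)// !mul0r.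
have hr := rim_root_hol m0 sh hx.
apply: (quo_has_pole (Ach_hol m p1i p2i qi _ hl g0) (Bph_hol m p1i p2i qi _ hl g0)
  (Nch_hol m p1i p2i qi hr hl g0) hd d0 hD n0 _ N0).
by rewrite hB.
Qed.

Lemma state_mult sh x n d : in_gap m x -> dsc_order sh x n d -> (0 < n)%N ->
  pole_multiplicity m p1 p2 q sh x%:C n.
Proof.
move=> hx hd n0; split; first exact: test_pole hd n0.
by move=> h k hC _; exact: pole_le hx hd hC.
Qed.

Lemma order_gt0 sh x n d : dsc_order sh x n d ->
  (0 < n)%N = (Dsc (rim_root m sh) gamma x%:C == 0).
Proof.
move=> [_ d0 [e e0 he]]; rewrite he ?subrr ?n1_0// expr0n mulf_eq0 (negbTE d0) orbF.
by case: n {he} => /= [|n]; rewrite ?oner_eq0 ?eqxx.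
Qed.

Lemma stateP sh x : in_gap m x ->
  state m p1 p2 q sh x%:C <-> Dsc (rim_root m sh) gamma x%:C = 0.
Proof.
move=> hx; have [n [d hd]] := dsc_order_exists p1i p2i qi m0 gamma0 V0 sh hx.
split=> [[h [k [hC _ hk]]]|/eqP].
  have kn := pole_le p1i p2i qi m0 gamma0 V0 hx hd hC hk.
  by apply/eqP; rewrite -(order_gt0 hd) (leq_trans _ kn)//; case: hk => F [P [_ _ []]].
rewrite -(order_gt0 hd) => n0; have [h [h1 h2 h3]] := test_pole hx hd n0.
by exists h, n.
Qed.

End State.
End TestFunction.

(** * Zeros on the real axis *)

Section SignParity.
Context {R : realType}.
Implicit Types (f g : R -> R) (x a b t v w : R) (s : seq R).

(** Taken at [w = x], the second clause says [g x != 0]; elsewhere it says that [g] keeps its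
    sign. *)
Definition real_order f x n := exists2 d : R, 0 < d & exists g,
  forall w, `|w - x| < d -> f w = (w - x) ^+ n * g w /\ 0 < g w * g x.

Lemma real_order_pos f x n d g : 0 < d ->
  (forall w, `|w - x| < d -> f w = (w - x) ^+ n * g w /\ 0 < g w * g x) ->
  forall w, `|w - x| < d -> w != x -> f w != 0.
Proof.
move=> d0 h w /h[-> k] wx; rewrite mulf_neq0 ?expf_neq0 ?subr_eq0//.
by apply/eqP => z; rewrite z mul0r ltxx in k.
Qed.

(** Passing through [x] multiplies the sign by [(-1)^n]: the product of the two powers is
    [(-1)^n ((x - t) (v - x))^n], and for [n > 0] both differences are positive since [f] is nonzero
    at [t] and [v]. *)
Lemma local_sign f x n d g t v : 0 < d ->
  (forall w, `|w - x| < d -> f w = (w - x) ^+ n * g w /\ 0 < g w * g x) ->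
  t <= x <= v -> `|t - x| < d -> `|v - x| < d -> f t != 0 -> f v != 0 ->
  0 < (-1) ^+ n * (f t * f v).
Proof.
move=> d0 h /andP[tx xv] td vd; have [et kt] := h t td; have [ev kv] := h v vd.
have gg : 0 < g t * g v.
  have g2 : 0 < g x ^+ 2.
    have [_] := h x ltac:(by rewrite subrr normr0).
    by rewrite -expr2.
  rewrite -(pmulr_lgt0 _ g2).
  have -> : g t * g v * g x ^+ 2 = (g t * g x) * (g v * g x) by ring.
  exact: mulr_gt0.
rewrite et ev => nt nv.
have -> : (-1) ^+ n * ((t - x) ^+ n * g t * ((v - x) ^+ n * g v)) =
    ((x - t) * (v - x)) ^+ n * (g t * g v).
  have -> : x - t = -1 * (t - x) by ring.
  by rewrite !exprMn; ring.
rewrite mulr_gt0//; case: n {et ev h} nt nv => [|n]; first by rewrite expr0.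
rewrite !mulf_eq0 !negb_or !expf_eq0 /= !subr_eq0 => /andP[t0 _] /andP[v0 _].
rewrite exprn_gt0// mulr_gt0// subr_gt0 lt_neqAle ?t0//.
by rewrite eq_sym v0.
Qed.

(** Finiteness of the zeros and the sign rule are carried together up to the supremum of the points
    where both hold; the local form at the supremum extends them beyond, or up to [b]. *)
Lemma sign_parity f (o : R -> nat) a b : a < b -> f a != 0 -> f b != 0 ->
  (forall x, a <= x <= b -> real_order f x (o x)) ->
  exists s, [/\ uniq s, forall x, x \in s <-> a < x < b /\ f x = 0 &
    0 < (-1) ^+ (\sum_(x <- s) o x)%N * (f a * f b)].
Proof.
move=> ab fa fb ho.
pose Q t := f t != 0 /\ exists s, [/\ uniq s, forall x, x \in s <-> a < x < t /\ f x = 0 &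
    0 < (-1) ^+ (\sum_(x <- s) o x)%N * (f a * f t)].
pose S := [set t | a <= t <= b /\ Q t].
have Sa : S a.
  split; first by rewrite lexx ltW.
  split => //; exists [::]; split => //.
    by move=> x; split=> // -[/andP[h1 h2] _]; have := lt_trans h1 h2; rewrite ltxx.
  by rewrite big_nil expr0 mul1r -expr2 exprn_even_gt0.
(* Crossing a neighbourhood with the local form at [x] extends the list of zeros from [t] to [v];
   [x] joins it exactly when [o x > 0], that is when [f x = 0]. *)
have ext x t v (d : R) g : 0 < d ->
    (forall w, `|w - x| < d -> f w = (w - x) ^+ (o x) * g w /\ 0 < g w * g x) ->
    a <= t -> t <= x <= v -> `|t - x| < d -> `|v - x| < d -> f v != 0 -> Q t -> Q v.
  move=> d0 h at_ /andP[tx xv] td vd fv [ft [s [us hs ps]]]; split => //.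
  have sg := local_sign d0 h (introT andP (conj tx xv)) td vd ft fv.
  have nz w : t <= w -> w <= v -> w != x -> f w != 0.
    move=> tw wv; apply: (real_order_pos d0 h).
    move: td vd; rewrite !ltr_norml => /andP[? ?] /andP[? ?].
    by apply/andP; split; lra.
  have st : 0 < (-1) ^+ (o x + \sum_(x <- s) o x)%N * (f a * f v).
    have f2 : 0 < f t ^+ 2 by rewrite exprn_even_gt0.
    rewrite -(pmulr_lgt0 _ f2) exprD.
    have := mulr_gt0 sg ps; congr (0 < _); ring.
  have [ox|ox] := posnP (o x).
    exists s; split => //; last by have := st; rewrite ox add0n.
    move=> w; split.
      by move=> /hs[/andP[aw wt] fw]; rewrite aw (lt_le_trans wt)// (le_trans tx).
    move=> [/andP[aw wv] fw]; apply/hs; rewrite aw fw; split => //=.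
    rewrite ltNge; apply/negP => tw; have [wx|wx] := eqVneq w x; last first.
      by have := nz w tw (ltW wv) wx; rewrite fw eqxx.
    have [e k] := h x ltac:(by rewrite subrr normr0).
    by move: fw; rewrite wx e ox expr0 mul1r => z; rewrite z mul0r ltxx in k.
  have fx : f x = 0.
    have [-> _] := h x ltac:(by rewrite subrr normr0).
    by rewrite subrr expr0n eqn0Ngt ox mul0r.
  have tx' : t < x by rewrite lt_neqAle tx andbT; apply: contraNneq ft => ->; rewrite fx.
  have xv' : x < v by rewrite lt_neqAle xv andbT; apply: contraNneq fv => <-; rewrite fx.
  exists (x :: s); split.
  - rewrite /= us andbT; apply/negP => /hs[/andP[_ k] _].
    by have := lt_trans tx' k; rewrite ltxx.
  - move=> w; rewrite in_cons; split.
      move=> /orP[/eqP ->|/hs[/andP[aw wt] fw]]; first by rewrite fx xv' (le_lt_trans at_).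
      by rewrite aw (lt_trans wt)// (lt_trans tx').
    move=> [/andP[aw wv] fw]; have [//|wx] := eqVneq w x; apply/hs.
    rewrite aw fw; split => //=; rewrite ltNge; apply/negP => tw.
    by have := nz w tw (ltW wv) wx; rewrite fw eqxx.
  - by rewrite big_cons; exact: st.
have hS : has_sup S by split; [exists a|exists b => t [/andP[]]].
set T := sup S.
have aT : a <= T by apply: ub_le_sup => //; case: hS.
have Tb : T <= b by apply: ge_sup; [exists a|move=> t [/andP[]]].
have [d d0 [g hg]] := ho T (introT andP (conj aT Tb)).
have [t St tT] := sup_adherent d0 hS.
have [/andP[at_ _] Qt] := St.
have tT' : t <= T by apply: ub_le_sup => //; case: hS.
have td : `|t - T| < d by rewrite ltr_norml; apply/andP; split; move: tT; rewrite -/T; lra.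
have [Tb'|Tb'] := eqVneq T b.
  have bd : `|b - T| < d by rewrite Tb' subrr normr0.
  by have [] := ext T t b d g d0 hg at_ (introT andP (conj tT' Tb)) td bd fb Qt.
have {}Tb : T < b by rewrite lt_neqAle Tb' Tb.
(* This point lies beyond the supremum but in its neighbourhood, where [f] can vanish only at [T];
   so [Q v] holds, against the choice of [T]. *)
pose v := Num.min b (T + d / 2).
have Tv : T < v by rewrite lt_min Tb ltrDl divr_gt0.
have vb : v <= b by rewrite ge_min lexx.
have vT : v <= T + d / 2 by rewrite ge_min lexx orbT.
have vd : `|v - T| < d by rewrite ltr_norml; apply/andP; split; lra.
have Qv : Q v.
  apply: (ext T t v d g d0 hg at_ _ td vd _ Qt); first by rewrite tT' ltW.
  by apply: (real_order_pos d0 hg vd); rewrite gt_eqF.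
have : v <= T by apply: ub_le_sup; [case: hS|split => //; rewrite vb (le_trans aT)// ltW].
by rewrite leNgt Tv.
Qed.

End SignParity.

(** * Signs of the denominator on the gap *)

Section RealAxis.
Context {R : realType}.
Local Notation C := (Cplx R).
Local Notation mu := (@lebesgue_measure R).
Implicit Types (x b : R) (sh : sheet).
Variables (m gamma : R) (p1 p2 q : R -> R).
Hypotheses (p1i : locint p1) (p2i : locint p2) (qi : locint q).
Hypotheses (m0 : 0 < m) (gamma0 : 0 < gamma).
Hypothesis V0 : {ae mu, forall x, gamma <= x -> [/\ p1 x = 0, p2 x = 0 & q x = 0]}.
Local Notation phi := (phi m p1 p2 q).
Local Notation Dsc := (dsc m p1 p2 q).
Local Notation dsc_order := (dsc_order m gamma p1 p2 q).

Lemma same_sign (u v : R) : `|u - v| < `|v| -> 0 < u * v.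
Proof.
have [vp|vp|->] := ltgtP v 0; last by rewrite normr0 ltNge normr_ge0.
  by rewrite (ltr0_norm vp) ltr_norml nmulr_lgt0// => /andP[? ?]; lra.
by rewrite (gtr0_norm vp) ltr_norml pmulr_lgt0// => /andP[? ?]; lra.
Qed.

Definition phi1 x : R := Re (phi x%:C gamma).1.
Definition phi2 x : R := Re (phi x%:C gamma).2.
Definition kapr x : R := Re (kap m x%:C).
Definition dscr sh x : R :=
  match sh with
  | physical => - kapr x * phi1 x - phi2 x * (x + m)
  | nonphysical => kapr x * phi1 x - phi2 x * (x + m)
  end.

Lemma phi_gammaE x : phi x%:C gamma = ((phi1 x)%:C, (phi2 x)%:C).
Proof.
move: (phi_real m p1i p2i qi x (ltW gamma0)); rewrite /phi1 /phi2 /cc.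
case: (phi x%:C gamma) => -[a1 b1] [a2 b2] /= [h1 h2].
by congr pair; apply: CP => //=; lra.
Qed.

Lemma krP x : in_gap m x -> [/\ 0 < kapr x, kapr x ^+ 2 = m ^+ 2 - x ^+ 2 & kap m x%:C = (kapr x)%:C].
Proof.
move=> hx; have k0 : 0 < kapr x by apply: kap_Re_gt0 => //; right.
move: k0 (kap2 m x%:C); rewrite /kapr; move: (kap m x%:C) => [u v] /= u0 e.
have := congr1 (@Re R) e; have := congr1 (@Im R) e; rewrite !expr2 !ReImE /= => e1 e2.
have v0 : v = 0.
  have : u * v == 0 by apply/eqP; lra.
  by rewrite mulf_eq0 gt_eqF//= => /eqP.
by split => //; [rewrite v0 in e2; lra|apply: CP].
Qed.

Lemma dscE sh x : in_gap m x -> Dsc (rim_root m sh) gamma x%:C = (dscr sh x)%:C.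
Proof.
move=> hx; have [_ _ ek] := krP hx.
rewrite /dsc /bform phi_gammaE /=.
by case: sh; rewrite /= ek; apply: CP; rewrite !ReImE /=; ring.
Qed.

Lemma f12_neq0 x : phi1 x = 0 -> phi2 x = 0 -> False.
Proof.
move=> h1 h2; have := phi_neq0 m p1i p2i qi x%:C (ltW gamma0).
by rewrite phi_gammaE h1 h2 => /eqP; apply.
Qed.

(** The denominator is real on the gap, so [Im d] vanishes at nearby real points other than [x], and
    at [x] by continuity. Hence [Re (d x)] is nonzero and [Re d] keeps its sign nearby. *)
Lemma dsc_real_order sh x n d : in_gap m x -> dsc_order sh x n d -> real_order (dscr sh) x n.
Proof.
move=> hx [hd d0 [e e0 he]]; have /andP[h1 h2] := hx.
have er w : (w%:C - x%:C : C) = (w - x)%:C by rewrite rmorphB.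
have n1r w : n1 (w%:C - x%:C : C) = `|w - x| by rewrite er n1_real.
pose r := Num.min e (Num.min (m - x) (x + m)).
have r0 : 0 < r by rewrite !lt_min e0; apply/andP; split; lra.
have hr w : `|w - x| < r -> (dscr sh w)%:C = ((w - x) ^+ n)%:C * d w%:C :> C.
  rewrite !lt_min => /and3P[w1 w2 w3]; rewrite -dscE; last first.
    by move: w2 w3; rewrite !ltr_norml => /andP[? ?] /andP[? ?]; apply/andP; split; lra.
  by rewrite he ?n1r// er rmorphXn.
have hc e1 : 0 < e1 -> exists2 t : R, 0 < t & forall w, `|w - x| < t -> n1 (d w%:C - d x%:C) < e1.
  by move=> /((continuousCP _ _).1 (hol_cont hd))[t t0 ht]; exists t => // w wt; apply: ht; rewrite n1r.
have ix : Im (d x%:C) = 0.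
  apply/eqP; rewrite -[_ == _]negbK; apply/negP => i0.
  have [t t0 ht] := hc `|Im (d x%:C)| ltac:(by rewrite normr_gt0).
  pose v := Num.min t r / 2.
  have v0 : 0 < v by rewrite divr_gt0// lt_min t0.
  have vv : `|x + v - x| < Num.min t r by rewrite addrC addKr ger0_norm ?ltW// /v gtr_pMr ?lt_min ?t0//; lra.
  move: vv; rewrite lt_min => /andP[/ht vt /hr/(congr1 (@Im R))].
  rewrite !ReImE /= mul0r addr0 => /esym/eqP.
  rewrite mulf_eq0 expf_eq0 addrC addKr (gt_eqF v0) andbF /= => /eqP iv.
  have := le_lt_trans (Im_le_n1 _) vt; by rewrite !ReImE iv add0r normrN ltxx.
have rx : Re (d x%:C) != 0 by apply: contraNneq d0 => rx; apply/eqP; apply: CP.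
have [t t0 ht] := hc `|Re (d x%:C)| ltac:(by rewrite normr_gt0).
exists (Num.min t r); first by rewrite lt_min t0.
exists (fun w => Re (d w%:C)) => w; rewrite lt_min => /andP[/ht wt /hr/(congr1 (@Re R))].
rewrite !ReImE /= mul0r subr0 => ->; split => //.
by apply: same_sign; have := le_lt_trans (Re_le_n1 _) wt; rewrite ReD ReN.
Qed.

(** A total function, as sums over lists of zeros require; in the gap the default is never taken, by
    [zmultP]. *)
Definition zmult sh x : nat := xget 0%N [set n | exists d, dsc_order sh x n d].

Lemma zmultP sh x : in_gap m x -> exists d, dsc_order sh x (zmult sh x) d.
Proof.
move=> hx; have [n h] := dsc_order_exists p1i p2i qi m0 gamma0 V0 sh hx.
exact: (@xgetPex _ 0%N [set n | exists d, dsc_order sh x n d] (ex_intro _ n h)).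
Qed.

Lemma gapI a b x : in_gap m a -> in_gap m b -> a <= x <= b -> in_gap m x.
Proof.
move=> /andP[h1 _] /andP[_ h2] /andP[h3 h4]; apply/andP; split.
  exact: lt_le_trans h3.
exact: le_lt_trans h2.
Qed.

Lemma dr_parity sh a b : a < b -> in_gap m a -> in_gap m b ->
  dscr sh a != 0 -> dscr sh b != 0 ->
  exists s, [/\ uniq s, forall x, x \in s <-> a < x < b /\ dscr sh x = 0 &
    0 < (-1) ^+ (\sum_(x <- s) zmult sh x)%N * (dscr sh a * dscr sh b)].
Proof.
move=> ab ha hb da db; apply: sign_parity => // x hx.
have hg := gapI ha hb hx; have [d hd] := zmultP sh hg.
exact: dsc_real_order hd.
Qed.

(** [kapr x / (x + m)] is [sqrt ((m - x) / (m + x))], a decreasing function; denominators are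
    cleared and squares compared. *)
Lemma kr_lt x y : in_gap m x -> in_gap m y -> x < y -> kapr y * (x + m) < kapr x * (y + m).
Proof.
move=> hx hy xy; have [kx ex _] := krP hx; have [ky ey _] := krP hy.
move: hx hy => /andP[x1 x2] /andP[y1 y2].
rewrite -(ltr_pXn2r (n := 2))// ?nnegrE ?mulr_ge0 ?ltW//; try lra.
rewrite !exprMn ex ey.
have -> : (m ^+ 2 - y ^+ 2) * (x + m) ^+ 2 = ((x + m) * (y + m)) * ((m - y) * (x + m)) by ring.
have -> : (m ^+ 2 - x ^+ 2) * (y + m) ^+ 2 = ((x + m) * (y + m)) * ((m - x) * (y + m)) by ring.
rewrite ltr_pM2l; last by rewrite mulr_gt0; lra.
have : 0 < m * (y - x) by rewrite mulr_gt0// subr_gt0.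
by lra.
Qed.

(** Here [(a, b)] and [(c, d)] stand for [phi] at [gamma] for the parameters [x] and [y], [k] and
    [l] for the two values of [kapr], and [J] for the integral in Lagrange's identity; the second
    hypothesis says that [x] is a zero on the physical sheet. *)
Lemma sign_algebra (x y a b c d k l J : R) : c * b - d * a = (y - x) * J ->
  b * (x + m) = - k * a ->
  (x + m) * (a * (- l * c - d * (y + m)) * (y - x)) =
  (x + m) * (y + m) * J * (y - x) ^+ 2 +
  c * a * ((k * (y + m) - l * (x + m)) * (y - x)).
Proof.
move=> W e.
have -> : (x + m) * (y + m) * J * (y - x) ^+ 2 =
  (x + m) * (y + m) * (y - x) * ((y - x) * J) by ring.
rewrite -W; have -> : (x + m) * (y + m) * (y - x) * (c * b - d * a) =
  (y + m) * (y - x) * (c * (b * (x + m)) - (x + m) * d * a) by ring.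
by rewrite e; ring.
Qed.

(* Lagrange's identity between [phi x] and [phi y] expresses [phi1 x * dscr y] through
   [int phi x . phi y] and [kapr x * (y + m) - kapr y * (x + m)], both of known sign. *)
Lemma sign_near x : in_gap m x -> dscr physical x = 0 -> exists2 e : R, 0 < e &
  forall y, `|y - x| < e -> in_gap m y -> y != x -> 0 < phi1 x * dscr physical y * (y - x).
Proof.
move=> hx dx; have [kx _ _] := krP hx; have g0 := ltW gamma0.
have [hp p0] := phiP m p1i p2i qi x%:C.
have f1x : phi1 x != 0.
  apply/eqP => z; apply: (f12_neq0 z).
  move: dx; rewrite /dscr z mulr0 sub0r => /eqP; rewrite oppr_eq0 mulf_eq0 => /orP[/eqP//|].
  by move: hx => /andP[h1 h2] /eqP ?; lra.
pose J (w : C) := integralC `[0, gamma]%classic (dotp (phi w) (phi x%:C)).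
have Jx : 0 < Re (J x%:C).
  have := dotp_cc_pos hp (lexx 0) gamma0; rewrite p0.
  move=> /(_ ltac:(by apply/eqP => /(congr1 snd)/eqP; rewrite oner_eq0)).
  congr (0 < _); apply: eq_Rintegral => t; rewrite inE /= in_itv/= => /andP[t0 _].
  by rewrite /dotp (phi_real m p1i p2i qi x t0).
have pl : lbm (phi x%:C) := dsol_lbm hp.
have Jc : {for x%:C, continuous J}.
  by apply: derivable_cont; apply: sol_derivable_int => //; [exact: gz_lbm|exact: pl].
have fc : {for x%:C, continuous (fun w => (phi w gamma).1)}.
  by apply: derivable_cont; apply: sol_derivable1 => //; exact: gz_lbm.
have [t1 t10 h1] := (continuousCP _ _).1 Jc _ Jx.
have [t2 t20 h2] := (continuousCP _ _).1 fc `|phi1 x| ltac:(by rewrite normr_gt0).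
exists (Num.min t1 t2); first by rewrite lt_min t10.
move=> y yx hy yx0; have n1r : n1 (y%:C - x%:C : C) = `|y - x|.
  by rewrite -rmorphB n1_real.
move: yx; rewrite lt_min -n1r => /andP[/h1 k1 /h2 k2].
have Jy : 0 < Re (J y%:C).
  have := le_lt_trans (Re_le_n1 _) k1; rewrite ReD ReN -[X in _ < X](gtr0_norm Jx).
  by move=> /same_sign; rewrite (pmulr_lgt0 _ Jx).
have fy : 0 < phi1 y * phi1 x.
  by apply: same_sign; have := le_lt_trans (Re_le_n1 _) k2; rewrite ReD ReN.
have [hq q0] := phiP m p1i p2i qi y%:C.
have W : phi1 y * phi2 x - phi2 y * phi1 x = (y - x) * Re (J y%:C).
  have [_] := lagrange hq hp g0.
  rewrite /wron !phi_gammaE p0 q0 /= mul0r mulr0 subrr add0r.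
  have -> : integralC `[0, gamma]%classic (fun t => (y%:C - x%:C) * dotp (phi y%:C) (phi x%:C) t
      + dotp (fun=> 0) (phi x%:C) t - dotp (phi y%:C) (fun=> 0) t) = (y - x)%:C * J y%:C.
    rewrite /J -integralCZ//; last first.
      exact: (dotp_int (dsol_lbm hq g0) (dsol_lbm hp g0)).
    apply: eq_integralC => t _.
    by rewrite rmorphB /dotp /= !mul0r !mulr0 !addr0 subr0.
  by move/(congr1 (@Re R)); rewrite !ReImE /= !mul0r !subr0.
have [ky _ _] := krP hy.
have e2 : phi2 x * (x + m) = - kapr x * phi1 x by apply/esym; exact: (subr0_eq dx).
have K : 0 < (kapr x * (y + m) - kapr y * (x + m)) * (y - x).
  have [xy|xy|e] := ltgtP x y; last by rewrite e eqxx in yx0.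
    by rewrite mulr_gt0 ?subr_gt0// kr_lt.
  by rewrite nmulr_rgt0 ?subr_lt0// kr_lt.
move: (hx) (hy) => /andP[x1 x2] /andP[y1 y2].
have xm : 0 < x + m by rewrite -ltrBlDr sub0r.
have ym : 0 < y + m by rewrite -ltrBlDr sub0r.
rewrite -(pmulr_rgt0 _ xm).
rewrite /dscr (sign_algebra _ W e2).
have y2x : 0 < (y - x) ^+ 2 by rewrite exprn_even_gt0//= subr_eq0.
exact: (addr_gt0 (mulr_gt0 (mulr_gt0 (mulr_gt0 xm ym) Jy) y2x) (mulr_gt0 fy K)).
Qed.

End RealAxis.

(** * The potential vanishes almost everywhere beyond [gamma] *)

Section Support.
Context {R : realType}.
Local Notation mu := (@lebesgue_measure R).

(** Points off the essential support have null neighbourhoods, and countably many rational balls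
    suffice to cover them. The point [gamma] itself is discarded as a null set. *)
Lemma esssupport_ae0 (p : R -> R) (gamma : R) : L2real p ->
  esssupport p `<=` `[0, gamma]%classic -> 0 <= gamma ->
  {ae mu, forall x, gamma <= x -> p x = 0}.
Proof.
move=> pL ps g0.
pose A : set R := halfline `&` [set y | p y != 0].
have mA : measurable (A : set (measurableTypeR R)).
  have [mp _] := (L2realP _).1 pL.
  have -> : A = halfline `&` p @^-1` (~` [set 0]).
    by rewrite /A; apply/seteqP; split => x [hx /eqP h].
  by apply: mp; [exact: halfline_meas|apply: measurableC; exact: measurable_set1].
pose B (r : rat * rat) : set R := ball (ratr r.1 : R) (ratr r.2) `&` A.
pose I k : set R := if @unpickle (rat * rat)%type k is Some r
  then (if `[< mu (B r) = 0%E >] then B r else set0) else set0.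
have IK r : mu (B r) = 0%E -> I (pickle r) = B r.
  by rewrite /I pickleK => /asboolP ->.
have I0 k : mu.-negligible (I k).
  rewrite /I; case: unpickle => [r|]; last exact: negligible_set0.
  case: asboolP => [h|_]; last exact: negligible_set0.
  apply/negligibleP => //; apply: measurableI => //; exact: measurable_ball.
have h1 := negligible_bigcup I0.
have h2 : mu.-negligible [set gamma] by apply/negligibleP; [exact: measurable_set1|exact: lebesgue_measure_set1].
have := negligibleU h1 h2; apply: negligibleS => y /= hy.
have [gy py] : gamma <= y /\ p y != 0.
  by split; [apply: contrapT|apply/eqP] => k; apply: hy.
have [->|yg] := eqVneq y gamma; [by right|left].
have gy' : gamma < y by rewrite lt_neqAle eq_sym yg.
have : ~ esssupport p y.
  by move=> /ps /=; rewrite in_itv/= => /andP[_]; rewrite leNgt gy'.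
move=> /existsNP[e /not_implyP[e0 /negP]]; rewrite -leNgt => em.
(* A rational ball of radius below [e / 2] that contains [y] lies within distance [e] of [y], hence
   is null. *)
have [r2 /andP[r20 r2e]] : exists r : rat, (0 : R) < ratr r < e / 2.
  have [r] := rat_in_itvoo (divr_gt0 e0 (ltr0Sn R 1)).
  by rewrite in_itv /= => h; exists r.
have [r1 /andP[r1l r1r]] : exists r : rat, (y : R) - ratr r2 < ratr r < y + ratr r2.
  have : (y : R) - ratr r2 < y + ratr r2 by rewrite ltrBlDr -addrA ltrDl addr_gt0.
  by move=> /rat_in_itvoo[r]; rewrite in_itv /= => h; exists r.
have m0 : mu (B (r1, r2)) = 0%E.
  apply/eqP; rewrite eq_le measure_ge0 andbT; apply: le_trans em.
  apply: le_outer_measure => z [bz [hz pz]]; split => //; split => //.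
  move: bz; rewrite /ball /= !ltr_norml => /andP[k1 k2]; apply/andP; split; lra.
exists (pickle (r1, r2)); first by [].
rewrite (IK _ m0); split; last first.
  by split => //; rewrite /halfline /= in_itv /= andbT (le_trans g0).
by rewrite /ball /= ltr_norml; apply/andP; split; lra.
Qed.

Lemma suppV_ae0 (p1 p2 q : R -> R) (gamma : R) : L2real p1 -> L2real p2 -> L2real q ->
  suppV p1 p2 q `<=` `[0, gamma]%classic -> 0 <= gamma ->
  {ae mu, forall x, gamma <= x -> [/\ p1 x = 0, p2 x = 0 & q x = 0]}.
Proof.
move=> h1 h2 h3 hs g0.
have a1 := esssupport_ae0 h1 (fun x hx => hs x (or_introl (or_introl hx))) g0.
have a2 := esssupport_ae0 h2 (fun x hx => hs x (or_introl (or_intror hx))) g0.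
have a3 := esssupport_ae0 h3 (fun x hx => hs x (or_intror hx)) g0.
have a12 := aeS2 (fun x (u : gamma <= x -> p1 x = 0) (v : gamma <= x -> p2 x = 0)
  (k : gamma <= x) => conj (u k) (v k)) a1 a2.
by apply: aeS2 a12 a3 => x u v gx; have [u1 u2] := u gx; split; rewrite ?v.
Qed.

End Support.

(** * Eigenvalues and anti-bound states as zeros of the two denominators *)

Theorem theorem1p2 (R : realType) (m gamma : R) (p1 p2 q : R -> R)
  (m_gt0 : 0 < m)
  (p1_L2 : L2real p1) (p2_L2 : L2real p2) (q_L2 : L2real q)
  (suppV_sub : suppV p1 p2 q `<=` `[0, gamma]%classic)
  (gammaE : gamma = sup (suppV p1 p2 q)) (gamma_gt0 : 0 < gamma) :
  (forall x : R, dirac_eigenvalue m p1 p2 q x -> ~ antibound_state m p1 p2 q x)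
  /\
  (forall x1 x2 : R, x1 < x2 ->
     dirac_eigenvalue m p1 p2 q x1 -> dirac_eigenvalue m p1 p2 q x2 ->
     (forall x, x1 < x < x2 -> ~ dirac_eigenvalue m p1 p2 q x) ->
     exists (s : seq R) (mult : R -> nat),
       [/\ uniq s,
           forall x, x \in s <-> x1 < x < x2 /\ antibound_state m p1 p2 q x,
           forall x, x \in s ->
             pole_multiplicity m p1 p2 q nonphysical x%:C (mult x) &
           odd (\sum_(x <- s) mult x)%N]).
Proof.
have p1i := L2real_locint p1_L2; have p2i := L2real_locint p2_L2.
have qi := L2real_locint q_L2.
have V0 := suppV_ae0 p1_L2 p2_L2 q_L2 suppV_sub (ltW gamma_gt0).
pose D := dscr m gamma p1 p2 q.
have st sh x : in_gap m x -> state m p1 p2 q sh x%:C <-> D sh x = 0.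
  move=> hx; rewrite (stateP p1i p2i qi m_gt0 gamma_gt0 V0 sh hx).
  rewrite (dscE p1i p2i qi m_gt0 gamma_gt0 sh hx).
  by rewrite -/(D sh x); split=> [/(congr1 (@complex.Re R))|->].
have evP x : dirac_eigenvalue m p1 p2 q x <-> in_gap m x /\ D physical x = 0.
  by split=> -[hx h]; split => //; apply/(st physical).
have abP x : antibound_state m p1 p2 q x <-> in_gap m x /\ D nonphysical x = 0.
  split=> [[hx [_ h]]|[hx h]]; first by split => //; apply/(st nonphysical).
  by split => //; split; [right; exists x|apply/(st nonphysical)].
have both x : in_gap m x -> D physical x = 0 -> D nonphysical x = 0 -> False.
  move=> hx h1 h2; have [k0 _ _] := krP m_gt0 hx.
  apply: (f12_neq0 p1i p2i qi gamma_gt0 (m := m) (x := x)).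
    have : kapr m x * phi1 m gamma p1 p2 q x == 0.
      by apply/eqP; move: h1 h2; rewrite /D /dscr; clear; lra.
    by rewrite mulf_eq0 gt_eqF//= => /eqP.
  have : phi2 m gamma p1 p2 q x * (x + m) == 0.
    by apply/eqP; move: h1 h2; rewrite /D /dscr; clear; lra.
  rewrite mulf_eq0 => /orP[/eqP//|/eqP xm]; move: hx => /andP[h3 h4].
  by exfalso; clear -xm h3; lra.
split=> [x /evP[hx h1] /abP[_ h2]|]; first exact: both hx h1 h2.
move=> x1 x2 x12 /evP[g1 z1] /evP[g2 z2] hn.
have D1 : D nonphysical x1 != 0 by apply/eqP => /(both x1 g1 z1).
have D2 : D nonphysical x2 != 0 by apply/eqP => /(both x2 g2 z2).
have [s [us hs ps]] := dr_parity p1i p2i qi m_gt0 gamma_gt0 V0 x12 g1 g2 D1 D2.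
set o := zmult m gamma p1 p2 q nonphysical in ps.
have hsg x : x \in s -> [/\ x1 < x < x2, in_gap m x & D nonphysical x = 0].
  move=> /hs[hx h]; split => //; apply: (gapI g1 g2).
  by move: hx => /andP[/ltW -> /ltW ->].
exists s, o; split => //.
- move=> x; split=> [/hsg[h1 h2 h3]|[h1 /abP[_ h2]]]; last by apply/hs.
  by split => //; apply/abP.
- move=> x /hsg[h1 h2 h3].
  have [d hd] := zmultP p1i p2i qi m_gt0 gamma_gt0 V0 nonphysical h2.
  apply: (state_mult p1i p2i qi m_gt0 gamma_gt0 V0 h2 hd).
  rewrite (order_gt0 hd) (dscE p1i p2i qi m_gt0 gamma_gt0 nonphysical h2).
  by rewrite -/(D nonphysical x) h3.
- have f12 : phi1 m gamma p1 p2 q x1 * phi1 m gamma p1 p2 q x2 < 0.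
    have [e1 e10 k1] := sign_near p1i p2i qi m_gt0 gamma_gt0 g1 z1.
    have [e2 e20 k2] := sign_near p1i p2i qi m_gt0 gamma_gt0 g2 z2.
    (* The third keeps [x1 + r < x2 - r], with each point in the range of [sign_near] for its
       eigenvalue. The displacement is [r] at [x1] and [- r] at [x2], whence the opposite signs in
       [q1] and [q2]. *)
    pose r := Num.min (Num.min e1 e2) (x2 - x1) / 3.
    have [r0 r1 r2 r3] : [/\ 0 < r, r < e1, r < e2 & 3 * r <= x2 - x1].
      have h : 0 < Num.min (Num.min e1 e2) (x2 - x1).
        by rewrite !lt_min e10 e20 subr_gt0.
      have a1 : Num.min (Num.min e1 e2) (x2 - x1) <= e1 by rewrite !ge_min lexx.
      have a2 : Num.min (Num.min e1 e2) (x2 - x1) <= e2 by rewrite !ge_min lexx orbT.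
      have a3 : Num.min (Num.min e1 e2) (x2 - x1) <= x2 - x1 by rewrite !ge_min lexx !orbT.
      by rewrite /r; split; clear -h a1 a2 a3; lra.
    have ga : in_gap m (x1 + r) by apply: (gapI g1 g2); apply/andP; split; clear -r0 r3; lra.
    have gb : in_gap m (x2 - r) by apply: (gapI g1 g2); apply/andP; split; clear -r0 r3; lra.
    have n1 : x1 + r != x1 by apply/eqP => k; clear -k r0; lra.
    have n2 : x2 - r != x2 by apply/eqP => k; clear -k r0; lra.
    have := k1 (x1 + r); rewrite [x1 + r - x1]addrC addKr (gtr0_norm r0).
    move=> /(_ r1 ga n1); rewrite (pmulr_lgt0 _ r0) => q1.
    have := k2 (x2 - r); rewrite [x2 - r - x2]addrC addKr normrN (gtr0_norm r0).
    move=> /(_ r2 gb n2); rewrite mulrN oppr_gt0 (pmulr_llt0 _ r0) => q2.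
    have ab : x1 + r < x2 - r by clear -r0 r3; lra.
    have Da : D physical (x1 + r) != 0 by apply/eqP => z; move: q1; rewrite -/D z mulr0 ltxx.
    have Db : D physical (x2 - r) != 0 by apply/eqP => z; move: q2; rewrite -/D z mulr0 ltxx.
    (* An empty list means that the physical denominator has the same sign at both points, which
       gives the claim; a listed zero would be an eigenvalue strictly between [x1] and [x2]. *)
    have [[|y s'] [_ hs' ps']] := dr_parity p1i p2i qi m_gt0 gamma_gt0 V0 ab ga gb Da Db.
      move: ps'; rewrite big_nil expr0 mul1r => q3.
      rewrite -(pmulr_llt0 _ q3).
      by rewrite mulrACA (pmulr_rlt0 _ q1).
    have /hs'[/andP[y1 y2] yz] := mem_head y s'.
    have yy : x1 < y < x2 by apply/andP; split; clear -y1 y2 r0; lra.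
    exfalso; apply: (hn y yy); apply/evP; split => //; apply: (gapI g1 g2).
    by move: yy => /andP[/ltW -> /ltW ->].
  have pn x : in_gap m x -> D physical x = 0 ->
      D nonphysical x = 2 * kapr m x * phi1 m gamma p1 p2 q x.
    by move=> _; rewrite /D /dscr => z; clear -z; lra.
  have [k1 _ _] := krP m_gt0 g1; have [k2 _ _] := krP m_gt0 g2.
  (* With an even total the sign rule would make the product of the two nonphysical denominators
     positive, yet it is a positive multiple of the negative number in [f12]. *)
  move: ps; rewrite -/D (pn x1)// (pn x2)// -signr_odd; case: odd => //.
  rewrite expr0 mul1r mulrACA pmulr_rgt0; last exact: (mulr_gt0 (mulr_gt0 _ k1) (mulr_gt0 _ k2)).
  by move=> /(lt_trans f12); rewrite ltxx.
Qed.
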